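(* Let $M$ be a hypersurface satisfying the setting RSS2 described in the context, and let $M_t$, $t\in[0,T[$ with $T<\infty$, be a maximal solution of the volume-preserving mean curvature flow $\frac{\partial X_t}{\partial t}=(\overline H_t-H_t)N_t$ with initial condition $M$ and such that $M_t$ meets $\partial G$ orthogonally at its boundary for every $t$. Let $\xi_i(T)$, $\eta_i(T)$ be the limits as $t\to T$ of the interior minima $\xi_i(t)$ and maxima $\eta_i(t)$ of $r_t:[a,b]\to\,]0,\infty[$ (see the context). Then for any closed interval $[c,d]\subset[a,b]$ not containing any of the points $a$, $\xi_i(T)$, $\eta_i(T)$, $b$, there exist $\delta>0$ and $t_2\in[0,T[$ such that $r_t(z)\ge\delta$ for all $z\in[c,d]$ and $t\in\,]t_2,T[$.
   Context: Ambient space. Let $J\subset\mathbb{R}$ be an interval and $B^n_R\subset\mathbb{R}^n$ the open Euclidean ball of radius $R\in\,]0,\infty]$. A rotationally symmetric space with respect to an axis is $\overline M=J\times B^n_R$ endowed with a $C^\infty$ Riemannian metric of the form $\overline g=dr^2+f^2(r)\,dz^2+h^2(r)\,g_S$ in the cylindrical coordinates $r=|x|$, $z$, $u=x/|x|$ of $(z,x)\in\overline M$, where $g_S$ is the standard metric of sectional curvature $1$ on $S^{n-1}$. The axis of rotation is $\{r=0\}$. Smoothness of $\overline g$ gives $f'(0)=0$, $h(0)=0$, $h'(0)=1$, and one normalizes $f(0)=1$; $'$ denotes the derivative with respect to $r$. Curvatures. $S_{zi}=-\frac{h'f'}{hf}$ is the sectional curvature of the plane spanned by $\partial_z$ and a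 unit vector $E_i$ tangent to the spheres $\{z=\text{const},\,r=\text{const}\}$; $S_{ri}=-\frac{h''}{h}$ is that of the plane spanned by $\partial_r$ and $E_i$. Setting RSS. For $a<b$ let $G=\{(r,z,u)\in\overline M: a\le z\le b\}$. $M$ is a smoothly embedded hypersurface of revolution around the axis of rotation, contained in $G$, generated by the graph of a function $r(z)>0$, $z\in[a,b]$ (i.e. $M=\{(r(z),z,u)\}$), with boundary $\partial M\subset\partial G$, which intersects $\partial G$ orthogonally at the boundary and encloses an $(n+1)$-volume $V$ inside $G$. Setting RSS2. $M$ is in the setting RSS and either (a) $S_{zi}<0$ and $S_{ri}\le 0$ on $\overline M$, or (b) $\overline M$ is the Euclidean space ($R=\infty$, $J=\mathbb{R}$, $f\equiv1$, $h(r)=r$). Flow. $X_t:M\to\overline M$ is a smooth family of immersions with image $M_t$; $N_t$ is the outward unit normal, $H_t$ is the trace of the Weingarten map $Y\mapsto\overline\nabla_YN_t$ (positive for round spheres in $\mathbb{R}^{n+1}$), and $\overline H_t=\int_{M_t}H_t\,dv_{g_t}\big/\int_{M_t}dv_{g_t}$. The boundary condition includes $\partial M_t\subset\partial G$. $[0,T[$ is the maximal time interval of existence. For every $t\in[0,T[$ the generating curve of $M_t$ is the graph of a smooth function $r_t(z)>0$, $z\in[a,b]$; a dot denotes the derivative with respect to $z$, and $\dot r_t(a)=\dot r_t(b)=0$. Critical points. It is known that there is $t_1\in[0,T[$ such that for $t\in[t_1,T[$ the number of zeros of $\dot r_t$ in $[a,b]$ is finite and constant in $t$, and $\ddot r_t\ne0$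 at each of them, so all critical points of $r_t$ are nondegenerate local minima or maxima. For such $t$, $\xi_i(t)$ denote the local minima and $\eta_i(t)$ the local maxima of $r_t$ in $]a,b[$, labelled in increasing order (they alternate). They are smooth functions of $t$ and the limits $\xi_i(T)=\lim_{t\to T}\xi_i(t)$ and $\eta_i(T)=\lim_{t\to T}\eta_i(t)$ exist. *)

(* Defs.v *)
From mathcomp Require Import all_boot all_order all_algebra.
From mathcomp Require Import all_classical all_reals all_analysis.

Set Implicit Arguments.
Unset Strict Implicit.
Unset Printing Implicit Defensive.

Import Order.TTheory GRing.Theory Num.Theory.
Import numFieldNormedType.Exports.

Local Open Scope classical_set_scope.
Local Open Scope ring_scope.

Section Smoothness.
Context {R : realType} {V W : normedModType R}.

(* For finite-dimensional V this is the usual C^k: the k-th order directional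
   derivatives along constant vectors exist and are continuous on U. *)
Fixpoint Ck (k : nat) (U : set V) (F : V -> W) : Prop :=
  if k is k'.+1 then
    forall v : V, (forall p, U p -> derivable F p v) /\ Ck k' U ('D_v F)
  else forall p, U p -> {for p, continuous F}.

(* A smooth map on a set A that need not be open (an interval, a submanifold
   with boundary) is represented by a total function that is smooth on an open
   neighbourhood of A, i.e. by one of its smooth extensions.  Derivatives at a
   point of A in directions tangent to A depend only on the values on A. *)
Definition smooth_near (A : set V) (F : V -> W) : Prop :=
  exists U : set V, [/\ open U, A `<=` U & forall k, Ck k U F].

End Smoothness.

(* Points (z, x) and tangent vectors of R x R^n; the library norm `|x| on 'rV_n
   is the sup norm, hence the Euclidean norm enorm below. *)
Notation pt R n := (R * 'rV[R]_n)%type.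

Section Ambient.
Context {R : realType} {n : nat}.

Definition dot (x y : 'rV[R]_n) : R := \sum_i x 0 i * y 0 i.

Definition enorm (x : 'rV[R]_n) : R := Num.sqrt (dot x x).

(* dr^2 + f(r)^2 dz^2 + h(r)^2 g_S in Cartesian coordinates: with r = |x|,
   u = x/r and v = (v.1, v.2), one has dz v = v.1 and dr v = <u, v.2>, and
   g_S is |x|^-2 times the Euclidean product of the components orthogonal to u.
   On the axis x = 0 the value is the one forced by continuity. *)
Definition metric (f h : R -> R) (p v w : pt R n) : R :=
  let r := enorm p.2 in
  f r ^+ 2 * (v.1 * w.1) +
  if p.2 == 0 then dot v.2 w.2
  else
    let dr y := dot p.2 y / r in
    dr v.2 * dr w.2 + (h r / r) ^+ 2 * (dot v.2 w.2 - dr v.2 * dr w.2).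

Definition cylinder (J : set R) (Rad : \bar R) : set (pt R n) :=
  [set p | J p.1 /\ ((enorm p.2)%:E < Rad)%E].

End Ambient.

(* The space J x B^n_Rad with its metric.  The equalities f'(0) = 0 and
   h'(0) = 1 are consequences of the smoothness of the metric. *)
Record rotsym (R : realType) (n : nat) := RotSym {
  zdom : set R;
  rad : \bar R;
  fz : R -> R;
  hu : R -> R;
  zdom_itv : is_interval zdom;
  rad_gt0 : (0 < rad)%E;
  fz_gt0 : forall r, 0 <= r -> (r%:E < rad)%E -> 0 < fz r;
  hu_gt0 : forall r, 0 < r -> (r%:E < rad)%E -> 0 < hu r;
  fz0 : fz 0 = 1;
  hu0 : hu 0 = 0;
  metric_smooth : forall v w : pt R n,
    smooth_near (cylinder zdom rad) (fun p => metric fz hu p v w) }.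

Section Curvature.
Context {R : realType} {n : nat} (S : rotsym R n).

Definition S_zi (r : R) : R :=
  - (derive1 (hu S) r * derive1 (fz S) r / (hu S r * fz S r)).

Definition S_ri (r : R) : R := - (derive1n 2 (hu S) r / hu S r).

(* S_zi < 0 and S_ri <= 0 on the whole space; on the axis a sectional
   curvature is the limit of its values at r > 0, and the limit of S_ri is
   <= 0 as soon as S_ri is. *)
Definition neg_curved : Prop :=
  (forall r, 0 < r -> (r%:E < rad S)%E -> S_zi r < 0 /\ S_ri r <= 0) /\
  (exists2 S0 : R, S0 < 0 & S_zi r @[r --> 0^'+] --> S0).

Definition euclidean : Prop :=
  [/\ rad S = +oo%E, zdom S = setT &
      forall r, 0 <= r -> fz S r = 1 /\ hu S r = r].

End Curvature.

Section Hypersurfaces.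
Context {R : realType} {n : nat} (S : rotsym R n).
Local Notation g := (metric (fz S) (hu S)).

Definition revolution (a b : R) (rho : R -> R) : set (pt R n) :=
  [set p | a <= p.1 <= b /\ enorm p.2 = rho p.1].

(* negative inside the hypersurface generated by rho, positive outside *)
Definition height (rho : R -> R) (p : pt R n) : R := enorm p.2 - rho p.1.

Definition tangent (rho : R -> R) (p v : pt R n) : Prop :=
  'D_v (height rho) p = 0.

Definition normal (rho : R -> R) (p v : pt R n) : Prop :=
  forall w, tangent rho p w -> g p v w = 0.

Definition outward_unit_normal (a b : R) (rho : R -> R)
    (N : pt R n -> pt R n) : Prop :=
  smooth_near (revolution a b rho) N /\
  forall p, revolution a b rho p ->
    [/\ normal rho p (N p), g p (N p) (N p) = 1
      & 0 < 'D_(N p) (height rho) p].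

(* The boundary of G consists of the slices z = a and z = b, whose normal is
   the coordinate field (1, 0) since the metric has no mixed terms in dz. *)
Definition meets_orthogonally (a b : R) (rho : R -> R) : Prop :=
  forall p v, revolution a b rho p -> p.1 = a \/ p.1 = b ->
    normal rho p v -> g p v (1, 0) = 0.

(* D is the Levi-Civita derivative of the field Y at p in the direction v:
   Koszul's formula for the (commuting) constant fields v, Y p and w. *)
Definition is_covariant_derivative (p v : pt R n) (Y : pt R n -> pt R n)
    (D : pt R n) : Prop :=
  forall w, g p D w = g p ('D_v Y p) w +
    ('D_v (fun q => g q (Y p) w) p + 'D_(Y p) (fun q => g q v w) p
     - 'D_w (fun q => g q v (Y p)) p) / 2.

Definition tangent_basis (rho : R -> R) (p : pt R n) (e : 'I_n -> pt R n) :=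
  [/\ forall i, tangent rho p (e i),
      forall c : 'I_n -> R, \sum_i c i *: e i = 0 -> forall i, c i = 0 &
      forall v, tangent rho p v -> exists c : 'I_n -> R, v = \sum_i c i *: e i].

(* H is the trace of the Weingarten map, whose matrix in the basis e is A. *)
Definition is_mean_curvature (rho : R -> R) (N : pt R n -> pt R n)
    (p : pt R n) (H : R) : Prop :=
  exists (e : 'I_n -> pt R n) (A : 'M[R]_n),
    [/\ tangent_basis rho p e,
        forall j, is_covariant_derivative p (e j) N (\sum_i A i j *: e i)
      & H = \tr A].

Definition borel_rV := g_sigma_algebraType (@open 'rV[R]_n).

Definition sphere : set borel_rV := [set u | enorm (u : 'rV[R]_n) = 1].

(* The Riemannian measure of the round sphere S^(n-1), up to a positive
   constant factor: the rotation-invariant measure. *)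
Definition sphere_measure
    (sigma : {finite_measure set borel_rV -> \bar R}) : Prop :=
  [/\ sigma (~` sphere) = 0%E, sigma sphere <> 0%E &
      forall (Q : 'M[R]_n) (A : set borel_rV), Q *m Q^T = 1%:M ->
        measurable A -> sigma [set u | A ((u : 'rV[R]_n) *m Q)] = sigma A].

(* In the coordinates (z, u) the metric induced on the hypersurface generated
   by rho is (f(rho)^2 + rho'^2) dz^2 + h(rho)^2 g_S. *)
Definition area_density (rho : R -> R) (z : R) : R :=
  Num.sqrt (fz S (rho z) ^+ 2 + derive1 rho z ^+ 2) * hu S (rho z) ^+ n.-1.

Definition surface_integral
    (sigma : {finite_measure set borel_rV -> \bar R})
    (a b : R) (rho : R -> R) (phi : pt R n -> R) : R :=
  \int[lebesgue_measure]_(z in `[a, b])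
    (area_density rho z *
     \int[sigma]_(u in sphere) phi (z, rho z *: (u : 'rV[R]_n))).

(* The normalization of sigma cancels in the quotient. *)
Definition is_average (a b : R) (rho : R -> R) (phi : pt R n -> R) (c : R) :=
  exists2 sigma, sphere_measure sigma &
    c = surface_integral sigma a b rho phi /
        surface_integral sigma a b rho (fun=> 1).

(* The hypersurface generated by rho; it encloses the region of G where
   |x| < rho(z). *)
Definition RSS (a b : R) (rho : R -> R) : Prop :=
  [/\ a < b, `[a, b] `<=` zdom S, smooth_near `[a, b] rho,
      forall z, a <= z <= b -> 0 < rho z /\ ((rho z)%:E < rad S)%E &
      meets_orthogonally a b rho].

Definition RSS2 (a b : R) (rho : R -> R) : Prop :=
  RSS a b rho /\ (neg_curved S \/ euclidean S).

Definition space_time (T : R) (M : set (pt R n)) : set (R * pt R n) :=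
  [set q | 0 <= q.1 < T /\ M q.2].

(* X t, 0 <= t < T, solves the volume-preserving mean curvature flow starting
   from the hypersurface M generated by rho0, and X t (M) is the hypersurface
   generated by r t. *)
Record vpmc_flow (a b : R) (rho0 : R -> R) (T : R)
    (X : R -> pt R n -> pt R n) (r : R -> R -> R) : Prop := VpmcFlow {
  flow_smooth :
    smooth_near (space_time T (revolution a b rho0)) (fun q => X q.1 q.2);
  flow_init : forall p, revolution a b rho0 p -> X 0 p = p;
  flow_immersion : forall t p v, 0 <= t < T -> revolution a b rho0 p ->
    tangent rho0 p v -> v <> 0 -> 'D_v (X t) p <> 0;
  flow_image : forall t, 0 <= t < T ->
    X t @` revolution a b rho0 = revolution a b (r t);
  flow_graph_smooth :
    smooth_near [set q : R * R | 0 <= q.1 < T /\ a <= q.2 <= b]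
      (fun q => r q.1 q.2);
  flow_graph : forall t z, 0 <= t < T -> a <= z <= b ->
    0 < r t z /\ ((r t z)%:E < rad S)%E;
  flow_boundary : forall t p, 0 <= t < T -> revolution a b rho0 p ->
    p.1 = a \/ p.1 = b -> (X t p).1 = a \/ (X t p).1 = b;
  flow_orthogonal : forall t, 0 <= t < T -> meets_orthogonally a b (r t);
  flow_equation : forall t, 0 <= t < T ->
    exists (N : pt R n -> pt R n) (H : pt R n -> R) (Hbar : R),
    [/\ outward_unit_normal a b (r t) N,
        forall q, revolution a b (r t) q -> is_mean_curvature (r t) N q (H q),
        is_average a b (r t) H Hbar &
        forall p, revolution a b rho0 p ->
          derive1 (X^~ p) t = (Hbar - H (X t p)) *: N (X t p)] }.

Definition maximal_vpmc_flow (a b : R) (rho0 : R -> R) (T : R)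
    (X : R -> pt R n -> pt R n) (r : R -> R -> R) : Prop :=
  vpmc_flow a b rho0 T X r /\
  ~ exists T' X' r', [/\ T < T', vpmc_flow a b rho0 T' X' r' &
      forall t p, 0 <= t < T -> revolution a b rho0 p -> X' t p = X t p].

End Hypersurfaces.

Section CriticalPoints.
Context {R : realType}.

Definition local_min (rho : R -> R) (z : R) : Prop :=
  \forall y \near z, rho z <= rho y.

Definition local_max (rho : R -> R) (z : R) : Prop :=
  \forall y \near z, rho y <= rho z.

(* xi_0 < ... < xi_(k-1) are smooth on [t1, T[, enumerate the points of ]a, b[
   where P holds of r t, and converge to xiT as t tends to T. *)
Definition enumerates (P : (R -> R) -> R -> Prop) (a b t1 T : R)
    (r : R -> R -> R) (k : nat) (xi : 'I_k -> R -> R) (xiT : 'I_k -> R) :=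
  [/\ forall t, t1 <= t < T -> forall i j : 'I_k, (i < j)%N -> xi i t < xi j t,
      forall t, t1 <= t < T ->
        [set z | a < z < b /\ P (r t) z] = range (fun i => xi i t),
      forall i, smooth_near [set t | t1 <= t < T] (xi i) &
      forall i, xi i t @[t --> T^'-] --> xiT i].

Definition nondegenerate_critical (a b t1 T : R) (r : R -> R -> R) : Prop :=
  exists m : nat, forall t, t1 <= t < T ->
    ([set z | (a <= z <= b)%R /\ derive1 (r t) z = 0%R] #= `I_m)%card /\
    forall z, a <= z <= b -> derive1 (r t) z = 0 -> derive1n 2 (r t) z <> 0.

End CriticalPoints.

(* Main.v *)
Require Import Defs.
From mathcomp Require Import all_boot all_order all_algebra.
From mathcomp Require Import all_classical all_reals all_analysis.
From mathcomp Require Import measurable_realfun ring lra.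
Set Implicit Arguments.
Unset Strict Implicit.
Unset Printing Implicit Defensive.
Import Order.TTheory GRing.Theory Num.Theory.
Import numFieldNormedType.Exports.
Local Open Scope classical_set_scope.
Local Open Scope ring_scope.

(* The generating curve [u(t, z)] of [M_t], with [p = u_z] and [q = u_zz],
   satisfies

     u_t = (q - G (f^2 + 2 p^2)) / (f^2 + p^2) - (n-1) h'/h + Hbar sqrt(1 + p^2/f^2)

   where [G = f'/f] and [f], [h] are taken at [u].  The averaged mean curvature
   [Hbar] is nonnegative: up to the boundary term [-(psi h^(n-1))'] with
   [psi = arctan(p/f)], the density of [H] is
   [h^(n-1) f' + (n-1) h^(n-2) h' (f + psi p)], and [f', h' >= 0].

   On an interval [[al, be]] slightly larger than [[c, d]] the slope [p] has, for
   [t] close to [T], no zero; reflecting in [z], say [p > 0].  Then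
   [p > c(z) (rho(t) - u)] is preserved, where [c = eps ((z - al) (be - z))^2],
   [rho] is a small constant decreasing linearly in time and [eps] is small
   enough at the initial time.  At a first touching point the singular terms
   coming from [h'/h] are bounded below, and the factor [rho(t) - u] makes the
   terms with [Hbar] add up to a nonnegative multiple of [Hbar], so that no upper
   bound on [Hbar] is needed.  Hence, where [u] is small, [p] is bounded below by
   a positive constant, and so is [u] to the right. *)

(** The order of choices matters. The rate at which [rho] decreases depends on [n], on [be - al] and
    on bounds for the metric near the axis, but neither on [eps] nor on the solution. Since [T] is
    finite, the initial time can be moved towards [T] until [rho] loses at most half of its size
    before [T]; [eps] is fixed only afterwards, from the minimum of the slope at that time. The rate
    can be free of [eps] because every term of the inequality at a touching point carries a factor
    [c], and [c'' >= - B c] with [B] depending on the length of the interval only. The geometric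
    input comes from weak data. Smoothness means directional derivatives along constant vectors, for
    some extension of the map. The metric is smooth in Cartesian coordinates, so [f] and [h] are
    reached through its coefficients [f^2] and [(h/r)^2]. The normal is prescribed on the
    hypersurface only, so it is differentiated along curves that stay there. *)

Local Notation rad := Defs.rad.

(** * Calculus along lines *)

Section Lines.
Context {R : realType} {V W : normedModType R}.
Implicit Types (F : V -> W) (p v : V).

Lemma line_quotient F p v s w :
  (fun h : R => h^-1 *: (((fun s : R => F (p + s *: v)) \o shift s) (h *: w)
                         - F (p + s *: v))) =
  (fun h : R => h^-1 *: ((F \o shift (p + s *: v)) (h *: (w *: v))
                         - F (p + s *: v))).
Proof.
apply/funext => h /=; congr (_ *: (F _ - _)).
by rewrite scalerDl -[(h *: w) *: v]scalerA addrCA addrA.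
Qed.

Lemma derivable_line F p v (s w : R) :
  derivable (fun s : R => F (p + s *: v)) s w =
  derivable F (p + s *: v) (w *: v).
Proof. by rewrite /derivable line_quotient. Qed.

Lemma derive_line F p v (s w : R) :
  'D_w (fun s : R => F (p + s *: v)) s = 'D_(w *: v) F (p + s *: v).
Proof. by rewrite /derive line_quotient. Qed.

Lemma line_continuous p v : continuous (fun s : R => p + s *: v).
Proof.
move=> s; apply: cvgD; first exact: cvg_cst.
by apply: cvgZr_tmp; exact: cvg_id.
Qed.

Lemma Ck_line k (U : set V) F p v : Ck k U F ->
  Ck k [set s : R | U (p + s *: v)] (fun s : R => F (p + s *: v)).
Proof.
elim: k F => [|k IH] F /=.
  move=> cF s Us; apply: continuous_comp; first exact: line_continuous.
  exact: cF.
move=> CF w; have [dF cF] := CF (w *: v); split.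
  by move=> s Us; rewrite derivable_line; exact: dF.
have -> : 'D_w (fun s : R => F (p + s *: v)) =
          (fun s : R => 'D_(w *: v) F (p + s *: v)).
  by apply/funext => s; exact: derive_line.
exact: (IH ('D_(w *: v) F)) cF.
Qed.

Lemma Ck_subset k (U U' : set V) F : U `<=` U' -> Ck k U' F -> Ck k U F.
Proof.
move=> UU'; elim: k F => [|k IH] F /=; first by move=> c p /UU'; exact: c.
move=> c v; have [d c'] := c v.
by split => [p /UU'|]; [exact: d|exact: IH].
Qed.

Lemma open_line (U : set V) p v : open U -> open [set s : R | U (p + s *: v)].
Proof.
by move=> oU; apply: open_comp => // s _; exact: line_continuous.
Qed.

End Lines.

Section MeanValue.
Context {R : realType}.

(** Stated on the symmetric neighbourhood of [a] reaching to [b], so that increments of either sign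
    are covered at once. *)
Lemma mean_value (f df : R -> R) (a b : R) :
  (forall x, `|x - a| <= `|b - a| -> is_derive x 1 f (df x)) ->
  exists2 x, `|x - a| <= `|b - a| & f b - f a = df x * (b - a).
Proof.
move=> dfP.
have cf x : `|x - a| <= `|b - a| -> {for x, continuous f}.
  move=> /dfP [fx _]; exact/differentiable_continuous/derivable1_diffP.
have cw c d : (forall x, c <= x <= d -> `|x - a| <= `|b - a|) ->
    {within `[c, d], continuous f}.
  move=> H; apply: continuous_in_subspaceT => x; rewrite inE/= in_itv/= => xcd.
  exact/cf/H.
have [ab|ba] := leP a b.
  have H x : a <= x <= b -> `|x - a| <= `|b - a|.
    by move=> /andP[ax xb]; rewrite !ger0_norm; lra.
  have [x|x xab ->] := @MVT_segment _ f df a b ab _ (cw _ _ H).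
    by rewrite in_itv/= => /andP[ax xb]; apply/dfP/H; lra.
  by exists x => //; apply: H; rewrite in_itv/= in xab.
have H x : b <= x <= a -> `|x - a| <= `|b - a|.
  by move=> /andP[ax xb]; rewrite !ler0_norm; lra.
have [x|x xab E] := @MVT_segment _ f df b a (ltW ba) _ (cw _ _ H).
  by rewrite in_itv/= => /andP[ax xb]; apply/dfP/H; lra.
exists x; first by apply: H; rewrite in_itv/= in xab.
by rewrite -[LHS]opprB E; ring.
Qed.

End MeanValue.

Section ChainRule.
Context {R : realType} {V : normedModType R}.

Lemma mean_value_line (F : V -> R) (p v : V) (c : R) :
  (forall s : R, `|s| <= `|c| -> derivable F (p + s *: v) v) ->
  exists2 s : R, `|s| <= `|c| &
    F (p + c *: v) - F p = c * 'D_v F (p + s *: v).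
Proof.
move=> dF.
have [|s] := @mean_value _ (fun s : R => F (p + s *: v))
    (fun s => 'D_v F (p + s *: v)) 0 c.
  move=> s; rewrite !subr0 => sc; split.
    by rewrite derivable_line scale1r; exact: dF.
  by rewrite derive_line scale1r.
rewrite !subr0 scale0r addr0 => sc ->; exists s => //.
by rewrite mulrC.
Qed.

(* Moving the base point of the curve one direction at a time, the chain rule
   only needs directional derivatives that are continuous. *)
Lemma is_derive_add_dir (F : V -> R) (U : set V) (gam : R -> V) (c : R -> R)
    (v : V) (x l d : R) :
  open U -> U (gam x) -> (forall q, U q -> derivable F q v) ->
  {for gam x, continuous ('D_v F)} -> {for x, continuous gam} ->
  c x = 0 -> is_derive x 1 c d -> is_derive x 1 (F \o gam) l ->
  is_derive x 1 (fun s => F (gam s + c s *: v)) (l + d * 'D_v F (gam x)).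
Proof.
move=> oU Ux dF cD cgam cx0 /is_derive1_caratheodory[gc [cE cgc gcx]].
move=> /is_derive1_caratheodory[gl [lE cgl glx]].
apply/is_derive1_caratheodory.
(* [c] may vanish at points other than [x]; there the difference quotient is replaced by the
   directional derivative, so that [DE] holds for every [s]. *)
pose D s := if c s == 0 then 'D_v F (gam s)
            else (F (gam s + c s *: v) - F (gam s)) / c s.
have DE s : F (gam s + c s *: v) - F (gam s) = c s * D s.
  rewrite /D; case: eqP => [->|/eqP c0]; last by rewrite mulrC divfK.
  by rewrite scale0r addr0 subrr mul0r.
exists (fun s => gl s + gc s * D s); split.
- move=> s; rewrite cx0 scale0r addr0 mulrDl -lE mulrAC -cE cx0 subr0 -DE /=.
  by ring.
- apply: cvgD; first exact: cgl.
  apply: cvgM; first exact: cgc.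
  have DxE : D x = 'D_v F (gam x) by rewrite /D cx0 eqxx.
  rewrite DxE; apply/cvgrPdist_lt => e e0.
  have : \forall q \near gam x, U q /\ `|'D_v F (gam x) - 'D_v F q| < e.
    near=> q; split; first by near: q; exact: open_nbhs_nbhs.
    by near: q; move/cvgrPdist_lt : cD; exact.
  move=> /nbhs_ballP[r/= r0 rP].
  have cc : c s @[s --> x] --> (0 : R).
    rewrite -cx0; apply/differentiable_continuous/derivable1_diffP.
    suff [] : is_derive x 1 c d by [].
    by apply/is_derive1_caratheodory; exists gc.
  have near_in s (y : R) : `|gam x - gam s| < r / 2 -> `|c s *: v| < r / 2 ->
      `|y| <= `|c s| -> ball (gam x) r (gam s + y *: v).
    move=> h1 h2 h3; rewrite -ball_normE /= opprD addrA.
    apply: le_lt_trans (ler_normB _ _) _.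
    rewrite [r in ltRHS]splitr; apply: ltrD => //.
    by apply: le_lt_trans h2; rewrite !normrZ ler_wpM2r.
  near=> s.
  have h1 : `|gam x - gam s| < r / 2.
    by near: s; move/cvgrPdist_lt : cgam; apply; rewrite divr_gt0.
  have h2 : `|c s *: v| < r / 2.
    near: s.
    have : (c s *: v) @[s --> x] --> (0 : R) *: v.
      by apply: cvgZr_tmp.
    rewrite scale0r => /cvgr0Pnorm_lt; apply; exact: divr_gt0.
  rewrite /D; case: eqP => [cs0|/eqP cs0].
    have := near_in s 0 h1 h2; rewrite normr0 => /(_ (normr_ge0 _)).
    by move=> /rP; rewrite scale0r addr0 => -[].
  have [y yc|y yc ->] := @mean_value_line F (gam s) v (c s).
    by apply: dF; apply: (rP _ _).1; exact: near_in.
  rewrite mulrC mulKf //.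
  by apply: (rP _ _).2; exact: near_in.
- by rewrite /D cx0 eqxx glx gcx.
Unshelve. all: by end_near. Qed.

End ChainRule.

Section RealDerivatives.
Context {R : realType} {V : normedModType R}.
Implicit Types (f g : V -> R) (x v : V) (a b : R).

Lemma drv_eq f x v a b : is_derive x v f a -> a = b -> is_derive x v f b.
Proof. by move=> + <-. Qed.

Lemma drv_cst (a : R) x v : is_derive x v (fun=> a) 0.
Proof. exact: is_derive_cst. Qed.

Lemma drv_add f g x v a b : is_derive x v f a -> is_derive x v g b ->
  is_derive x v (fun y => f y + g y) (a + b).
Proof. exact: is_deriveD. Qed.

Lemma drv_sub f g x v a b : is_derive x v f a -> is_derive x v g b ->
  is_derive x v (fun y => f y - g y) (a - b).
Proof. exact: is_deriveB. Qed.

Lemma drv_opp f x v a : is_derive x v f a -> is_derive x v (fun y => - f y) (- a).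
Proof. exact: is_deriveN. Qed.

Lemma drv_mul f g x v a b : is_derive x v f a -> is_derive x v g b ->
  is_derive x v (fun y => f y * g y) (a * g x + f x * b).
Proof.
move=> df dg; apply: drv_eq (is_deriveM df dg) _.
by rewrite /GRing.scale/= addrC mulrC [f x * b]mulrC [b * f x]mulrC.
Qed.

Lemma drv_scale (k : R) f x v a : is_derive x v f a ->
  is_derive x v (fun y => k * f y) (k * a).
Proof. by move=> df; apply: drv_eq (drv_mul (drv_cst k x v) df) _; ring. Qed.

Lemma drv_sqr f x v a : is_derive x v f a ->
  is_derive x v (fun y => f y ^+ 2) (2 * f x * a).
Proof.
move=> df; apply: drv_eq (drv_mul df df) _; ring.
Qed.

Lemma drv_inv f x v a : is_derive x v f a -> f x != 0 ->
  is_derive x v (fun y => (f y)^-1) (- a / f x ^+ 2).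
Proof.
move=> [df <-] f0; split; first exact: derivableV.
by rewrite deriveV// /GRing.scale/= mulrC mulrN mulNr.
Qed.

Lemma drv_div f g x v a b : is_derive x v f a -> is_derive x v g b -> g x != 0 ->
  is_derive x v (fun y => f y / g y) ((a * g x - f x * b) / g x ^+ 2).
Proof.
move=> df dg g0; have dgi := drv_inv dg g0.
by apply: drv_eq (drv_mul df dgi) _; field.
Qed.

End RealDerivatives.

Section RealDerivatives1.
Context {R : realType}.
Implicit Types (f g : R -> R) (x a b : R).

Lemma drv_id x : is_derive x 1 (fun y : R => y) 1.
Proof. exact: is_derive_id. Qed.

Lemma drv_sqrt f x a : is_derive x 1 f a -> 0 < f x ->
  is_derive x 1 (fun y => Num.sqrt (f y)) (a / (2 * Num.sqrt (f x))).
Proof.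
move=> df f0; have h := is_derive1_sqrt f0.
by apply: drv_eq (is_derive1_comp h df) _; rewrite mulrC.
Qed.

Lemma drv_comp f g x a b : is_derive (g x) 1 f a -> is_derive x 1 g b ->
  is_derive x 1 (fun y => f (g y)) (a * b).
Proof. exact: is_derive1_comp. Qed.

Lemma drv_exprn f x a n : is_derive x 1 f a ->
  is_derive x 1 (fun y => f y ^+ n) (n%:R * f x ^+ n.-1 * a).
Proof.
move=> df; elim: n => [|n IH].
  by rewrite mul0r mul0r; exact: drv_cst.
have -> : (fun y => f y ^+ n.+1) = (fun y => f y * f y ^+ n).
  by apply/funext => y; rewrite exprS.
apply: drv_eq (drv_mul df IH) _ => /=.
case: n {IH} => [|n] /=; first by rewrite !expr0; ring.
by rewrite [in LHS]exprS exprS -[n.+2%:R]natr1; ring.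
Qed.

Lemma drv_continuous f x a : is_derive x 1 f a -> {for x, continuous f}.
Proof. by move=> [fx _]; exact/differentiable_continuous/derivable1_diffP. Qed.

End RealDerivatives1.

(** * Symmetry of mixed directional derivatives *)

Section Schwarz.
Context {R : realType} {V : normedModType R}.

Lemma derivable_shift (F : V -> R) (p q v : V) :
  derivable F (p + q) v -> derivable (fun x => F (x + q)) p v.
Proof.
have E : (fun h : R => h^-1 *: (((fun x => F (x + q)) \o shift p) (h *: v)
            - F (p + q))) =
         (fun h : R => h^-1 *: ((F \o shift (p + q)) (h *: v) - F (p + q))).
  by apply/funext => h /=; rewrite addrA.
by rewrite /derivable E.
Qed.

Lemma derive_shift_point (F : V -> R) (p q v : V) :
  'D_v (fun x => F (x + q)) p = 'D_v F (p + q).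
Proof.
have E : (fun h : R => h^-1 *: (((fun x => F (x + q)) \o shift p) (h *: v)
            - F (p + q))) =
         (fun h : R => h^-1 *: ((F \o shift (p + q)) (h *: v) - F (p + q))).
  by apply/funext => h /=; rewrite addrA.
by rewrite /derive E.
Qed.

(** The second difference is the increment along [v] of the increment along [w]; the mean value
    theorem is applied once in each direction. *)
Lemma second_difference (F : V -> R) (p v w : V) (s : R) :
  (forall y z : R, `|y| <= `|s| -> `|z| <= `|s| ->
     derivable F (p + y *: v + z *: w) v /\
     derivable ('D_v F) (p + y *: v + z *: w) w) ->
  exists y z : R, [/\ `|y| <= `|s|, `|z| <= `|s| &
    F (p + s *: v + s *: w) - F (p + s *: v) - F (p + s *: w) + F p
    = s ^+ 2 * 'D_w ('D_v F) (p + y *: v + z *: w)].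
Proof.
move=> dF; pose G x := F (x + s *: w) - F x.
have dG y : `|y| <= `|s| -> derivable (fun x => F (x + s *: w)) (p + y *: v) v.
  by move=> ys; apply: derivable_shift; have [] := dF y s ys (lexx _).
have dF0 y : `|y| <= `|s| -> derivable F (p + y *: v) v.
  move=> ys; have [|+ _] := dF y 0 ys _; first by rewrite normr0.
  by rewrite scale0r addr0.
have [|y ys] := @mean_value_line R V G p v s.
  by move=> y ys; apply: derivableB; [exact: dG|exact: dF0].
rewrite deriveB; [|exact: dG|exact: dF0].
rewrite derive_shift_point => E.
have [|z zs] := @mean_value_line R V ('D_v F) (p + y *: v) w s.
  by move=> z zs; have [] := dF y z ys zs.
move=> E'; exists y, z; split => //.
rewrite E' in E; rewrite expr2 -mulrA -E /G; ring.
Qed.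

Lemma ball_close (A B : V -> R) (U : set V) (p : V) (e : R) :
  open U -> U p -> {for p, continuous A} -> {for p, continuous B} -> 0 < e ->
  exists2 r : R, 0 < r & forall q, ball p r q ->
    [/\ U q, `|A p - A q| < e & `|B p - B q| < e].
Proof.
move=> oU Up cA cB e0.
suff : \forall q \near p, [/\ U q, `|A p - A q| < e & `|B p - B q| < e].
  by move=> /nbhs_ballP[r/= r0 rP]; exists r.
near=> q; split.
- by near: q; exact: open_nbhs_nbhs.
- by near: q; move/cvgrPdist_lt : cA; exact.
- by near: q; move/cvgrPdist_lt : cB; exact.
Unshelve. all: by end_near. Qed.

(** The second difference is symmetric in [v] and [w], so the two mixed derivatives share a value,
    taken at two points as close to [p] as desired. Continuity of both at [p] concludes. *)
Lemma derive_comm (F : V -> R) (U : set V) (p v w : V) :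
  open U -> U p ->
  (forall q, U q -> [/\ derivable F q v, derivable F q w,
     derivable ('D_v F) q w & derivable ('D_w F) q v]) ->
  {for p, continuous ('D_w ('D_v F))} -> {for p, continuous ('D_v ('D_w F))} ->
  'D_w ('D_v F) p = 'D_v ('D_w F) p.
Proof.
move=> oU Up dF c1 c2; apply/eqP; rewrite -subr_eq0 -normr_le0.
suff H (e : R) : 0 < e ->
    `|'D_w ('D_v F) p - 'D_v ('D_w F) p| <= e.
  by apply/ler_addgt0Pr => e e0; rewrite add0r; exact: H.
move=> e0.
have tri (a b x : R) : `|a - x| < e / 2 -> `|b - x| < e / 2 -> `|a - b| <= e.
  by rewrite !ltr_norml ler_norml; lra.
have e2 : 0 < e / 2 by lra.
have [r r0 rP] := ball_close oU Up c1 c2 e2.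
(* The summand 1 keeps [N] positive when [v] and [w] vanish; with the step [r / 2 / N] the whole
   parallelogram lies in the ball of radius [r]. *)
pose N := `|v| + `|w| + 1.
have N0 : 0 < N by rewrite /N; have := normr_ge0 v; have := normr_ge0 w; lra.
pose s := r / 2 / N.
have s0 : 0 < s by rewrite /s !divr_gt0.
have sN : s * N = r / 2 by rewrite /s divfK// gt_eqF.
have inb (y z : R) (v' w' : V) : `|v'| + `|w'| < N -> `|y| <= s -> `|z| <= s ->
    ball p r (p + y *: v' + z *: w').
  move=> vw ys zs; rewrite -ball_normE /= -addrA opprD addrA subrr add0r normrN.
  apply: le_lt_trans (ler_normD _ _) _; rewrite !normrZ.
  have h1 : `|y| * `|v'| <= s * `|v'| by rewrite ler_wpM2r.
  have h2 : `|z| * `|w'| <= s * `|w'| by rewrite ler_wpM2r.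
  have h3 : s * (`|v'| + `|w'|) <= s * N by rewrite ler_wpM2l ?ltW.
  by rewrite sN in h3; lra.
have vwN : `|v| + `|w| < N by rewrite /N; lra.
have wvN : `|w| + `|v| < N by rewrite /N; lra.
have sE : `|s| = s by rewrite gtr0_norm.
have [|y [z [ys zs E1]]] := @second_difference F p v w s.
  move=> y z; rewrite sE => ys zs.
  by have [/dF[]] := rP _ (inb y z _ _ vwN ys zs).
have [|y' [z' [ys' zs' E2]]] := @second_difference F p w v s.
  move=> y' z'; rewrite sE => ys' zs'.
  by have [/dF[]] := rP _ (inb y' z' _ _ wvN ys' zs').
have canc (X Y a b : R) : X = s ^+ 2 * a -> Y = s ^+ 2 * b -> X = Y -> a = b.
  by move=> -> -> /mulfI; apply; rewrite expf_neq0// gt_eqF.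
have E : 'D_w ('D_v F) (p + y *: v + z *: w) =
         'D_v ('D_w F) (p + y' *: w + z' *: v).
  apply: canc E1 E2 _.
  by rewrite [p + s *: w + _]addrAC [X in X + F p]addrAC.
rewrite sE in ys zs ys' zs'.
have [_ h1 _] := rP _ (inb y z _ _ vwN ys zs).
have [_ _ h2] := rP _ (inb y' z' _ _ wvN ys' zs').
rewrite E in h1.
exact: tri h1 h2.
Qed.

End Schwarz.

Section Plane.
Context {R : realType}.
Implicit Types F : R * R -> R.

Lemma row_line (t s : R) : (t, 0) + s *: (0, 1) = (t, s) :> R * R.
Proof.
by congr pair; rewrite /= /GRing.scale/= ?mulr0 ?addr0 ?mulr1 ?add0r.
Qed.

Lemma col_line (x s : R) : (0, x) + s *: (1, 0) = (s, x) :> R * R.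
Proof.
by congr pair; rewrite /= /GRing.scale/= ?mulr0 ?addr0 ?mulr1 ?add0r.
Qed.

Lemma row_lineE F t : (fun x => F (t, x)) =
  (fun s : R => F ((t, 0) + s *: (0, 1))).
Proof. by apply/funext => s; rewrite row_line. Qed.

Lemma col_lineE F x : (fun t => F (t, x)) =
  (fun s : R => F ((0, x) + s *: (1, 0))).
Proof. by apply/funext => s; rewrite col_line. Qed.

Lemma is_derive_row F t x : derivable F (t, x) (0, 1) ->
  is_derive x 1 (fun y => F (t, y)) ('D_(0, 1) F (t, x)).
Proof.
move=> dF.
by rewrite row_lineE; split; rewrite ?derivable_line ?derive_line scale1r row_line.
Qed.

Lemma is_derive_col F t x : derivable F (t, x) (1, 0) ->
  is_derive t 1 (fun s => F (s, x)) ('D_(1, 0) F (t, x)).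
Proof.
move=> dF.
by rewrite col_lineE; split; rewrite ?derivable_line ?derive_line scale1r col_line.
Qed.

Lemma cont_row F t z : {for (t, z), continuous F} ->
  {for z, continuous (fun s => F (t, s))}.
Proof.
move=> cF; rewrite row_lineE.
have l : (t, 0) + s *: (0, 1) @[s --> z] --> ((t, z) : R * R).
  by rewrite -(row_line t z); exact: line_continuous.
by rewrite /prop_for /continuous_at row_line; exact: (cvg_comp _ _ l cF).
Qed.

Lemma cont_col F t z : {for (t, z), continuous F} ->
  {for t, continuous (fun s => F (s, z))}.
Proof.
move=> cF; rewrite col_lineE.
have l : (0, z) + s *: (1, 0) @[s --> t] --> ((t, z) : R * R).
  by rewrite -(col_line z t); exact: line_continuous.
by rewrite /prop_for /continuous_at col_line; exact: (cvg_comp _ _ l cF).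
Qed.

End Plane.

(** * The barrier *)

Section GraphSpeed.
Context {R : realType}.

(** Takes the values of [f], [f'/f] and [h'/h] at a point instead of the functions, so that the
    inequality at a touching point is a statement about real numbers; [k] stands for [n - 1]. *)
Definition graph_speed (k F G L Hb p q : R) : R :=
  (q - G * (F ^+ 2 + 2 * p ^+ 2)) / (F ^+ 2 + p ^+ 2) - k * L
  + Hb * Num.sqrt (1 + p ^+ 2 / F ^+ 2).

(** The derivative of [graph_speed] along the curve, with [f'] replaced by [G f]: [G1] and [L1] are
    the derivatives of [G] and [L], and [m] is the third derivative of the curve. *)
Definition graph_speed_deriv (k F G G1 L1 Hb p q m : R) : R :=
  (m - G1 * p * (F ^+ 2 + 2 * p ^+ 2) - G * (2 * G * F ^+ 2 * p + 4 * p * q))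
    / (F ^+ 2 + p ^+ 2)
  - (q - G * (F ^+ 2 + 2 * p ^+ 2)) * (2 * G * F ^+ 2 * p + 2 * p * q)
    / (F ^+ 2 + p ^+ 2) ^+ 2
  - k * (L1 * p)
  + Hb * ((p * q / F ^+ 2 - G * p ^+ 3 / F ^+ 2)
          / Num.sqrt (1 + p ^+ 2 / F ^+ 2)).

Lemma is_derive_graph_speed (k Hb : R) (f G G1 L L1 u p q : R -> R) (m x : R) :
  0 < f (u x) ->
  is_derive (u x) 1 f (G (u x) * f (u x)) ->
  is_derive (u x) 1 G (G1 (u x)) -> is_derive (u x) 1 L (L1 (u x)) ->
  is_derive x 1 u (p x) -> is_derive x 1 p (q x) -> is_derive x 1 q m ->
  is_derive x 1
    (fun x => graph_speed k (f (u x)) (G (u x)) (L (u x)) Hb (p x) (q x))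
    (graph_speed_deriv k (f (u x)) (G (u x)) (G1 (u x)) (L1 (u x)) Hb
       (p x) (q x) m).
Proof.
move=> f0 df dG dL du dp dq.
have dF := drv_comp df du.
have F0 : f (u x) != 0 by rewrite gt_eqF.
have F20 : f (u x) ^+ 2 != 0 by rewrite expf_neq0.
have D0 : f (u x) ^+ 2 + p x ^+ 2 != 0.
  by rewrite gt_eqF// ltr_pwDl ?sqr_ge0// exprn_gt0.
have s20 : 0 < 1 + p x ^+ 2 / f (u x) ^+ 2.
  by rewrite ltr_pwDl// mulr_ge0 ?invr_ge0 ?sqr_ge0.
have dF2 := drv_sqr dF.
have dp2 := drv_sqr dp.
have dN := drv_sub dq (drv_mul (drv_comp dG du)
  (drv_add dF2 (drv_scale 2 dp2))).
have dQ := drv_div dN (drv_add dF2 dp2) D0.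
have dS := drv_sqrt (drv_add (drv_cst 1 x 1) (drv_div dp2 dF2 F20)) s20.
apply: drv_eq (drv_add (drv_sub dQ (drv_scale k (drv_comp dL du)))
  (drv_scale Hb dS)) _.
rewrite /graph_speed_deriv.
have : Num.sqrt (1 + p x ^+ 2 / f (u x) ^+ 2) != 0 by rewrite gt_eqF// sqrtr_gt0.
move: (Num.sqrt _) => s s0.
move: (f (u x)) (G (u x)) (G1 (u x)) (L1 (u x)) (p x) (q x) F0 D0.
move=> F g g1 l1 P Q F0 D0.
by field; rewrite s0 D0 F0.
Qed.

Lemma normM_le (x y a b : R) : `|x| <= a -> `|y| <= b -> `|x * y| <= a * b.
Proof. by move=> xa yb; rewrite normrM ler_pM. Qed.

(** Each summand bounds one term of the bracket formed in [touching_ineq], in the same order; [iota]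
    is an upper bound for [rho^-1], and the final 1 makes the inequality strict. *)
Definition barrier_rate (k B C iota : R) : R :=
  4 * (B + 2) + 2 * C + (2 * C + 24) * C + (2 * C + 6) * (2 * C + 12)
  + (6 + 2 * C) + k * (iota + 2 * C) + 1.

(* With [y = rho - u] the singular parts [y / u^2] and [- 1 / u] of the terms
   containing [h'/h] and its derivative add up to [rho / u^2 - 2 / u], which is
   bounded below; the terms with [Hb] add up to a nonnegative multiple of [Hb]. *)
Lemma touching_ineq (k F G G1 L L1 Hb B C rho u c c1 c2 p q m : R) :
  0 <= k -> 0 <= Hb -> 0 <= B ->
  2^-1 <= F -> `|G| <= C -> `|G1| <= C -> `|L - u^-1| <= C ->
  `|L1 + u ^- 2| <= C -> 0 < u < rho -> rho <= 1 ->
  0 < c -> c <= 1 -> C * c ^+ 2 <= 8^-1 -> `|c1| <= 8^-1 -> - B * c <= c2 ->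
  (rho - u) * (c2 - 3 * c * c1 + c ^+ 3) <= m ->
  p = c * (rho - u) -> q = (c1 - c ^+ 2) * (rho - u) ->
  0 < graph_speed_deriv k F G G1 L1 Hb p q m
      + c * graph_speed k F G L Hb p q + c * barrier_rate k B C rho^-1.
Proof.
move=> k0 Hb0 B0 F2 GC G1C LC L1C /andP[u0 urho] rho1 c0 c1' Cc c1C c2B mB pE qE.
have C0 : 0 <= C by apply: le_trans GC.
set y := rho - u in pE qE mB *.
have y0 : 0 < y by rewrite /y; lra.
have y1 : y <= 1 by rewrite /y; lra.
have F0 : 0 < F by lra.
have F20 : 4^-1 <= F ^+ 2 by rewrite expr2; nra.
have F2p : 0 < F ^+ 2 by lra.
have p20 : 0 <= p ^+ 2 := sqr_ge0 p.
pose D := F ^+ 2 + p ^+ 2.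
have D4 : 4^-1 <= D by rewrite /D; lra.
have D0 : 0 < D by lra.
pose e := D^-1.
have e0 : 0 < e by rewrite invr_gt0.
have De : D * e = 1 by rewrite mulfV ?gt_eqF.
have e4 : e <= 4 by nra.
pose s1 := (F ^+ 2 + 2 * p ^+ 2) * e.
pose s2 := F ^+ 2 * e.
have s2C : `|s2| <= 1.
  rewrite ger0_norm /s2; last by rewrite mulr_ge0// ltW.
  by rewrite -De; apply: ler_wpM2r; [exact: ltW|rewrite /D; lra].
have s1C : `|s1| <= 2.
  rewrite ger0_norm /s1; last by rewrite mulr_ge0 ?ltW//; lra.
  apply: le_trans (_ : 2 * D * e <= _); last by rewrite -mulrA De mulr1.
  by apply: ler_wpM2r; [exact: ltW|rewrite /D; lra].
have c21 : c ^+ 2 <= 1 by rewrite exprn_ile1// ltW.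
have c20 : 0 <= c ^+ 2 := sqr_ge0 c.
have q2 : `|q| <= 3 / 2.
  rewrite qE -[leRHS]mulr1; apply: normM_le; last by rewrite ger0_norm// ltW.
  by move: c1C c20 c21; rewrite !ler_norml; clear; lra.
pose qe := q * e.
have qeC : `|qe| <= 6.
  have -> : 6 = 3 / 2 * 4 :> R by field.
  by apply: normM_le => //; rewrite ger0_norm// ltW.
pose A := qe - G * s1.
have AC : `|A| <= 6 + 2 * C.
  apply: le_trans (ler_normB _ _) _; apply: lerD => //.
  by rewrite [2 * C]mulrC; exact: normM_le.
pose W := 2 * G * s2 + 2 * qe.
have WC : `|W| <= 2 * C + 12.
  apply: le_trans (ler_normD _ _) _; apply: lerD.
    rewrite -[leRHS]mulr1; apply: normM_le => //.
    by apply: normM_le => //; rewrite ger0_norm.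
  have -> : 12 = 2 * 6 :> R by ring.
  by apply: normM_le => //; rewrite ger0_norm.
pose S := Num.sqrt (1 + p ^+ 2 / F ^+ 2).
have S20 : 0 < 1 + p ^+ 2 / F ^+ 2 by rewrite ltr_pwDl// mulr_ge0 ?invr_ge0// ltW.
have S0 : 0 < S by rewrite sqrtr_gt0.
have SS : S ^+ 2 = 1 + p ^+ 2 / F ^+ 2 by rewrite sqr_sqrtr// ltW.
pose iF := F ^- 2.
have iF0 : 0 < iF by rewrite invr_gt0.
have iFE : F ^+ 2 * iF = 1 by rewrite mulfV ?gt_eqF.
have iF4 : iF <= 4 by clear -F20 iF0 iFE; nra.
pose iu := u^-1.
have iu0 : 0 < iu by rewrite invr_gt0.
have uiu : u * iu = 1 by rewrite mulfV ?gt_eqF.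
(* The two terms with [Hb] add up to [c * Hb * Hg / S]: the part [- c^2 y] of [q] cancels
   [p^2 / F^2] in [S^2]. The bounds [1/8] on [c1] and on [C c^2], with [F^-2 <= 4], make each of the
   two corrections at most [1/2]. *)
pose Hg := 1 + y ^+ 2 * iF * c1 - G * c ^+ 2 * (y ^+ 3 * iF).
have Hg0 : 0 <= Hg.
  have y21 : y ^+ 2 <= 1 by rewrite exprn_ile1// ltW.
  have y31 : y ^+ 3 <= 1 by rewrite exprn_ile1// ltW.
  have h1 : `|y ^+ 2 * iF * c1| <= (1 * 4) * 8^-1.
    apply: normM_le => //; apply: normM_le; rewrite ger0_norm ?sqr_ge0//.
    exact: ltW.
  have h2 : `|G * c ^+ 2 * (y ^+ 3 * iF)| <= 8^-1 * (1 * 4).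
    apply: normM_le.
      apply: le_trans Cc.
      by apply: normM_le => //; rewrite ger0_norm.
    by apply: normM_le; rewrite ger0_norm ?exprn_ge0// ltW.
  by move: h1 h2; rewrite !ler_norml /Hg; clear; lra.
(* [c] is arbitrarily small near the ends of the interval, so all bounds must be proportional to it;
   the factor [c] is divided out. *)
pose m' := m / c.
have mE : m = c * m' by rewrite /m' mulrC divfK// gt_eqF.
have m'B : - (B + 2) <= m'.
  rewrite -(ler_pM2l c0) -mE; apply: le_trans mB.
  have h1 : - B * c - 3 * c * c1 <= c2 - 3 * c * c1 + c ^+ 3.
    have : 0 <= c ^+ 3 by rewrite exprn_ge0// ltW.
    by clear -c2B; lra.
  have h2 : - (B + 2) * c <= - B * c - 3 * c * c1.
    move: c1C; rewrite ler_norml => /andP[_ hc].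
    have : c * c1 <= c * 8^-1 by rewrite ler_wpM2l// ltW.
    by clear -c0; nra.
  have h3 : - (B + 2) * c <= c2 - 3 * c * c1 + c ^+ 3 := le_trans h2 h1.
  rewrite mulrC.
  apply: le_trans (_ : y * (- (B + 2) * c) <= _); last by rewrite ler_wpM2l// ltW.
  have : 0 <= (B + 2) * c.
    by apply: mulr_ge0; [exact: addr_ge0|exact: ltW].
  by clear -y0 y1; nra.
have T1 : - (4 * (B + 2)) <= m' * e.
  clear -B0 m'B e0 e4.
  have [m0|m0] := leP 0 m'.
    have : 0 <= m' * e by rewrite mulr_ge0// ltW.
    lra.
  nra.
have yC z a : `|z| <= a -> `|y * z| <= a.
  by move=> za; rewrite -[a]mul1r; apply: normM_le => //; rewrite ger0_norm// ltW.
have T2 : `|y * (G1 * s1)| <= 2 * C.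
  by apply: yC; rewrite [2 * C]mulrC; exact: normM_le.
have T3 : `|y * (G * (2 * G * s2 + 4 * qe))| <= (2 * C + 24) * C.
  apply: yC; rewrite mulrC; apply: normM_le => //.
  apply: le_trans (ler_normD _ _) _; apply: lerD.
    rewrite -[leRHS]mulr1; apply: normM_le => //.
    by apply: normM_le => //; rewrite ger0_norm.
  have -> : 24 = 4 * 6 :> R by ring.
  by apply: normM_le => //; rewrite ger0_norm.
have T4 : `|y * (A * W)| <= (6 + 2 * C) * (2 * C + 12).
  by apply: yC; exact: normM_le.
have T5 : - (rho^-1 + 2 * C) <= - (y * L1) - L.
  have T6 : `|y * (L1 + u ^- 2)| <= C by exact: yC.
  (* This is [rho (u^-1 - rho^-1)^2 >= 0], expanded. *)
  have hs : - rho^-1 <= y * u ^- 2 - u^-1.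
    have r0 : 0 < rho := lt_trans u0 urho.
    rewrite -exprVn -/iu.
    have -> : y * iu ^+ 2 = rho * iu ^+ 2 - iu.
      by rewrite /y mulrBl expr2 [u * _]mulrA uiu mul1r.
    have rr : rho * rho^-1 = 1 by rewrite mulfV// gt_eqF.
    have ir0 : 0 < rho^-1 by rewrite invr_gt0.
    have : 0 <= rho * (iu - rho^-1) ^+ 2 by rewrite mulr_ge0 ?sqr_ge0// ltW.
    have -> : rho * (iu - rho^-1) ^+ 2 =
      rho * iu ^+ 2 - 2 * (rho * rho^-1) * iu + (rho * rho^-1) * rho^-1 by ring.
    rewrite rr; clear; lra.
  have T7 : y * L1 = y * (L1 + u ^- 2) - y * u ^- 2 by ring.
  by move: LC T6; rewrite !ler_norml T7; move: hs; clear; lra.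
have T8 : k * - (rho^-1 + 2 * C) <= k * (- (y * L1) - L) by rewrite ler_wpM2l.
have T9 : 0 <= Hb * (S^-1 * Hg) by rewrite !mulr_ge0// invr_ge0 ltW.
have -> : graph_speed_deriv k F G G1 L1 Hb p q m + c * graph_speed k F G L Hb p q
    = c * (m' * e - y * (G1 * s1) - y * (G * (2 * G * s2 + 4 * qe))
           - y * (A * W) + A + k * (- (y * L1) - L) + Hb * (S^-1 * Hg)).
  have Hexp : Hb * ((p * q / F ^+ 2 - G * p ^+ 3 / F ^+ 2) / S) + c * (Hb * S)
              = c * (Hb * (S^-1 * Hg)).
    have -> : c * (Hb * S) = c * Hb * (S ^+ 2 / S).
      by field; rewrite gt_eqF.
    rewrite SS /Hg -/iF pE qE; ring.
  rewrite /graph_speed_deriv /graph_speed -/S -/D -exprVn -/e.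
  rewrite [in RHS]mulrDr -Hexp mE /A /W /s1 /s2 /qe pE; ring.
rewrite -mulrDr mulr_gt0// /barrier_rate.
move: AC T1 T2 T3 T4 T8 T9; rewrite !ler_norml; clear; lra.
Qed.

End GraphSpeed.

(** * Derivative tests at extrema and first touching times *)

Section Extrema.
Context {R : realType}.

Lemma derive_gt0_near (g : R -> R) (x d : R) : is_derive x 1 g d -> 0 < d ->
  exists2 e : R, 0 < e & forall z, `|z - x| < e ->
    (x < z -> g x < g z) /\ (z < x -> g z < g x).
Proof.
move=> /is_derive1_caratheodory[h [gE ch hx]] d0.
have : \forall z \near x, 0 < h z.
  by move/cvgr_gt : ch; apply; rewrite hx.
move=> /nbhs_ballP[e/= e0 eP]; exists e => // z zx.
have hz : 0 < h z by apply: eP; rewrite -ball_normE/= distrC.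
split => xz; rewrite -subr_gt0.
  by rewrite gE mulr_gt0// subr_gt0.
by rewrite -opprB gE -mulrN opprB mulr_gt0// subr_gt0.
Qed.

(** One-sided, because at a first touching time only the past is controlled. *)
Lemma derive_le0_left (g : R -> R) (a x d : R) : a < x ->
  is_derive x 1 g d -> (forall z, a < z < x -> g x <= g z) -> d <= 0.
Proof.
move=> ax dg gP; rewrite leNgt; apply/negP => d0.
have [e e0 eP] := derive_gt0_near dg d0.
pose z := Num.max ((a + x) / 2) (x - e / 2).
have zx : z < x by rewrite gt_max; apply/andP; split; lra.
have az : a < z by rewrite lt_max; apply/orP; left; lra.
have ze : x - e / 2 <= z by rewrite le_max lexx orbT.
have [|_ /(_ zx)] := eP z; first by rewrite ltr0_norm; lra.
by rewrite ltNge gP ?az.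
Qed.

Lemma second_derive_pos (g g' : R -> R) (a b x d : R) :
  a < x < b -> (forall z, a < z < b -> is_derive z 1 g (g' z)) ->
  is_derive x 1 g' d -> g' x = 0 -> 0 < d ->
  exists2 e : R, 0 < e & forall z, `|z - x| < e -> z != x -> g x < g z.
Proof.
move=> /andP[ax xb] dg dg' g'x d0.
have [e e0 eP] := derive_gt0_near dg' d0.
pose e' := Num.min e (Num.min (x - a) (b - x)).
have [e'e e'a e'b] : [/\ e' <= e, e' <= x - a & e' <= b - x].
  by rewrite /e' !ge_min !lexx ?orbT.
exists e'; first by rewrite !lt_min e0 !subr_gt0 ax.
move=> z zx zneq.
have ab y' : `|y' - x| < e' -> a < y' < b by rewrite ltr_norml; lra.
have dgw w : `|w - x| < e' -> is_derive w 1 g (g' w) by move=> /ab/dg.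
have cg c1 c2 : (forall w, c1 <= w <= c2 -> `|w - x| < e') ->
    {within `[c1, c2], continuous g}.
  move=> H; apply: continuous_in_subspaceT => w; rewrite inE/= in_itv/= => wc.
  exact/drv_continuous/dgw/H.
have lt w : `|w - x| < e' -> (x < w -> 0 < g' w) /\ (w < x -> g' w < 0).
  by move=> we; rewrite -g'x; apply: eP; exact: lt_le_trans we e'e.
have [zltx|xltz] := ltP z x.
  have H w : z <= w <= x -> `|w - x| < e'.
    by move: zx; rewrite !ltr_norml; lra.
  have [w|w] := @MVT R g g' z x zltx _ (cg _ _ H).
    by rewrite in_itv/= => wz; apply/dgw/H; lra.
  rewrite in_itv/= => wz E'; rewrite -subr_lt0 E' pmulr_llt0 ?subr_gt0//.
  by apply: (lt w _).2; [apply: H|]; lra.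
have {xltz} xz : x < z by rewrite lt_neqAle xltz eq_sym zneq.
have H w : x <= w <= z -> `|w - x| < e'.
  by move: zx; rewrite !ltr_norml; lra.
have [w|w] := @MVT R g g' x z xz _ (cg _ _ H).
  by rewrite in_itv/= => wz; apply/dgw/H; lra.
rewrite in_itv/= => wz E'; rewrite -subr_gt0 E' pmulr_lgt0 ?subr_gt0//.
by apply: (lt w _).1; [apply: H|]; lra.
Qed.

(** If [d] were negative, the second derivative test applied to [- g] would make [x] a strict local
    maximum of [g]. *)
Lemma second_derive_min (g g' : R -> R) (a b x d : R) :
  a < x < b -> (forall z, a < z < b -> is_derive z 1 g (g' z)) ->
  is_derive x 1 g' d -> (forall z, a < z < b -> g x <= g z) ->
  g' x = 0 /\ 0 <= d.
Proof.
move=> xab dg dg' gmin.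
have g'x : g' x = 0.
  have [_ <-] := dg x xab.
  have ab : a <= b by lra.
  have [| |t|_ ->//] := @derive1_at_min _ g a b x ab.
  - by move=> t; rewrite in_itv/= => /dg[].
  - by rewrite in_itv.
  - by rewrite in_itv/= => /gmin.
split => //; rewrite leNgt; apply/negP => d0.
have dN z : a < z < b -> is_derive z 1 (fun y => - g y) (- g' z).
  by move=> /dg; exact: drv_opp.
have [||e e0 eP] := second_derive_pos xab dN (drv_opp dg').
- by rewrite g'x oppr0.
- by rewrite oppr_gt0.
pose z := Num.min (x + e / 2) ((x + b) / 2).
have zx : x < z by rewrite lt_min; apply/andP; split; lra.
have zb : z < b by rewrite gt_min; apply/orP; right; lra.
have ze : z <= x + e / 2 by rewrite ge_min lexx.
have := eP z; rewrite gt_eqF// ltrN2 => /(_ _ isT).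
rewrite gtr0_norm; last by lra.
move=> /(_ ltac:(lra)); rewrite ltNge gmin//; lra.
Qed.

End Extrema.

Section FirstTouching.
Context {R : realType}.

(** The points of the rectangle with [J <= 0] form a nonempty compact set, on which the time attains
    its minimum. At that time [J] is still nonnegative everywhere, since a negative value would
    persist at slightly earlier times. *)
Lemma first_touching (J : R -> R -> R) (al be t0 t3 x3 : R) :
  t0 <= t3 -> al <= x3 <= be ->
  (forall t x, t0 <= t <= t3 -> al <= x <= be ->
     {for (t, x), continuous (fun z : R * R => J z.1 z.2)}) ->
  (forall x, al <= x <= be -> 0 < J t0 x) -> J t3 x3 <= 0 ->
  exists t x, [/\ t0 < t <= t3, al <= x <= be, J t x = 0,
    forall s y, t0 <= s < t -> al <= y <= be -> 0 < J s y &
    forall y, al <= y <= be -> 0 <= J t y].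
Proof.
move=> t03 x3ab cJ J0 J3.
pose Q : set (R * R) := `[t0, t3] `*` `[al, be].
have QP z : Q z <-> (t0 <= z.1 <= t3) /\ (al <= z.2 <= be).
  by rewrite /Q /= !in_itv.
have cQ : compact Q by apply: compact_setX; exact: segment_compact.
pose Z := Q `&` [set z | J z.1 z.2 <= 0].
have cZ : compact Z.
  apply: (subclosed_compact _ cQ); last by move=> z [].
  move=> z zZ.
  have Qz : Q z.
    have cl : closed Q by apply: compact_closed.
    by apply: cl => N /zZ [w [[Qw _] Nw]]; exists w.
  split => //=; rewrite leNgt; apply/negP => Jz.
  have [/= h1 h2] := (QP z).1 Qz.
  have := cJ _ _ h1 h2; rewrite -surjective_pairing => /cvgr_gt /(_ _ Jz) /zZ.
  by move=> [w [[_ /= wJ]]]; rewrite /= ltNge wJ.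
have Z0 : Z !=set0.
  exists (t3, x3); split => //=; apply/QP => /=; split => //.
  by rewrite t03 lexx.
have [|[t x]] := @compact_EVT_min _ R fst Z Z0 cZ.
  by apply: continuous_subspaceT => z; exact: cvg_fst.
rewrite inE => -[/QP/= [tt xx] /= Jtx] tmin.
have before s y : t0 <= s < t -> al <= y <= be -> 0 < J s y.
  move=> st yab; rewrite ltNge; apply/negP => Jsy.
  have : (s, y) \in Z.
    by rewrite inE; split => //; apply/QP => /=; split => //; lra.
  by move=> /tmin /=; lra.
have tt0 : t0 < t.
  rewrite lt_neqAle; case/andP: (tt) => -> _; rewrite andbT.
  by apply/eqP => E; move: (J0 x xx) Jtx; rewrite E; lra.
have after y : al <= y <= be -> 0 <= J t y.
  move=> yab; rewrite leNgt; apply/negP => Jty.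
  have := cJ t y tt yab => /cvgr_lt /(_ _ Jty) /nbhs_ballP[e/= e0 eP].
  pose s := Num.max t0 (t - e / 2).
  have st : s < t by rewrite gt_max tt0/=; lra.
  have t0s : t0 <= s by rewrite le_max lexx.
  have se : t - e / 2 <= s by rewrite le_max lexx orbT.
  have := eP (s, y); rewrite /ball/= => /(_ _)/= H.
  have : J s y < 0.
    apply: H; split => /=; last exact: ballxx.
    by rewrite -ball_normE /= gtr0_norm; lra.
  have := before s y; rewrite t0s st => /(_ isT yab); lra.
exists t, x; split => //; first by case/andP: tt => _ ->; rewrite tt0.
by apply/eqP; rewrite eq_le Jtx after.
Qed.

End FirstTouching.

Section Barrier.
Context {R : realType}.

(* [G = f'/f] and [L = h'/h] near the axis. *)
Record axis_bounds (rho0 C : R) (f G G1 L L1 : R -> R) : Prop := AxisBounds {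
  axis_rho0 : 0 < rho0 <= 1;
  axis_bound : forall r, 0 < r < rho0 ->
    [/\ 2^-1 <= f r, `|G r| <= C, `|G1 r| <= C, `|L r - r^-1| <= C
      & `|L1 r + r ^- 2| <= C];
  axis_deriv : forall r, 0 < r < rho0 ->
    [/\ is_derive r 1 f (G r * f r), is_derive r 1 G (G1 r)
      & is_derive r 1 L (L1 r)] }.

(* [p], [q] and [m] are the first three derivatives of [u] in [x], and [v], [pt]
   those of [u] and [p] in [t]. *)
Record graph_flow (k : R) (f G L : R -> R) (al be t0 T : R)
    (u p q m v pt : R -> R -> R) (Hb : R -> R) : Prop := GraphFlow {
  gf_pos : forall t x, t0 <= t < T -> al <= x <= be -> 0 < u t x /\ 0 < p t x;
  gf_x : forall t x, t0 <= t < T -> al <= x <= be ->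
    [/\ is_derive x 1 (u t) (p t x), is_derive x 1 (p t) (q t x)
      & is_derive x 1 (q t) (m t x)];
  gf_t : forall t x, t0 <= t < T -> al <= x <= be ->
    is_derive t 1 (u^~ x) (v t x) /\ is_derive t 1 (p^~ x) (pt t x);
  gf_mixed : forall t x, t0 <= t < T -> al <= x <= be ->
    is_derive x 1 (v t) (pt t x);
  gf_speed : forall t x, t0 <= t < T -> al <= x <= be ->
    v t x = graph_speed k (f (u t x)) (G (u t x)) (L (u t x)) (Hb t)
              (p t x) (q t x);
  gf_cont : forall t x, t0 <= t < T -> al <= x <= be ->
    {for (t, x), continuous (fun z : R * R => u z.1 z.2)} /\
    {for (t, x), continuous (fun z : R * R => p z.1 z.2)};
  gf_Hb : forall t, t0 <= t < T -> 0 <= Hb t }.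

(** [c1] and [c2] are the first two derivatives of the spatial factor [c] of the barrier. Its
    vanishing at the ends keeps touching points inside; the bounds are those that the inequality at
    such a point consumes. *)
Record small_bump (al be B C : R) (c c1 c2 : R -> R) : Prop := SmallBump {
  bump_ends : c al = 0 /\ c be = 0;
  bump_pos : forall x, al < x < be -> 0 < c x;
  bump_deriv : forall x : R, is_derive x 1 c (c1 x) /\ is_derive x 1 c1 (c2 x);
  bump_bound : forall x, al <= x <= be ->
    [/\ c x <= 1, C * c x ^+ 2 <= 8^-1, `|c1 x| <= 8^-1 & - B * c x <= c2 x] }.

Lemma near_itv (a b x : R) : a < x < b -> \forall y \near x, a < y < b.
Proof.
move=> /andP[ax xb]; near=> y; apply/andP; split; near: y.
  exact: lt_nbhsr.
exact: lt_nbhsl.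
Unshelve. all: by end_near. Qed.

Lemma barrier_rate_le (k B C i j : R) : 0 <= k -> i <= j ->
  barrier_rate k B C i <= barrier_rate k B C j.
Proof. by move=> k0 ij; rewrite /barrier_rate lerD2r lerD2l ler_wpM2l// lerD2r. Qed.

Lemma barrier_rate_ge0 (k B C i : R) : 0 <= k -> 0 <= B -> 0 <= C -> 0 <= i ->
  0 <= barrier_rate k B C i.
Proof.
move=> k0 B0 C0 i0; rewrite /barrier_rate.
have h1 : 0 <= (2 * C + 24) * C by apply: mulr_ge0; lra.
have h2 : 0 <= (2 * C + 6) * (2 * C + 12) by apply: mulr_ge0; lra.
have h3 : 0 <= k * (i + 2 * C) by apply: mulr_ge0; lra.
by lra.
Qed.

(** At a first zero of [J = p - c (rho - u)] one has [c > 0], as [p > 0], so the point is interior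
    in [x]. There [J = J_x = 0] determine [p] and [q], [J_xx >= 0] bounds [m] from below, and
    [J_t <= 0] contradicts [touching_ineq]. *)
Lemma barrier_comparison (k B C rho0 : R) (f G G1 L L1 : R -> R)
    (al be t0 T : R) (u p q m v pt : R -> R -> R) (Hb c c1 c2 : R -> R) :
  0 <= k -> 0 <= B -> al < be -> axis_bounds rho0 C f G G1 L L1 ->
  graph_flow k f G L al be t0 T u p q m v pt Hb ->
  small_bump al be B C c c1 c2 ->
  let K := barrier_rate k B C (2 / rho0) in
  K * (T - t0) <= rho0 / 2 ->
  (forall x, al <= x <= be -> c x * rho0 < p t0 x) ->
  forall t x, t0 <= t < T -> al <= x <= be ->
    c x * (rho0 - K * (t - t0) - u t x) < p t x.
Proof.
move=> k0 B0 albe ax gf bp K KT init t3 x3 t3T x3ab.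
have /andP[rho00 rho01] := axis_rho0 ax.
pose rho t := rho0 - K * (t - t0).
pose J t x := p t x - c x * (rho t - u t x).
rewrite -subr_gt0 -[X in 0 < X]/(J t3 x3) ltNge; apply/negP => J3.
have cpos x : al <= x <= be -> 0 <= c x.
  move=> /andP[]; rewrite le_eqVlt => /orP[/eqP <- _|ax'].
    by rewrite (bump_ends bp).1.
  rewrite le_eqVlt => /orP[/eqP ->|xb]; first by rewrite (bump_ends bp).2.
  by rewrite ltW// (bump_pos bp)// ax'.
have crho : continuous rho.
  move=> t; have := drv_sub (drv_cst rho0 t 1)
    (drv_scale K (drv_sub (drv_id t) (drv_cst t0 t 1))).
  exact: drv_continuous.
have [||t x E|x xab|//|t [x [tt xab Jtx before after]]] :=
    @first_touching R J al be t0 t3 x3.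
- by case/andP: t3T.
- by [].
- move=> xab; have t_T : t0 <= t < T by lra.
  have [cu cp] := gf_cont gf t_T xab.
  apply: cvgB; first exact: cp.
  apply: cvgM; last apply: cvgB.
  + apply: (@continuous_comp _ _ _ snd c); first exact: cvg_snd.
    by have [/drv_continuous] := bump_deriv bp x.
  + by apply: (@continuous_comp _ _ _ fst rho); [exact: cvg_fst|exact: crho].
  + exact: cu.
- rewrite /J /rho subrr mulr0 subr0 subr_gt0.
  have t0T : t0 <= t0 < T by lra.
  have [u0 _] := gf_pos gf t0T xab.
  apply: le_lt_trans (init x xab).
  by rewrite ler_wpM2l ?cpos//; lra.
have t_T : t0 <= t < T by lra.
have [ut0 pt0] := gf_pos gf t_T xab.
have cx0 : 0 < c x.
  rewrite lt_neqAle cpos// andbT; apply/eqP => c0.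
  by move: Jtx; rewrite /J -c0; lra.
have xoo : al < x < be.
  have [ca cb] := bump_ends bp.
  have xa : x != al by apply/eqP => E; move: cx0; rewrite E ca ltxx.
  have xb : x != be by apply/eqP => E; move: cx0; rewrite E cb ltxx.
  by rewrite !lt_neqAle xb eq_sym xa.
have pE : p t x = c x * (rho t - u t x) by apply/eqP; rewrite -subr_eq0 -/(J t x) Jtx.
(* Since [p] is positive, touching forces [u < rho]: it only happens near the axis, where the bounds
   of [axis_bounds] are available. *)
have y0 : 0 < rho t - u t x by move: pt0; rewrite pE pmulr_rgt0.
have K0 : 0 <= K.
  have C0 : 0 <= C.
    have [|_ h _ _ _] := axis_bound ax (r := rho0 / 2); first by lra.
    by apply: le_trans h.
  by apply: barrier_rate_ge0 => //; rewrite divr_ge0// ltW.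
have rhole : rho t <= rho0.
  have : 0 <= K * (t - t0) by apply: mulr_ge0 => //; lra.
  by rewrite /rho; lra.
(* The smallness of [T - t0] keeps [rho] above half its initial value, which is why [K] is taken
   with [2 / rho0] as the bound for [rho^-1]. *)
have rhoge : rho0 / 2 <= rho t.
  have : K * (t - t0) <= K * (T - t0) by rewrite ler_wpM2l//; lra.
  by rewrite /rho; lra.
have urho : 0 < u t x < rho0 by lra.
have [dux dpx dqx] := gf_x gf t_T xab.
have [dut dpt] := gf_t gf t_T xab.
have [dc dc1] := bump_deriv bp x.
pose Jx y := q t y - (c1 y * (rho t - u t y) - c y * p t y).
have dJ y : al < y < be -> is_derive y 1 (J t) (Jx y).
  move=> yab; have yab' : al <= y <= be by lra.
  have [duy dpy _] := gf_x gf t_T yab'.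
  have [dcy _] := bump_deriv bp y.
  apply: drv_eq (drv_sub dpy (drv_mul dcy (drv_sub (drv_cst (rho t) y 1) duy))) _.
  by rewrite /Jx sub0r mulrN.
have dJx : is_derive x 1 Jx
    (m t x - (c2 x * (rho t - u t x) - 2 * c1 x * p t x - c x * q t x)).
  apply: drv_eq (drv_sub dqx (drv_sub
    (drv_mul dc1 (drv_sub (drv_cst (rho t) x 1) dux)) (drv_mul dc dpx))) _.
  by ring.
have [Jx0 Jxx] : Jx x = 0 /\
    0 <= m t x - (c2 x * (rho t - u t x) - 2 * c1 x * p t x - c x * q t x).
  apply: (second_derive_min xoo dJ dJx) => y yab.
  by rewrite Jtx after//; lra.
have dJt : is_derive t 1 (J^~ x) (pt t x - c x * (- K - v t x)).
  apply: drv_eq (drv_sub dpt (drv_scale (c x) (drv_sub (drv_sub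
    (drv_cst rho0 t 1) (drv_scale K (drv_sub (drv_id t) (drv_cst t0 t 1)))) dut))) _.
  by ring.
have Jt : pt t x - c x * (- K - v t x) <= 0.
  have /andP[tt0 _] := tt.
  apply: (derive_le0_left tt0 dJt) => s sab.
  by rewrite Jtx ltW// before//; lra.
have qE : q t x = (c1 x - c x ^+ 2) * (rho t - u t x).
  apply/eqP; rewrite -subr_eq0 -[X in _ == X]Jx0 /Jx pE; apply/eqP; ring.
have [f2 GC G1C LC L1C] := axis_bound ax urho.
have [df dG dL] := axis_deriv ax urho.
have [cle1 cC c1C c2B] := bump_bound bp xab.
have mB : (rho t - u t x) * (c2 x - 3 * c x * c1 x + c x ^+ 3) <= m t x.
  rewrite -subr_ge0; apply: le_trans Jxx _.
  by rewrite qE pE le_eqVlt; apply/orP; left; apply/eqP; ring.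
(* [pt] is also the [x]-derivative of the speed [v], and the evolution equation for [v] holds on a
   neighbourhood of [x], so it may be differentiated. *)
have ptE : pt t x = graph_speed_deriv k (f (u t x)) (G (u t x)) (G1 (u t x))
    (L1 (u t x)) (Hb t) (p t x) (q t x) (m t x).
  have f0 : 0 < f (u t x) by lra.
  have d1 := is_derive_graph_speed k (Hb t) f0 df dG dL dux dpx dqx.
  have d2 := gf_mixed gf t_T xab.
  have [_ <-] := d2; have [_ <-] := d1; apply: near_eq_derive.
  near=> y; apply: (gf_speed gf t_T).
  suff : al < y < be by lra.
  by near: y; exact: near_itv.
have urt : 0 < u t x < rho t by lra.
have rho1 : rho t <= 1 by lra.
have := touching_ineq k0 (gf_Hb gf t_T) B0 f2 GC G1C LC L1C urt rho1
  cx0 cle1 cC c1C c2B mB pE qE.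
rewrite -ptE -(gf_speed gf t_T xab).
have KE : c x * barrier_rate k B C (rho t)^-1 <= c x * K.
  rewrite ler_wpM2l ?cpos//; apply: barrier_rate_le => //.
  have -> : 2 / rho0 = (rho0 / 2)^-1 by rewrite invf_div.
  by rewrite lef_pV2// posrE; lra.
move: Jt; rewrite mulrBr mulrN; lra.
Unshelve. all: by end_near. Qed.

End Barrier.

(** * From the barrier to a lower bound for the curve *)

Section LowerBound.
Context {R : realType}.

(** With [l = be - al] and [s = (x - al)(be - x)], [(al + be - 2 x)^2 = l^2 - 4 s], hence
    [c'' + (18 / l^2) c = 2 e (l - 3 s / l)^2]: this is the origin of 18. The square matters: [s]
    itself has second derivative [-2] at the ends, where it vanishes. *)
Lemma small_bump_sqr (al be C e : R) : al < be -> 0 <= C -> 0 < e ->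
  e * ((be - al) ^+ 4 + 2 * (be - al) ^+ 3 + 1) * (C + 1) <= 8^-1 ->
  small_bump al be (18 / (be - al) ^+ 2) C
    (fun x => e * ((x - al) * (be - x)) ^+ 2)
    (fun x => 2 * e * ((x - al) * (be - x)) * (al + be - 2 * x))
    (fun x => 2 * e * ((al + be - 2 * x) ^+ 2 - 2 * ((x - al) * (be - x)))).
Proof.
move=> albe C0 e0 eB; set l := be - al in eB *.
have l0 : 0 < l by rewrite /l; lra.
split.
- by rewrite !subrr mul0r mulr0 expr0n mulr0.
- by move=> x /andP[ax xb]; rewrite mulr_gt0// exprn_gt0// mulr_gt0// subr_gt0.
- move=> x.
  have d1 := drv_sub (drv_id x) (drv_cst al x 1).
  have d2 := drv_sub (drv_cst be x 1) (drv_id x).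
  have d3 := drv_sub (drv_cst (al + be) x 1) (drv_scale 2 (drv_id x)).
  have ds := drv_mul d1 d2; split.
    by apply: drv_eq (drv_scale e (drv_sqr ds)) _; ring.
  by apply: drv_eq (drv_mul (drv_scale (2 * e) ds) d3) _; ring.
- move=> x /andP[ax xb].
  set s := (x - al) * (be - x).
  have s0 : 0 <= s by rewrite mulr_ge0// subr_ge0.
  have sl : s <= l ^+ 2.
    by rewrite expr2; apply: ler_pM; rewrite /l; lra.
  have s2l : s ^+ 2 <= l ^+ 4.
    have -> : l ^+ 4 = (l ^+ 2) ^+ 2 by rewrite -exprM.
    by rewrite ler_pXn2r// nnegrE// exprn_ge0// ltW.
  have l40 : 0 <= l ^+ 4 by rewrite exprn_ge0// ltW.
  have l30 : 0 <= l ^+ 3 by rewrite exprn_ge0// ltW.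
  pose Y := e * (l ^+ 4 + 2 * l ^+ 3 + 1).
  have Y0 : 0 <= Y by rewrite mulr_ge0 ?addr_ge0 ?mulr_ge0 ?ltW.
  have YC : Y * C <= 8^-1.
    by apply: le_trans eB; rewrite ler_wpM2l//; lra.
  have Y8 : Y <= 8^-1.
    by apply: le_trans eB; rewrite ler_peMr//; lra.
  have cY : e * s ^+ 2 <= Y by rewrite ler_wpM2l ?(ltW e0)//; lra.
  have c0 : 0 <= e * s ^+ 2 by rewrite mulr_ge0 ?(ltW e0)// exprn_ge0.
  have c8 : e * s ^+ 2 <= 1 by apply: le_trans cY _; clear -Y8; lra.
  split.
  + exact: c8.
  + apply: le_trans YC; rewrite mulrC ler_wpM2r//.
    by apply: le_trans cY; rewrite [X in X <= _]expr2; apply: ler_piMl.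
  + have h : `|al + be - 2 * x| <= l by rewrite ler_norml /l; lra.
    have e20 : 0 <= 2 * e by apply: mulr_ge0 => //; exact: ltW.
    rewrite normrM ger0_norm; last exact: mulr_ge0.
    apply: le_trans (_ : 2 * e * l ^+ 2 * l <= _).
      by apply: ler_pM => //; [exact: mulr_ge0|exact: ler_wpM2l].
    apply: le_trans Y8; rewrite /Y.
    have -> : 2 * e * l ^+ 2 * l = e * (2 * l ^+ 3) by ring.
    by apply: ler_wpM2l; [exact: ltW|clear -l40 l30; lra].
  + rewrite -subr_ge0.
    have ln0 : l != 0 by rewrite gt_eqF.
    have -> : (al + be - 2 * x) ^+ 2 = l ^+ 2 - 4 * s by rewrite /l /s; ring.
    have -> : 2 * e * (l ^+ 2 - 4 * s - 2 * s) - - (18 / l ^+ 2) * (e * s ^+ 2)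
        = 2 * e * (l - 3 * s / l) ^+ 2 by field.
    by apply: mulr_ge0 (sqr_ge0 _); apply: mulr_ge0 => //; exact: ltW.
Qed.

(** If [u t x0] is below [rho0 / 4], so is [u t] on [[x1, x0]] by monotonicity, and
    [rho >= rho0 / 2] turns the barrier into [p >= c * rho0 / 4] there. Integrating this from [x1],
    where [u] is positive, bounds [u t x0] from below. *)
Lemma graph_flow_lower_bound (k C rho0 : R) (f G G1 L L1 : R -> R)
    (al be t0 T : R) (u p q m v pt : R -> R -> R) (Hb : R -> R) (x0 : R) :
  0 <= k -> al < x0 < be -> t0 < T -> axis_bounds rho0 C f G G1 L L1 ->
  graph_flow k f G L al be t0 T u p q m v pt Hb ->
  barrier_rate k (18 / (be - al) ^+ 2) C (2 / rho0) * (T - t0) <= rho0 / 2 ->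
  exists2 delta : R, 0 < delta & forall t, t0 <= t < T -> delta <= u t x0.
Proof.
move=> k0 /andP[ax0 x0b] t0T ax gf KT.
have albe : al < be by lra.
have /andP[rho00 rho01] := axis_rho0 ax.
have C0 : 0 <= C.
  have [|_ h _ _ _] := axis_bound ax (r := rho0 / 2); first by lra.
  by apply: le_trans h.
have t00 : t0 <= t0 < T by rewrite lexx.
have [|xm xmab pm] := @EVT_min R (p t0) al be (ltW albe).
  apply: continuous_in_subspaceT => x; rewrite inE/= in_itv/= => xab.
  by have [_ /drv_continuous] := gf_x gf t00 xab.
rewrite in_itv/= in xmab.
have [_ pm0] := gf_pos gf t00 xmab.
pose M := (be - al) ^+ 4 + 2 * (be - al) ^+ 3 + 1.
have l0 : 0 < be - al by lra.
have M1 : 1 <= M.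
  have := exprn_gt0 4 l0; have := exprn_gt0 3 l0; rewrite /M; lra.
have M0 : 0 < M by lra.
(* The first bound is the smallness required by [small_bump_sqr]; the second puts the barrier below
   half the minimal slope at time [t0]. [T - t0] is already fixed here, which is legitimate since
   the rate does not involve [e]. *)
pose e := Num.min (8^-1 / (M * (C + 1))) (p t0 xm / 2 / M).
have C10 : 0 < C + 1 by lra.
have MC0 : 0 < M * (C + 1) by rewrite mulr_gt0.
have e0 : 0 < e.
  by rewrite lt_min !divr_gt0// invr_gt0.
have eB : e * M * (C + 1) <= 8^-1.
  by rewrite -mulrA -ler_pdivlMr// ge_min lexx.
have eM : e * M <= p t0 xm / 2 by rewrite -ler_pdivlMr// ge_min lexx orbT.
have bp := small_bump_sqr albe C0 e0 eB.
have B0 : 0 <= 18 / (be - al) ^+ 2 by rewrite divr_ge0// exprn_ge0// ltW.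
have init x : al <= x <= be ->
    e * ((x - al) * (be - x)) ^+ 2 * rho0 < p t0 x.
  move=> xab.
  have := pm x; rewrite in_itv/= xab => /(_ isT) pmx.
  have s0 : 0 <= (x - al) * (be - x) by rewrite mulr_ge0//; lra.
  have sl : (x - al) * (be - x) <= (be - al) ^+ 2.
    by rewrite expr2; clear -xab; apply: ler_pM; lra.
  have s2M : ((x - al) * (be - x)) ^+ 2 <= M.
    apply: le_trans (_ : (be - al) ^+ 4 <= _).
      have -> : (be - al) ^+ 4 = ((be - al) ^+ 2) ^+ 2 by rewrite -exprM.
      by rewrite ler_pXn2r// nnegrE// exprn_ge0// ltW.
    by have := exprn_gt0 3 l0; rewrite /M; lra.
  have h1 : e * ((x - al) * (be - x)) ^+ 2 <= e * M by rewrite ler_wpM2l// ltW.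
  have h0 : 0 <= e * ((x - al) * (be - x)) ^+ 2 by rewrite mulr_ge0 ?exprn_ge0// ltW.
  have h2 : e * ((x - al) * (be - x)) ^+ 2 * rho0 <= e * ((x - al) * (be - x)) ^+ 2.
    by rewrite ler_piMr.
  lra.
have bar := barrier_comparison k0 B0 albe ax gf bp KT init.
set K := barrier_rate _ _ _ _ in KT bar.
have K0 : 0 <= K by apply: barrier_rate_ge0 => //; rewrite divr_ge0// ltW.
pose x1 := (al + x0) / 2.
(* A lower bound for [(y - al) * (be - y)] over [y] in [[x1, x0]], each factor being smallest at one
   of the ends. *)
pose s := (x1 - al) * (be - x0).
have s0 : 0 < s by clear -ax0 x0b; rewrite mulr_gt0// /x1; lra.
pose d := e * s ^+ 2 * (rho0 / 4).
have r4 : 0 < rho0 / 4 by rewrite divr_gt0.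
have d0 : 0 < d by apply: mulr_gt0 r4; apply: mulr_gt0 => //; exact: exprn_gt0.
exists (Num.min (rho0 / 4) (d * (x0 - x1))).
  rewrite lt_min divr_gt0//=; apply: mulr_gt0 => //.
  by clear -ax0; rewrite /x1; lra.
move=> t tT; rewrite ge_min.
have [//|ult] := leP (rho0 / 4) (u t x0).
apply/orP; right.
have ab x : x1 <= x <= x0 -> al <= x <= be by clear -ax0 x0b; rewrite /x1; lra.
have cu y z : x1 <= y -> z <= x0 -> {within `[y, z], continuous (u t)}.
  move=> yx zx; apply: continuous_in_subspaceT => x; rewrite inE/= in_itv/= => xab.
  have /ab xab' : x1 <= x <= x0 by clear -xab yx zx; lra.
  by have [/drv_continuous] := gf_x gf tT xab'.
have du x : x1 <= x <= x0 -> is_derive x 1 (u t) (p t x).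
  by move=> /ab; case/(gf_x gf tT).
have x10 : x1 < x0 by clear -ax0; rewrite /x1; lra.
have ux x : x1 <= x <= x0 -> u t x <= u t x0.
  move=> /andP[x1x xx0].
  have [y|y] := @MVT_segment R (u t) (p t) x x0 xx0 _ (cu _ _ x1x (lexx _)).
    by rewrite in_itv/= => yx; apply: du; clear -yx x1x; lra.
  rewrite in_itv/= => yx E; rewrite -subr_ge0 E mulr_ge0 ?subr_ge0//.
  have /ab yab : x1 <= y <= x0 by clear -yx x1x; lra.
  by have [_ /ltW] := gf_pos gf tT yab.
have [y|y] := @MVT R (u t) (p t) x1 x0 x10 _ (cu _ _ (lexx _) (lexx _)).
  by rewrite in_itv/= => yx; apply: du; clear -yx; lra.
rewrite in_itv/= => yx E.
have yy : x1 <= y <= x0 by clear -yx; lra.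
have /ab x1ab : x1 <= x1 <= x0 by rewrite lexx ltW.
have [u1 _] := gf_pos gf tT x1ab.
apply: le_trans (_ : u t x0 - u t x1 <= _); last by clear -u1; lra.
rewrite E ler_wpM2r ?subr_ge0 ?(ltW x10)//.
apply: ltW; apply: le_lt_trans (bar t y tT (ab y yy)).
have ltt : K * (t - t0) <= K * (T - t0).
  by rewrite ler_wpM2l//; clear -tT; lra.
have uy := ux y yy.
have ss : s ^+ 2 <= ((y - al) * (be - y)) ^+ 2.
  rewrite ler_pXn2r// ?nnegrE; last 2 first.
  - exact: ltW.
  - by have := ab y yy => /andP[? ?]; rewrite mulr_ge0// subr_ge0.
  rewrite /s; move: yy (ab y yy) ax0 x0b; rewrite /x1; clear => *.
  by apply: ler_pM; lra.
rewrite /d; apply: ler_pM.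
- by apply: mulr_ge0; [exact: ltW|exact: sqr_ge0].
- exact: ltW.
- by rewrite ler_wpM2l// ltW.
- by move: KT ltt uy ult; clear; lra.
Qed.

End LowerBound.

(** * The metric near the axis *)

Section Dot.
Context {R : realType} {n : nat}.
Implicit Types (x y w : 'rV[R]_n) (c : R).

Lemma dotC x y : dot x y = dot y x.
Proof. by apply: eq_bigr => i _; rewrite mulrC. Qed.

Lemma dotDl x y w : dot (x + y) w = dot x w + dot y w.
Proof. by rewrite -big_split; apply: eq_bigr => i _; rewrite mxE mulrDl. Qed.

Lemma dotZl c x w : dot (c *: x) w = c * dot x w.
Proof. by rewrite /dot big_distrr/=; apply: eq_bigr => i _; rewrite mxE mulrA. Qed.

Lemma dotDr x y w : dot w (x + y) = dot w x + dot w y.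
Proof. by rewrite !(dotC w) dotDl. Qed.

Lemma dotZr c x w : dot w (c *: x) = c * dot w x.
Proof. by rewrite !(dotC w) dotZl. Qed.

Lemma dotNl x w : dot (- x) w = - dot x w.
Proof. by rewrite -scaleN1r dotZl mulN1r. Qed.

Lemma dotNr x w : dot w (- x) = - dot w x.
Proof. by rewrite !(dotC w) dotNl. Qed.

Lemma dot0l w : dot 0 w = 0.
Proof. by rewrite -(scale0r (0 : 'rV[R]_n)) dotZl mul0r. Qed.

Lemma dot0r w : dot w 0 = 0.
Proof. by rewrite dotC dot0l. Qed.

Lemma dot_ge0 x : 0 <= dot x x.
Proof. by apply: sumr_ge0 => i _; rewrite -expr2 sqr_ge0. Qed.

Lemma dot_eq0 x : (dot x x == 0) = (x == 0).
Proof.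
apply/eqP/eqP => [|->]; last exact: dot0l.
move=> /eqP; rewrite psumr_eq0; last by move=> i _; rewrite -expr2 sqr_ge0.
move=> /allP h; apply/rowP => i; rewrite mxE; apply/eqP.
by have := h i (mem_index_enum i); rewrite /= mulf_eq0 orbb.
Qed.

Lemma enorm_sqr x : enorm x ^+ 2 = dot x x.
Proof. by rewrite sqr_sqrtr// dot_ge0. Qed.

Lemma enorm_ge0 x : 0 <= enorm x.
Proof. exact: sqrtr_ge0. Qed.

Lemma enorm_eq0 x : (enorm x == 0) = (x == 0).
Proof. by rewrite -dot_eq0 -enorm_sqr sqrf_eq0. Qed.

Lemma enorm_gt0 x : (0 < enorm x) = (x != 0).
Proof. by rewrite lt0r enorm_eq0 enorm_ge0 andbT. Qed.

Lemma enormZ c x : enorm (c *: x) = `|c| * enorm x.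
Proof.
by rewrite /enorm dotZl dotZr mulrA -expr2 sqrtrM ?sqr_ge0// sqrtr_sqr.
Qed.

Lemma dot_delta (i j : 'I_n) :
  dot (delta_mx 0 i) (delta_mx 0 j) = (i == j)%:R :> R.
Proof.
rewrite /dot (bigD1 i)//= big1 => [|k ki]; rewrite !mxE ?eqxx/=.
  by rewrite mul1r addr0.
by rewrite (negbTE ki) mul0r.
Qed.

Lemma enorm_delta (i : 'I_n) : enorm (delta_mx 0 i : 'rV[R]_n) = 1.
Proof. by rewrite /enorm dot_delta eqxx sqrtr1. Qed.

End Dot.

Section LogDerivative.
Context {R : realType}.
Implicit Types (F : R -> R) (U : set R).

Lemma Ck_derive1 k U F : Ck k.+1 U F ->
  (forall x, U x -> derivable F x 1) /\ Ck k U (derive1 F).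
Proof.
move=> /= /(_ 1)[dF cF]; split => //.
suff -> : (derive1 F) = 'D_1 F by [].
by apply/funext => x; rewrite derive1E.
Qed.

Lemma Ck_continuous k U F : Ck k U F -> forall x, open U -> U x ->
  {for x, continuous F}.
Proof.
case: k => [cF x _ Ux|k /Ck_derive1[dF _] x _ Ux]; first exact: cF.
exact/differentiable_continuous/derivable1_diffP/dF.
Qed.

Lemma derivable_is_derive1 F x : derivable F x 1 -> is_derive x 1 F (derive1 F x).
Proof. by move=> dF; rewrite derive1E; exact: derivableP. Qed.

(* The logarithmic derivative of the square root of [F], and its derivative. *)
Definition sqrt_logd F r := derive1 F r / (2 * F r).

Definition sqrt_logd1 F r :=
  (derive1 (derive1 F) r * (2 * F r) - derive1 F r * (2 * derive1 F r)) / (2 * F r) ^+ 2.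

Lemma is_derive_sqrt_logd U F r : Ck 2 U F -> U r -> F r != 0 ->
  is_derive r 1 (sqrt_logd F) (sqrt_logd1 F r).
Proof.
move=> /Ck_derive1[dF /Ck_derive1[dF1 _]] Ur F0.
have d1 := derivable_is_derive1 (dF _ Ur).
have d2 := derivable_is_derive1 (dF1 _ Ur).
by apply: (drv_div d2 (drv_scale 2 d1)); rewrite mulf_neq0.
Qed.

Lemma sqrt_logd_continuous U F r : open U -> Ck 2 U F -> U r -> F r != 0 ->
  {for r, continuous (sqrt_logd F)} /\ {for r, continuous (sqrt_logd1 F)}.
Proof.
move=> oU C2 Ur F0; split.
  by have /drv_continuous := is_derive_sqrt_logd C2 Ur F0.
have c0 := Ck_continuous C2 oU Ur.
have [_ C1] := Ck_derive1 C2.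
have c1 := Ck_continuous C1 oU Ur.
have [_ C0] := Ck_derive1 C1.
have c2 := Ck_continuous C0 oU Ur.
have c2F : {for r, continuous (fun r => 2 * F r)}.
  by apply: cvgM => //; exact: cvg_cst.
apply: cvgM; last first.
  apply: cvgV; first by rewrite expf_neq0// mulf_neq0.
  by apply: cvgM.
apply: cvgB; apply: cvgM => //.
by apply: cvgM => //; exact: cvg_cst.
Qed.

(** Used for [f] and [h/r]: only their squares occur as metric coefficients, and positivity allows
    the square root to be differentiated. *)
Lemma is_derive_sqrt_of_sqr (f F : R -> R) U r : open U -> Ck 1 U F -> U r ->
  (forall s, U s -> 0 < f s /\ F s = f s ^+ 2) ->
  is_derive r 1 f (sqrt_logd F r * f r).
Proof.
move=> oU /Ck_derive1[dF _] Ur fF.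
have [fr0 Fr] := fF r Ur.
have F0 : 0 < F r by rewrite Fr exprn_gt0.
have := drv_sqrt (derivable_is_derive1 (dF _ Ur)) F0.
have -> : Num.sqrt (F r) = f r by rewrite Fr sqrtr_sqr gtr0_norm.
move=> d; apply: (@near_eq_is_derive _ _ _ (fun y => Num.sqrt (F y))).
  have : \forall s \near r, U s by exact: open_nbhs_nbhs.
  by apply: filterS => s /fF[fs ->]; rewrite sqrtr_sqr gtr0_norm.
apply: drv_eq d _; rewrite /sqrt_logd Fr; field.
by rewrite gt_eqF.
Qed.

End LogDerivative.

(** * Smoothness of the metric coefficients across the axis *)

Section Profile.
Context {R : realType} {n : nat} (S : rotsym R n).
Local Notation f := (fz S).
Local Notation h := (hu S).

Section Radial.
Context (z0 : R) (hz : zdom S z0) (i0 : 'I_n).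

Lemma radial_smooth (v w : pt R n) : exists2 W : set R, open W &
  (forall s : R, (`|s|%:E < rad S)%E -> W s) /\
  forall k, Ck k W (fun s : R =>
     metric f h ((z0, 0) + s *: (0, delta_mx 0 i0)) v w).
Proof.
have [U [oU cylU CU]] := metric_smooth S v w.
exists [set s : R | U ((z0, 0) + s *: (0, delta_mx 0 i0))].
  exact: open_line.
split => [s sR|k]; last by apply: (Ck_line (F := fun p => metric f h p v w)).
apply: cylU; split => /=; first by rewrite /GRing.scale/= mulr0 addr0.
by rewrite add0r enormZ enorm_delta mulr1.
Qed.

Lemma metric_radial_z (s : R) :
  metric f h ((z0, 0) + s *: (0, delta_mx 0 i0)) (1, 0) (1, 0) = f `|s| ^+ 2.
Proof.
rewrite /metric /= add0r enormZ enorm_delta !mulr1 !dot0r.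
by case: ifP => _; rewrite ?mul0r ?subr0 ?mulr0 ?addr0.
Qed.

Lemma metric_radial_u (i1 : 'I_n) (s : R) : i0 != i1 ->
  metric f h ((z0, 0) + s *: (0, delta_mx 0 i0)) (0, delta_mx 0 i1)
    (0, delta_mx 0 i1) = if s == 0 then 1 else (h `|s| / `|s|) ^+ 2.
Proof.
move=> i01; rewrite /metric /= add0r enormZ enorm_delta mulr1 mulr0 mulr0 add0r.
rewrite dotZl !dot_delta eqxx (negbTE i01) mulr0 mul0r.
have e0 : delta_mx 0 i0 != 0 :> 'rV[R]_n.
  by rewrite -enorm_eq0 enorm_delta oner_neq0.
by rewrite scaler_eq0 (negbTE e0) orbF mul0r subr0 mulr1 add0r.
Qed.

End Radial.

Hypothesis n2 : (2 <= n)%N.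
Context (z0 : R) (hz : zdom S z0).



(** The metric is restricted to a line crossing the axis orthogonally. Its value on [d/dz] is [f^2],
    and on a direction orthogonal to that line and to [d/dz], which exists as [n >= 2], it is
    [(h/r)^2]. The signed parameter [s] makes 0 an interior point, so that bounds up to the axis
    follow from continuity. *)
Lemma profile_smooth : exists (F K : R -> R) (W : set R),
  [/\ open W, forall s : R, (`|s|%:E < rad S)%E -> W s,
      (forall k, Ck k W F) /\ (forall k, Ck k W K),
      forall s, F s = f `|s| ^+ 2 &
      forall s, K s = if s == 0 then 1 else (h `|s| / `|s|) ^+ 2].
Proof.
pose i0 := Ordinal (ltnW n2); pose i1 := Ordinal n2.
have [W1 oW1 [sW1 C1]] := radial_smooth hz i0 (1, 0) (1, 0).
have [W2 oW2 [sW2 C2]] :=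
  radial_smooth hz i0 (0, delta_mx 0 i1) (0, delta_mx 0 i1).
exists (fun s => metric f h ((z0, 0) + s *: (0, delta_mx 0 i0)) (1, 0) (1, 0)).
exists (fun s => metric f h ((z0, 0) + s *: (0, delta_mx 0 i0))
   (0, delta_mx 0 i1) (0, delta_mx 0 i1)).
exists (W1 `&` W2); split.
- exact: openI.
- by move=> s sr; split; [exact: sW1|exact: sW2].
- by split => k; [apply: Ck_subset (C1 k)|apply: Ck_subset (C2 k)] => s [].
- by move=> s; rewrite metric_radial_z.
- by move=> s; rewrite metric_radial_u.
Qed.

Lemma open_radii : open [set r : R | 0 < r /\ (r%:E < rad S)%E].
Proof.
apply: openI; first exact: open_gt.
case: (rad S) => [x| |] /=.
- rewrite -/[set r : R | (r%:E < x%:E)%E].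
  have -> : [set r : R | (r%:E < x%:E)%E] = [set r | r < x].
    by apply/seteqP; split => r /=; rewrite lte_fin.
  exact: open_lt.
- rewrite -/[set r : R | (r%:E < +oo)%E].
  have -> : [set r : R | (r%:E < +oo)%E] = setT.
    by apply/seteqP; split => r //= _; rewrite ltry.
  exact: openT.
- rewrite -/[set r : R | (r%:E < -oo)%E].
  have -> : [set r : R | (r%:E < -oo)%E] = set0.
    by apply/seteqP; split => r //=; rewrite ltNge leNye.
  exact: open0.
Qed.

(** Writing [h = r * (h/r)] splits the logarithmic derivative of [h] into the singular part [1/r]
    and that of [h/r], which is continuous at the axis together with its derivative. *)
Lemma profile_log : exists (g l g1 l1 : R -> R) (e : R),
  [/\ 0 < e,
      forall r, 0 < r -> (r%:E < rad S)%E ->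
        [/\ is_derive r 1 f (g r * f r), is_derive r 1 g (g1 r),
            is_derive r 1 h ((r^-1 + l r) * h r) & is_derive r 1 l (l1 r)],
      {for 0, continuous g} /\ {for 0, continuous l},
      {for 0, continuous g1} /\ {for 0, continuous l1} &
      forall r, 0 < r < e -> 2^-1 <= f r /\ (r%:E < rad S)%E].
Proof.
have [F [K [W [oW sW [CF CK] FE KE]]]] := profile_smooth.
have W0 : W 0 by apply: sW; rewrite normr0; exact: rad_gt0.
have F0 : F 0 = 1 by rewrite FE normr0 fz0 expr1n.
have K0 : K 0 = 1 by rewrite KE eqxx.
have F00 : F 0 != 0 by rewrite F0 oner_neq0.
have K00 : K 0 != 0 by rewrite K0 oner_neq0.
have [cg cg1] := sqrt_logd_continuous oW (CF 2) W0 F00.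
have [cl cl1] := sqrt_logd_continuous oW (CK 2) W0 K00.
have [e e0 eP] : exists2 e : R, 0 < e &
    forall r, 0 < r < e -> 2^-1 <= f r /\ (r%:E < rad S)%E.
  have cF := Ck_continuous (CF 0) oW W0.
  have F14 : 4^-1 < F 0 by rewrite F0; lra.
  have /cvgr_gt /(_ _ F14) /nbhs_ballP[e1/= e10 e1P] := cF.
  have [r1 r10 r1P] : exists2 r1 : R, 0 < r1 & (r1%:E <= rad S)%E.
    have := rad_gt0 S; case: (rad S) => [x|_|//].
      by rewrite lte_fin => x0; exists x.
    by exists 1; rewrite ?leey.
  exists (Num.min e1 r1); first by rewrite lt_min e10.
  move=> r /andP[r0]; rewrite lt_min => /andP[re1 rr1].
  have rR : (r%:E < rad S)%E by apply: lt_le_trans r1P; rewrite lte_fin.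
  split => //; have fr0 := fz_gt0 (ltW r0) rR.
  have : ball (0 : R) e1 r by rewrite -ball_normE /= sub0r normrN gtr0_norm.
  move=> /e1P; rewrite FE gtr0_norm// => fr.
  rewrite leNgt; apply/negP => fr2; move: fr; rewrite expr2; nra.
exists (sqrt_logd F), (sqrt_logd K), (sqrt_logd1 F), (sqrt_logd1 K), e.
split => // r r0 rR.
pose V := [set r : R | 0 < r /\ (r%:E < rad S)%E].
have oV : open V := open_radii.
have Vr : V r by split.
have VW : V `<=` W.
  by move=> s [s0 sR]; apply: sW; rewrite gtr0_norm.
have CkV k (G : R -> R) : Ck k W G -> Ck k V G := @Ck_subset R _ _ k V W G VW.
have FV s : V s -> 0 < f s /\ F s = f s ^+ 2.
  move=> [s0 sR]; split; first exact: fz_gt0 (ltW s0) sR.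
  by rewrite FE gtr0_norm.
have KV s : V s -> 0 < h s / s /\ K s = (h s / s) ^+ 2.
  move=> [s0 sR]; split; first by rewrite divr_gt0// hu_gt0.
  by rewrite KE gt_eqF// gtr0_norm.
split.
- exact: (is_derive_sqrt_of_sqr oV (CkV _ _ (CF 1)) Vr FV).
- apply: (is_derive_sqrt_logd (CkV _ _ (CF 2)) Vr).
  by have [fr ->] := FV r Vr; rewrite expf_neq0// gt_eqF.
- have d := is_derive_sqrt_of_sqr oV (CkV _ _ (CK 1)) Vr KV.
  have d1 := drv_mul (drv_id r) d.
  apply: drv_eq (_ : is_derive r 1 h (1 * (h r / r) + r * (sqrt_logd K r * (h r / r)))) _; last first.
    by field; rewrite gt_eqF.
  apply: near_eq_is_derive d1.
  have : \forall s \near r, V s by exact: open_nbhs_nbhs.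
  by apply: filterS => s [s0 _]; rewrite mulrC divfK// gt_eqF.
- apply: (is_derive_sqrt_logd (CkV _ _ (CK 2)) Vr).
  by have [fr ->] := KV r Vr; rewrite expf_neq0// gt_eqF.
Qed.

End Profile.

Definition log_profile (R : realType) (n : nat) (S : rotsym R n)
    (G G1 L L1 : R -> R) : Prop :=
  forall r, 0 < r -> (r%:E < rad S)%E ->
    [/\ is_derive r 1 (fz S) (G r * fz S r), is_derive r 1 G (G1 r),
        is_derive r 1 (hu S) (L r * hu S r) & is_derive r 1 L (L1 r)].

Lemma log_profile_exists (R : realType) (n : nat) (S : rotsym R n) (z0 : R) :
  (2 <= n)%N -> zdom S z0 ->
  exists (G G1 L L1 : R -> R) (rho0 C : R),
  [/\ log_profile S G G1 L L1, axis_bounds rho0 C (fz S) G G1 L L1 &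
      forall r, 0 < r < rho0 -> (r%:E < rad S)%E].
Proof.
move=> n2 hz.
have [g [l [g1 [l1 [e [e0 dP [cg cl] [cg1 cl1] eP]]]]]] := profile_log n2 hz.
pose L r := r^-1 + l r; pose L1 r := - r ^- 2 + l1 r.
have dL r : 0 < r -> (r%:E < rad S)%E -> is_derive r 1 L (L1 r).
  move=> r0 rR; have [_ _ _ dl] := dP r r0 rR.
  apply: drv_eq (drv_add (drv_inv (drv_id r) _) dl) _; first by rewrite gt_eqF.
  by rewrite mulNr mul1r.
have bnd (u : R -> R) : {for 0, continuous u} ->
    exists2 d : R, 0 < d & forall r, 0 < r < d -> `|u r| <= `|u 0| + 1.
  move=> /cvgrPdist_lt /(_ 1 ltr01) /nbhs_ballP[d/= d0 dB].
  exists d => // r /andP[r0 rd].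
  have : ball (0 : R) d r by rewrite -ball_normE /= sub0r normrN gtr0_norm.
  move=> /dB /= h; rewrite -[u r](subKr (u 0)).
  by apply: le_trans (ler_normB _ _) _; rewrite lerD2l ltW.
have [d1 d10 B1] := bnd g cg; have [d2 d20 B2] := bnd l cl.
have [d3 d30 B3] := bnd g1 cg1; have [d4 d40 B4] := bnd l1 cl1.
pose rho0 := Num.min 1 (Num.min e (Num.min (Num.min d1 d2) (Num.min d3 d4))).
pose C := `|g 0| + `|l 0| + `|g1 0| + `|l1 0| + 1.
have rP r : 0 < r < rho0 ->
    [/\ 0 < r < e, 0 < r < d1, 0 < r < d2, 0 < r < d3 & 0 < r < d4].
  by rewrite /rho0 !lt_min => /andP[-> /and3P[_ -> /andP[/andP[-> ->] /andP[-> ->]]]].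
exists g, g1, L, L1, rho0, C; split.
- move=> r r0 rR; have [df dg dh _] := dP r r0 rR; split => //.
  exact: dL.
- split.
  + by rewrite /rho0 ge_min lexx !lt_min ltr01 e0 d10 d20 d30 d40.
  + move=> r /rP[/eP[f2 _] /B1 b1 /B2 b2 /B3 b3 /B4 b4].
    have n1 := normr_ge0 (g 0); have n2' := normr_ge0 (l 0).
    have n3 := normr_ge0 (g1 0); have n4 := normr_ge0 (l1 0).
    split => //.
    * by apply: (le_trans b1); rewrite /C; lra.
    * by apply: (le_trans b3); rewrite /C; lra.
    * by rewrite /L addrAC subrr add0r; apply: (le_trans b2); rewrite /C; lra.
    * by rewrite /L1 addrAC addNr add0r; apply: (le_trans b4); rewrite /C; lra.
  + move=> r rr; have [/eP[_ rR] _ _ _ _] := rP r rr.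
    have /andP[r0 _] := rr.
    by have [df dg dh _] := dP r r0 rR; split => //; exact: dL.
- by move=> r /rP[/eP[]].
Qed.

(** * Signs of the derivatives of [f] and [h] *)

Section Signs.
Context {R : realType} {n : nat} (S : rotsym R n) (G G1 L L1 : R -> R).
Hypothesis prof : log_profile S G G1 L L1.
Local Notation f := (fz S).
Local Notation h := (hu S).

Lemma radii_nbhs (r : R) : 0 < r -> (r%:E < rad S)%E ->
  \forall s \near r, 0 < s /\ (s%:E < rad S)%E.
Proof.
move=> r0 rR; apply: open_nbhs_nbhs; split; last by split.
exact: open_radii.
Qed.

Lemma derive1_fz r : 0 < r -> (r%:E < rad S)%E -> derive1 f r = G r * f r.
Proof. by move=> r0 rR; rewrite derive1E; have [[_ <-]] := prof r0 rR. Qed.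

Lemma derive1_hu r : 0 < r -> (r%:E < rad S)%E -> derive1 h r = L r * h r.
Proof. by move=> r0 rR; rewrite derive1E; have [_ _ [_ <-]] := prof r0 rR. Qed.

Lemma is_derive_derive1_hu r : 0 < r -> (r%:E < rad S)%E ->
  is_derive r 1 (derive1 h) (derive1n 2 h r).
Proof.
move=> r0 rR; have [_ _ dh dL] := prof r0 rR.
have : is_derive r 1 (derive1 h) (L1 r * h r + L r * (L r * h r)).
  apply: near_eq_is_derive (drv_mul dL dh).
  by apply: filterS (radii_nbhs r0 rR) => s [s0 sR]; rewrite derive1_hu.
by move=> d; rewrite /derive1n /= derive1E; case: d => d _; exact: derivableP.
Qed.

(** In the curved case [h'] is positive near the axis, where [L] behaves like [1/r], and
    nondecreasing because [h'' = - S_ri h >= 0]; so [h' > 0]. Then [S_zi = - L G < 0] forces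
    [G > 0]. In the Euclidean case [G = 0] and [L = 1/r]. *)
Lemma log_profile_ge0 rho0 C : axis_bounds rho0 C f G G1 L L1 ->
  (forall r, 0 < r < rho0 -> (r%:E < rad S)%E) ->
  neg_curved S \/ euclidean S ->
  forall r, 0 < r -> (r%:E < rad S)%E -> 0 <= G r /\ 0 <= L r.
Proof.
move=> ax axR [[nc _]|[_ _ eu]] r r0 rR; last first.
  have [df _ dh _] := prof r0 rR.
  have [f1 h1] := eu r (ltW r0).
  have df1 : is_derive r 1 f 0.
    apply: near_eq_is_derive (drv_cst 1 r 1).
    by apply: filterS (radii_nbhs r0 rR) => s [s0 _]; rewrite (eu s (ltW s0)).1.
  have dh1 : is_derive r 1 h 1.
    apply: near_eq_is_derive (drv_id r).
    by apply: filterS (radii_nbhs r0 rR) => s [s0 _]; rewrite (eu s (ltW s0)).2.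
  have GE : G r = 0 by case: df df1 => _ E [_ E']; rewrite -E' E f1 mulr1.
  have LE : L r * r = 1 by case: dh dh1 => _ E [_ E']; rewrite -E' E h1.
  rewrite GE; split => //.
  by rewrite -(pmulr_lge0 _ r0) LE.
have Lpos : 0 < L r.
  have /andP[rho00 rho01] := axis_rho0 ax.
  have C0 : 0 <= C.
    have [|_ h' _ _ _] := axis_bound ax (r := rho0 / 2); first by lra.
    by apply: le_trans h'.
  (* A radius below [r], within the range of [axis_bounds], and so small that [s^-1 >= C + 1],
     whence [L s > 0]. *)
  pose s := Num.min r (Num.min (rho0 / 2) (C + 1)^-1).
  have C1 : 0 < C + 1 by lra.
  have s0 : 0 < s by rewrite !lt_min r0 divr_gt0//= invr_gt0.
  have sr : s <= r by rewrite ge_min lexx.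
  have srho : 0 < s < rho0.
    rewrite s0 !gt_min; apply/orP; right; apply/orP; left; lra.
  have sC : C + 1 <= s^-1.
    rewrite -[leLHS]invrK lef_pV2 ?posrE ?invr_gt0//.
    by rewrite !ge_min lexx !orbT.
  have sR := axR s srho.
  have Ls : 0 < L s.
    have [_ _ _ + _] := axis_bound ax srho.
    by rewrite ler_norml; lra.
  have hs : 0 < derive1 h s by rewrite derive1_hu// mulr_gt0// hu_gt0.
  have yR y : s <= y <= r -> 0 < y /\ (y%:E < rad S)%E.
    move=> /andP[sy yr]; split; first exact: lt_le_trans sy.
    by apply: le_lt_trans rR; rewrite lee_fin.
  have [y| |y yy E] := @MVT_segment R (derive1 h) (derive1n 2 h) s r sr.
  - rewrite in_itv/= => yy; have [|y0 yR'] := yR y; first by lra.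
    exact: is_derive_derive1_hu.
  - apply: derivable_within_continuous => y; rewrite in_itv/= => yy.
    have [y0 yR'] := yR y yy.
    by have [] := is_derive_derive1_hu y0 yR'.
  rewrite in_itv/= in yy.
  have [y0 yR'] := yR y yy.
  have hy : 0 <= derive1n 2 h y.
    have [_] := nc y y0 yR'.
    rewrite /S_ri oppr_le0 pmulr_lge0// invr_gt0.
    exact: hu_gt0.
  have : 0 < derive1 h r.
    have : 0 <= derive1n 2 h y * (r - s) by rewrite mulr_ge0// subr_ge0.
    rewrite -E; lra.
  by rewrite derive1_hu// pmulr_lgt0// hu_gt0.
split; last exact: ltW.
have [+ _] := nc r r0 rR.
have fr := fz_gt0 (ltW r0) rR; have hr := hu_gt0 r0 rR.
rewrite /S_zi oppr_lt0 derive1_hu// derive1_fz//.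
have -> : L r * h r * (G r * f r) / (h r * f r) = L r * G r.
  by field; rewrite !gt_eqF.
by rewrite pmulr_rgt0// => /ltW.
Qed.

End Signs.

(** * Mean curvature of a hypersurface of revolution *)

Section DirectionalDerivatives.
Context {R : realType} {V : normedModType R}.

Lemma is_derive_lineP (F : V -> R) (p v : V) (l : R) :
  is_derive p v F l <-> is_derive (0 : R) 1 (fun s : R => F (p + s *: v)) l.
Proof.
split=> -[d <-]; split.
- by rewrite derivable_line scale0r addr0 scale1r.
- by rewrite derive_line scale0r addr0 scale1r.
- by move: d; rewrite derivable_line scale0r addr0 scale1r.
- by rewrite derive_line scale0r addr0 scale1r.
Qed.

Lemma is_derive_comp_dir (phi : R -> R) (F : V -> R) (p v : V) (d l : R) :
  is_derive (F p) 1 phi d -> is_derive p v F l ->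
  is_derive p v (fun q => phi (F q)) (d * l).
Proof.
move=> dphi /is_derive_lineP dF; apply/is_derive_lineP.
by apply: (drv_comp (f := phi)) dF; rewrite scale0r addr0.
Qed.

End DirectionalDerivatives.

Section Coordinates.
Context {R : realType} {n : nat}.
Implicit Types (p v w : pt R n).

Lemma is_derive_z p v : is_derive p v (fun q : pt R n => q.1) v.1.
Proof.
apply/is_derive_lineP.
have -> : (fun s : R => (p + s *: v).1) = (fun s => p.1 + s * v.1) by [].
have h := drv_add (drv_cst p.1 (0 : R) 1) (drv_mul (drv_id 0) (drv_cst v.1 (0 : R) 1)).
by apply: drv_eq h _; ring.
Qed.

Lemma is_derive_dot p v (y : 'rV[R]_n) :
  is_derive p v (fun q : pt R n => dot q.2 y) (dot v.2 y).
Proof.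
apply/is_derive_lineP.
have -> : (fun s : R => dot (p + s *: v).2 y) =
          (fun s => dot p.2 y + s * dot v.2 y).
  by apply/funext => s; rewrite dotDl dotZl.
have h := drv_add (drv_cst (dot p.2 y) (0 : R) 1)
  (drv_mul (drv_id 0) (drv_cst (dot v.2 y) (0 : R) 1)).
by apply: drv_eq h _; ring.
Qed.

Lemma is_derive_enorm_line (x y : 'rV[R]_n) : x != 0 ->
  is_derive (0 : R) 1 (fun s : R => enorm (x + s *: y)) (dot x y / enorm x).
Proof.
move=> x0.
have d : is_derive (0 : R) 1 (fun s : R => dot (x + s *: y) (x + s *: y))
    (2 * dot x y).
  have -> : (fun s : R => dot (x + s *: y) (x + s *: y)) =
            (fun s => dot x x + (s * (2 * dot x y) + s ^+ 2 * dot y y)).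
    apply/funext => s.
    rewrite dotDl !dotDr !dotZl !dotZr (dotC y x); ring.
  have h := drv_add (drv_cst (dot x x) (0 : R) 1)
    (drv_add (drv_mul (drv_id 0) (drv_cst (2 * dot x y) (0 : R) 1))
       (drv_mul (drv_sqr (drv_id 0)) (drv_cst (dot y y) (0 : R) 1))).
  by apply: drv_eq h _; ring.
have d0 : 0 < dot (x + 0 *: y) (x + 0 *: y).
  by rewrite scale0r addr0 lt0r dot_eq0 x0 dot_ge0.
apply: drv_eq (drv_sqrt d d0) _.
rewrite scale0r addr0 -/(enorm x); field.
by rewrite gt_eqF// enorm_gt0.
Qed.

Lemma is_derive_enorm p v : p.2 != 0 ->
  is_derive p v (fun q : pt R n => enorm q.2) (dot p.2 v.2 / enorm p.2).
Proof. by move=> p0; apply/is_derive_lineP; exact: is_derive_enorm_line. Qed.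

Lemma is_derive_height (rho : R -> R) p v : p.2 != 0 -> derivable rho p.1 1 ->
  is_derive p v (height rho)
    (dot p.2 v.2 / enorm p.2 - derive1 rho p.1 * v.1).
Proof.
move=> p0 drho; apply: drv_sub; first exact: is_derive_enorm.
apply: is_derive_comp_dir (is_derive_z p v).
exact: derivable_is_derive1.
Qed.

Lemma near_off_axis p : p.2 != 0 -> \forall q \near p, q.2 != 0.
Proof.
move=> p0; have c : {for p, continuous (fun q : pt R n => q.2)} by exact: cvg_snd.
by move/cvgr_neq0 : c; apply.
Qed.

Lemma is_derive_fst (V : normedModType R) (N : V -> pt R n) (q v : V) :
  derivable N q v -> is_derive q v (fun x => (N x).1) ('D_v N q).1.
Proof.
move=> dN.
have h : (fun s : R => s^-1 *: (((fun x => (N x).1) \o shift q) (s *: v) - (N q).1))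
   @ 0^' --> ('D_v N q).1.
  by apply: (cvg_comp _ fst dN); exact: cvg_fst.
by split; [apply/cvg_ex; exists ('D_v N q).1|exact: cvg_lim h].
Qed.

Lemma is_derive_coord (V : normedModType R) (N : V -> pt R n) (q v : V) (i : 'I_n) :
  derivable N q v -> is_derive q v (fun x => (N x).2 0 i) (('D_v N q).2 0 i).
Proof.
move=> dN.
have h : (fun s : R => s^-1 *: (((fun x => (N x).2 0 i) \o shift q) (s *: v)
    - (N q).2 0 i)) @ 0^' --> ('D_v N q).2 0 i.
  have c : {for 'D_v N q, continuous (fun x : pt R n => x.2 0 i)}.
    apply: (@continuous_comp _ _ _ snd (fun A : 'rV[R]_n => A 0 i)).
      exact: cvg_snd.
    exact: coord_continuous.
  have H := cvg_comp _ _ dN c.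
  apply: cvg_trans H; apply: near_eq_cvg; near=> s => /=.
  by rewrite !mxE.
by split; [apply/cvg_ex; exists (('D_v N q).2 0 i)|exact: cvg_lim h].
Unshelve. all: by end_near. Qed.

(** For a fixed base point and a fixed second argument the metric is a linear form of this shape, by
    [metric_linearE]; this differentiates it along a vector field. *)
Lemma is_derive_linear_form (V : normedModType R) (N : V -> pt R n) (q v : V)
    (c : R) (y : 'rV[R]_n) : derivable N q v ->
  is_derive q v (fun x => c * (N x).1 + dot (N x).2 y)
    (c * ('D_v N q).1 + dot ('D_v N q).2 y).
Proof.
move=> dN; apply: drv_add; first exact: drv_scale (is_derive_fst dN).
rewrite /dot.
have -> : (fun x => \sum_i (N x).2 0 i * y 0 i) =
    \sum_i (fun x => (N x).2 0 i * y 0 i).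
  by apply/funext => x; rewrite fct_sumE.
apply: is_derive_sum => i.
by apply: drv_eq (drv_mul (is_derive_coord i dN) (drv_cst (y 0 i) q v)) _; ring.
Qed.

End Coordinates.

Section Metric.
Context {R : realType} {n : nat} (S : rotsym R n) (G G1 L L1 : R -> R).
Hypothesis prof : log_profile S G G1 L L1.
Local Notation f := (fz S).
Local Notation h := (hu S).
Local Notation g := (metric (fz S) (hu S)).
Implicit Types (p v w y : pt R n).

(** [drad] is the form [dr], and [sph] is the Euclidean product of the components orthogonal to the
    radial direction; off the axis the metric is [f^2 dz^2 + drad^2 + sph_factor * sph]. *)
Definition drad p v : R := dot p.2 v.2 / enorm p.2.
Definition sph p v w : R := dot v.2 w.2 - drad p v * drad p w.
Definition sph_factor (r : R) : R := (h r / r) ^+ 2.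

Lemma sphC p v w : sph p v w = sph p w v.
Proof. by rewrite /sph dotC mulrC. Qed.

Lemma metric_offE p v w : p.2 != 0 ->
  g p v w = f (enorm p.2) ^+ 2 * (v.1 * w.1) + drad p v * drad p w
            + sph_factor (enorm p.2) * sph p v w.
Proof. by move=> p0; rewrite /metric (negbTE p0) addrA. Qed.

Lemma is_derive_drad p v y : p.2 != 0 ->
  is_derive p y (drad^~ v) (sph p v y / enorm p.2).
Proof.
move=> p0; have e0 : enorm p.2 != 0 by rewrite enorm_eq0.
apply: drv_eq (drv_div (is_derive_dot p y v.2) (is_derive_enorm y p0) e0) _.
rewrite /sph /drad (dotC v.2); field.
by rewrite e0.
Qed.

Lemma is_derive_sph_factor (r : R) : 0 < r -> (r%:E < rad S)%E ->
  is_derive r 1 sph_factor (2 * sph_factor r * (L r - r^-1)).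
Proof.
move=> r0 rR; have [_ _ dh _] := prof r0 rR.
have r00 : r != 0 by rewrite gt_eqF.
apply: drv_eq (drv_sqr (drv_div dh (drv_id r) r00)) _.
by rewrite /sph_factor; field.
Qed.

(** Provides the three metric terms of Koszul's formula. The middle term comes from the rotation of
    the radial direction: [drad] has derivative [sph p v y / r] along [y]. *)
Lemma is_derive_metric p v w y : p.2 != 0 -> ((enorm p.2)%:E < rad S)%E ->
  let r := enorm p.2 in
  is_derive p y (fun q => g q v w)
    (2 * G r * f r ^+ 2 * drad p y * (v.1 * w.1)
     + (1 - sph_factor r)
       * (sph p v y * drad p w + drad p v * sph p w y) / r
     + 2 * sph_factor r * (L r - r^-1) * drad p y * sph p v w).
Proof.
move=> p0 pR r; have r0 : 0 < r by rewrite enorm_gt0.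
have r00 : r != 0 by rewrite gt_eqF.
have [df _ _ _] := prof r0 pR.
have dr := is_derive_enorm y p0.
have dF := is_derive_comp_dir (F := fun q : pt R n => enorm q.2) df dr.
have dK := is_derive_comp_dir (F := fun q : pt R n => enorm q.2)
  (is_derive_sph_factor r0 pR) dr.
have dv := is_derive_drad v y p0; have dw := is_derive_drad w y p0.
have dvw := drv_mul dv dw.
have D := drv_add (drv_add (drv_mul (drv_sqr dF) (drv_cst (v.1 * w.1) p y)) dvw)
  (drv_mul dK (drv_sub (drv_cst (dot v.2 w.2) p y) dvw)).
apply: drv_eq (_ : is_derive p y (fun q => g q v w) _) _.
  apply: near_eq_is_derive D.
  by apply: filterS (near_off_axis p0) => q q0; rewrite metric_offE.
rewrite -/r -[dot p.2 y.2 / r]/(drad p y) [sph p v w]/sph; field.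
exact: r00.
Qed.

Lemma metric_linearE p v w : p.2 != 0 ->
  let r := enorm p.2 in
  g p v w = f r ^+ 2 * w.1 * v.1
    + dot v.2 (((1 - sph_factor r) * drad p w / r) *: p.2 + sph_factor r *: w.2).
Proof.
move=> p0 r; have r00 : r != 0 by rewrite /r enorm_eq0.
rewrite metric_offE// dotDr !dotZr /sph /drad (dotC v.2 p.2) -/r; field.
exact: r00.
Qed.

Lemma metric_subl p v v' w : p.2 != 0 -> g p (v - v') w = g p v w - g p v' w.
Proof. by move=> p0; rewrite !metric_linearE//= dotDl dotNl; ring. Qed.

Lemma dradxx p : p.2 != 0 -> drad p (0, p.2) = enorm p.2.
Proof.
move=> p0; rewrite /drad /= -enorm_sqr expr2 mulfK// enorm_eq0 //.
Qed.

Lemma sph_radial p v (c d : R) : p.2 != 0 -> sph p v (c, d *: p.2) = 0.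
Proof.
move=> p0; have e0 : enorm p.2 != 0 by rewrite enorm_eq0.
rewrite /sph /drad /= !dotZr -enorm_sqr (dotC v.2); field.
exact: e0.
Qed.

Lemma sph_factor_gt0 (r : R) : 0 < r -> (r%:E < rad S)%E -> 0 < sph_factor r.
Proof. by move=> r0 rR; rewrite exprn_gt0// divr_gt0// hu_gt0. Qed.

Lemma metric_nondegenerate p v : p.2 != 0 -> ((enorm p.2)%:E < rad S)%E ->
  (forall w, g p v w = 0) -> v = 0.
Proof.
move=> p0 pR gv.
have r0 : 0 < enorm p.2 by rewrite enorm_gt0.
have f0 : 0 < f (enorm p.2) := fz_gt0 (ltW r0) pR.
have v10 : v.1 = 0.
  have := gv (1, 0); rewrite metric_offE// /sph /drad /= !dot0r mul0r mulr0 subr0.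
  by rewrite !mulr0 !addr0 mulr1 => /eqP; rewrite mulf_eq0 sqrf_eq0 gt_eqF//= => /eqP.
have dv0 : drad p v = 0.
  have := gv (0, p.2); rewrite metric_offE//= v10.
  rewrite -[(0, p.2)]/(0, p.2) -[X in sph p v (_, X)]scale1r sph_radial// dradxx//.
  by rewrite !mulr0 addr0 add0r => /eqP; rewrite mulf_eq0 (gt_eqF r0) orbF => /eqP.
have := gv (0, v.2); rewrite metric_offE//= v10 dv0 /sph dv0 !mul0r subr0 mulr0 !add0r.
move=> /eqP; rewrite mulf_eq0 gt_eqF ?sph_factor_gt0//= dot_eq0 => /eqP v20.
by rewrite [v]surjective_pairing v10 v20.
Qed.

End Metric.

Section Curve.
Context {R : realType}.

Lemma smooth_near_derive1 (a b : R) (rho : R -> R) (j : nat) (z : R) :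
  smooth_near `[a, b] rho -> a <= z <= b ->
  is_derive z 1 (derive1n j rho) (derive1n j.+1 rho z).
Proof.
move=> [U [oU abU CU]] zab.
have Uz : U z by apply: abU; rewrite /= in_itv.
have C i k : Ck k U (derive1n i rho).
  by elim: i k => [|i IH] k //=; have [] := Ck_derive1 (IH k.+1).
by have [d _] := Ck_derive1 (C j 1); exact: derivable_is_derive1 (d z Uz).
Qed.

End Curve.

Section Hypersurface.
Context {R : realType} {n : nat} (S : rotsym R n) (G G1 L L1 : R -> R).
Hypothesis prof : log_profile S G G1 L L1.
Local Notation f := (fz S).
Local Notation h := (hu S).
Local Notation g := (metric (fz S) (hu S)).
Context (a b : R) (rho : R -> R).
Hypothesis rho_smooth : smooth_near `[a, b] rho.
Hypothesis rho_rad : forall z, a <= z <= b ->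
  0 < rho z /\ ((rho z)%:E < rad S)%E.
Implicit Types (p v w : pt R n) (z : R).
Local Notation rho1 := (derive1 rho).
Local Notation rho2 := (derive1n 2 rho).

(** The length element of the generating curve for [f^2 dz^2 + dr^2]; [normal_z] and [normal_r] are
    the components of its outward unit normal along [d/dz] and [d/dr]. *)
Definition arc_speed z : R := Num.sqrt (f (rho z) ^+ 2 + rho1 z ^+ 2).
Definition normal_z z : R := - rho1 z / (f (rho z) * arc_speed z).
Definition normal_r z : R := f (rho z) / arc_speed z.

(* The principal curvatures in the direction of the generating curve and in the
   directions of the spheres. *)
Definition curv_z z : R :=
  (G (rho z) * f (rho z)
   - f (rho z) * (rho2 z - G (rho z) * rho1 z ^+ 2) / arc_speed z ^+ 2) / arc_speed z.
Definition curv_u z : R := normal_r z * L (rho z).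

Lemma arc_speed_gt0 z : a <= z <= b -> 0 < arc_speed z /\ 0 < f (rho z).
Proof.
move=> /rho_rad[r0 rR]; have f0 := fz_gt0 (ltW r0) rR.
by rewrite sqrtr_gt0 ltr_pwDl ?sqr_ge0// exprn_gt0.
Qed.

Lemma arc_speed_sqr z : arc_speed z ^+ 2 = f (rho z) ^+ 2 + rho1 z ^+ 2.
Proof. by rewrite sqr_sqrtr// addr_ge0 ?sqr_ge0. Qed.

Lemma revolution_off p : revolution a b rho p ->
  [/\ p.2 != 0, enorm p.2 = rho p.1, 0 < rho p.1 & ((rho p.1)%:E < rad S)%E].
Proof.
by move=> [/rho_rad[r0 rR] E]; split => //; rewrite -enorm_gt0 E.
Qed.

Lemma tangentE p v : revolution a b rho p ->
  tangent rho p v <-> drad p v = rho1 p.1 * v.1.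
Proof.
move=> Mp; have [p0 pE _ _] := revolution_off Mp.
have [pab _] := Mp.
have [d _] : is_derive p.1 1 rho (rho1 p.1) :=
  smooth_near_derive1 0 rho_smooth pab.
have [_ E] := is_derive_height v p0 d.
rewrite /tangent E /drad; split => [/eqP|->]; last by rewrite subrr.
by rewrite subr_eq0 => /eqP.
Qed.

Definition normal_field p : pt R n :=
  (normal_z p.1, (normal_r p.1 / enorm p.2) *: p.2).

(** Orthogonality to the meridian direction fixes the ratio of the [z] and radial components,
    orthogonality to the spheres removes everything else, and unit length with the outward sign
    determines the remaining factor. *)
Lemma outward_unit_normalE N p : outward_unit_normal S a b rho N ->
  revolution a b rho p -> N p = normal_field p.
Proof.
move=> [_ HN] Mp; have [nN uN oN] := HN p Mp.
have [p0 pE r0 rR] := revolution_off Mp.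
have [pab _] := Mp; have [s0 f0] := arc_speed_gt0 pab.
have r00 : rho p.1 != 0 by rewrite gt_eqF.
set s := arc_speed p.1 in s0 *; set F := f (rho p.1) in f0 *.
pose be := drad p (N p).
have bE : F ^+ 2 * (N p).1 = - rho1 p.1 * be.
  have T : tangent rho p (1, (rho1 p.1 / rho p.1) *: p.2).
    apply/(tangentE _ Mp); rewrite /drad /= dotZr -enorm_sqr pE; field.
    exact: r00.
  have := nN _ T; rewrite metric_offE// sph_radial// mulr0 addr0.
  rewrite [drad p (1, _)]/drad/= dotZr -enorm_sqr pE mulr1 -/F -/be.
  have -> : rho1 p.1 / rho p.1 * rho p.1 ^+ 2 / rho p.1 = rho1 p.1.
    by field; exact: r00.
  by move=> /eqP; rewrite addr_eq0 mulNr mulrC [be * _]mulrC => /eqP.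
have N2 : (N p).2 = (be / rho p.1) *: p.2.
  pose y := (N p).2 - (be / rho p.1) *: p.2.
  have py : dot p.2 y = 0.
    rewrite /y dotDr dotNr dotZr -enorm_sqr pE /be /drad pE; field.
    exact: r00.
  have T : tangent rho p (0, y).
    by apply/(tangentE _ Mp); rewrite /drad /= py mul0r mulr0.
  have := nN _ T; rewrite metric_offE//= mulr0 mulr0 add0r.
  rewrite /sph [drad p (0, y)]/drad /= py mul0r !mulr0 subr0 add0r => /eqP.
  rewrite mulf_eq0 gt_eqF ?(sph_factor_gt0)// ?pE//=.
  have -> : dot (N p).2 y = dot y y.
    by rewrite {2}/y dotDl dotNl dotZl py mulr0 subr0.
  by rewrite dot_eq0 subr_eq0 => /eqP.
have d1 : is_derive p.1 1 rho (rho1 p.1) :=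
  smooth_near_derive1 0 rho_smooth pab.
have be0 : 0 < be.
  have [d _] := d1.
  have [_ E] := is_derive_height (N p) p0 d.
  move: oN; rewrite E -/(drad p (N p)) -/be.
  have -> : (N p).1 = - rho1 p.1 * be / F ^+ 2.
    by rewrite -bE mulrC mulKf// expf_neq0// gt_eqF.
  have -> : be - rho1 p.1 * (- rho1 p.1 * be / F ^+ 2) =
      be * (1 + rho1 p.1 ^+ 2 / F ^+ 2) by field; rewrite gt_eqF.
  rewrite pmulr_lgt0; first by [].
  by rewrite ltr_pwDl// divr_ge0// sqr_ge0.
have NE : (N p).1 = - rho1 p.1 * be / F ^+ 2.
  by rewrite -bE mulrC mulKf// expf_neq0// gt_eqF.
have beE : be = F / s.
  have : be ^+ 2 * s ^+ 2 = F ^+ 2.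
    move: uN; rewrite metric_offE// pE -/F -/be.
    have -> : sph p (N p) (N p) = 0.
      by rewrite {2}[N p]surjective_pairing N2 sph_radial.
    rewrite mulr0 addr0 NE /s arc_speed_sqr -/F => /(congr1 (fun x => x * F ^+ 2)).
    rewrite mul1r => uE; rewrite -[RHS]uE; field.
    by rewrite gt_eqF.
  move=> sE.
  have /eqP : be ^+ 2 = (F / s) ^+ 2.
    by rewrite [in RHS]expr_div_n -sE mulfK// expf_neq0// gt_eqF.
  have Fs0 : 0 <= F / s by apply: divr_ge0; exact: ltW.
  by rewrite eqrXn2// ?(ltW be0)// => /eqP.
rewrite [LHS]surjective_pairing /normal_field NE N2 pE /normal_r -/F -/s -beE.
congr pair; rewrite /normal_z beE -/F -/s; field.
by rewrite !gt_eqF.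
Qed.

(** The derivative of [normal_z], [F1] and [s1] being those of [f] along the curve and of
    [arc_speed]; likewise for [normal_r1]. *)
Definition normal_z1 z : R :=
  let F := f (rho z) in let s := arc_speed z in
  let F1 := G (rho z) * F * rho1 z in
  let s1 := (F * F1 + rho1 z * rho2 z) / s in
  - (rho2 z * (F * s) - rho1 z * (F1 * s + F * s1)) / (F * s) ^+ 2.

Definition normal_r1 z : R :=
  let F := f (rho z) in let s := arc_speed z in
  let F1 := G (rho z) * F * rho1 z in
  let s1 := (F * F1 + rho1 z * rho2 z) / s in
  (F1 * s - F * s1) / s ^+ 2.

Lemma rho_derivatives z : a <= z <= b ->
  is_derive z 1 rho (rho1 z) /\ is_derive z 1 rho1 (rho2 z).
Proof.
move=> zab; split; first exact: (smooth_near_derive1 0 rho_smooth zab).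
exact: (smooth_near_derive1 1 rho_smooth zab).
Qed.

Lemma is_derive_arc_speed z : a <= z <= b -> is_derive z 1 arc_speed
  ((f (rho z) * (G (rho z) * f (rho z) * rho1 z) + rho1 z * rho2 z) / arc_speed z).
Proof.
move=> zab; have [d1 d2] := rho_derivatives zab.
have [r0 rR] := rho_rad zab; have [df _ _ _] := prof r0 rR.
have [s0 f0] := arc_speed_gt0 zab.
have s20 : 0 < f (rho z) ^+ 2 + rho1 z ^+ 2.
  by rewrite -arc_speed_sqr exprn_gt0.
have dF := drv_comp df d1.
apply: drv_eq (drv_sqrt (drv_add (drv_sqr dF) (drv_sqr d2)) s20) _.
rewrite -/(arc_speed z); field.
by rewrite gt_eqF.
Qed.

Lemma is_derive_normal z : a <= z <= b ->
  is_derive z 1 normal_z (normal_z1 z) /\ is_derive z 1 normal_r (normal_r1 z).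
Proof.
move=> zab; have [d1 d2] := rho_derivatives zab.
have [r0 rR] := rho_rad zab; have [df _ _ _] := prof r0 rR.
have [s0 f0] := arc_speed_gt0 zab.
have dF := drv_comp df d1; have ds := is_derive_arc_speed zab.
have fs : f (rho z) * arc_speed z != 0 by rewrite mulf_neq0// gt_eqF.
split.
  apply: drv_eq (drv_div (drv_opp d2) (drv_mul dF ds) fs) _.
  by rewrite /normal_z1; congr (_ / _); ring.
by apply: drv_eq (drv_div dF ds _) _; rewrite ?gt_eqF.
Qed.

(** The meridian is a principal direction with curvature [curv_z]: the left sides are [f^2] times
    the [z] component and the [r] component of the covariant derivative of the normal along
    [(1, rho')], with the Christoffel symbols of [f^2 dz^2 + dr^2]. *)
Lemma normal_identities z : a <= z <= b ->
  f (rho z) ^+ 2 * normal_z1 z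
    + G (rho z) * f (rho z) ^+ 2 * (rho1 z * normal_z z + normal_r z)
  = curv_z z * f (rho z) ^+ 2 /\
  normal_r1 z - G (rho z) * f (rho z) ^+ 2 * normal_z z = curv_z z * rho1 z.
Proof.
move=> zab; have [s0 f0] := arc_speed_gt0 zab; have := arc_speed_sqr z.
rewrite /normal_z1 /normal_r1 /normal_z /normal_r /curv_z.
move: (arc_speed z) (f (rho z)) (rho1 z) (rho2 z) (G (rho z)) s0 f0.
move=> s F p q gg s0 f0 sE.
have s00 : s != 0 by rewrite gt_eqF.
have F00 : F != 0 by rewrite gt_eqF.
have qE (x y : R) : x * s ^+ 2 = y * s ^+ 2 -> x = y.
  by apply: mulIf; rewrite expf_neq0.
have pE : p ^+ 2 = s ^+ 2 - F ^+ 2 by rewrite sE; ring.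
split; apply: qE; rewrite [p ^+ 2]pE.
  transitivity (- q * F * s + p ^+ 2 * gg * F * s + F * (F * gg * F * p ^+ 2 / s + p ^+ 2 * q / s)
    - gg * F * p ^+ 2 * s + gg * F ^+ 3 * s).
    by field; rewrite s00 F00.
  rewrite pE; field; exact: s00.
transitivity (gg * F * p * s - F * (F * (gg * F * p) / s + p * q / s)
   + gg * F * p * s).
  by field; rewrite s00 F00.
by field; exact: s00.
Qed.

End Hypersurface.

Section LinearForms.
Context {R : realType} {n : nat}.

Lemma linear_form_continuous (c : R) (y : 'rV[R]_n) :
  continuous (fun v : pt R n => c * v.1 + dot v.2 y).
Proof.
move=> v; apply: cvgD.
  by apply: cvgM; [exact: cvg_cst|exact: cvg_fst].
rewrite /dot; apply: continuous_big v => [|i _ v]; first exact: add_continuous.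
apply: cvgM; last exact: cvg_cst.
apply: (@continuous_comp _ _ _ snd (fun A : 'rV[R]_n => A 0 i)).
  exact: cvg_snd.
exact: coord_continuous.
Qed.

End LinearForms.

Section MeanCurvature.
Context {R : realType} {n : nat} (S : rotsym R n) (G G1 L L1 : R -> R).
Hypothesis prof : log_profile S G G1 L L1.
Local Notation f := (fz S).
Local Notation h := (hu S).
Local Notation g := (metric (fz S) (hu S)).
Context (a b : R) (rho : R -> R).
Hypothesis rho_smooth : smooth_near `[a, b] rho.
Hypothesis rho_rad : forall z, a <= z <= b ->
  0 < rho z /\ ((rho z)%:E < rad S)%E.
Implicit Types (p v w : pt R n) (z : R).
Local Notation rho1 := (derive1 rho).

(** [N] is known on the hypersurface only, which the line [p + s v] leaves. Rescaling its [x] part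
    by [ph] brings it back. As [v] is tangent, [ph - 1] vanishes to second order at 0, so the
    derivative is unchanged; as [p] is interior, [z] stays in [[a, b]]. *)
Lemma normal_derivative N p v w : outward_unit_normal S a b rho N ->
  revolution a b rho p -> a < p.1 < b -> tangent rho p v ->
  g p ('D_v N p) w =
  f (rho p.1) ^+ 2 * (normal_z1 S G rho p.1 * v.1) * w.1
  + normal_r1 S G rho p.1 * v.1 * drad p w
  + normal_r S rho p.1 * sph_factor S (rho p.1) * sph p v w / rho p.1.
Proof.
move=> HN Mp pab' /(tangentE rho_smooth rho_rad _ Mp) tv.
have [p0 pE r0 rR] := revolution_off rho_rad Mp.
have [pab _] := Mp; have r00 : rho p.1 != 0 by rewrite gt_eqF.
have [[U [oU MU CU]] _] := HN.
have Up := MU _ Mp.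
pose c0 : R := f (rho p.1) ^+ 2 * w.1.
pose k0 := sph_factor S (rho p.1).
pose y0 := ((1 - k0) * drad p w / rho p.1) *: p.2 + k0 *: w.2.
have gE x : g p x w = c0 * x.1 + dot x.2 y0.
  by rewrite metric_linearE// pE.
pose Phi (q : pt R n) : R := c0 * (N q).1 + dot (N q).2 y0.
have dN q d : U q -> derivable N q d.
  by move=> Uq; have [+ _] := CU 1%N d; apply.
have dPhi q d : U q -> is_derive q d Phi (c0 * ('D_d N q).1 + dot ('D_d N q).2 y0).
  by move=> Uq; exact: is_derive_linear_form (dN q d Uq).
have cPhi d : {for p, continuous ('D_d Phi)}.
  have cD : {for p, continuous ('D_d N)}.
    by have [_] := CU 1%N d; apply.
  have cE : {for p, continuous (fun q => c0 * ('D_d N q).1 + dot ('D_d N q).2 y0)}.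
    exact: (@continuous_comp _ _ _ ('D_d N) (fun x : pt R n => c0 * x.1 + dot x.2 y0)
      p cD (@linear_form_continuous _ _ c0 y0 _)).
  have [_ Ep] := dPhi p d Up.
  rewrite /prop_for /continuous_at Ep.
  apply: cvg_trans cE; apply: near_eq_cvg.
  have : \forall q \near p, U q by exact: open_nbhs_nbhs.
  by apply: filterS => q /(dPhi _ d)[_ <-].
pose ph (s : R) := rho (p.1 + s * v.1) / enorm (p.2 + s *: v.2).
have dline : is_derive (0 : R) 1 (fun s : R => p.1 + s * v.1) v.1.
  have hd := drv_add (drv_cst p.1 (0 : R) 1) (drv_mul (drv_id 0) (drv_cst v.1 (0 : R) 1)).
  by apply: drv_eq hd _; ring.
have comp_line (F : R -> R) d : is_derive p.1 1 F d ->
    is_derive (0 : R) 1 (fun s : R => F (p.1 + s * v.1)) (d * v.1).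
  move=> dF; apply: (drv_comp (f := F) _ dline).
  by rewrite mul0r addr0.
have [d1 d2] := rho_derivatives rho_smooth pab.
have den := is_derive_enorm_line v.2 p0.
have e00 : enorm (p.2 + (0 : R) *: v.2) != 0 by rewrite scale0r addr0 pE.
have dph : is_derive (0 : R) 1 ph 0.
  apply: drv_eq (drv_div (comp_line _ _ d1) den e00) _.
  by rewrite mul0r scale0r !addr0 -/(drad p v) tv pE; field.
have ph0 : ph 0 = 1 by rewrite /ph mul0r scale0r !addr0 pE divff.
have dc := drv_sub dph (drv_cst 1 (0 : R) 1).
have dcs := drv_mul dc (drv_id 0).
have D0 : is_derive (0 : R) 1 (Phi \o (fun s : R => p + s *: v))
    (c0 * ('D_v N p).1 + dot ('D_v N p).2 y0).
  exact: (is_derive_lineP _ _ _ _).1 (dPhi p v Up).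
have derPhi q d : U q -> derivable Phi q d by move=> /(dPhi q d)[].
have g0 : p + (0 : R) *: v = p by rewrite scale0r addr0.
have cz (s : R -> R) d (x : pt R n) : is_derive (0 : R) 1 s d ->
    {for (0 : R), continuous (fun t : R => s t *: x)}.
  by move=> /drv_continuous cs; apply: (cvgZr_tmp cs).
have cg0 : {for (0 : R), continuous (fun s : R => p + s *: v)}.
  exact: line_continuous.
(* The correction [(ph s - 1) (p.2 + s v.2)] is added in two moves along the constant vectors
   [(0, p.2)] and [(0, v.2)], as [is_derive_add_dir] requires; both coefficients have derivative 0
   at [s = 0]. *)
have D1 : is_derive (0 : R) 1 (fun s : R => Phi (p + s *: v + (ph s - 1) *: (0, p.2)))
    ((c0 * ('D_v N p).1 + dot ('D_v N p).2 y0) + (0 - 0) * 'D_(0, p.2) Phi p).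
  have := @is_derive_add_dir R _ Phi U (fun s : R => p + s *: v)
    (fun s => ph s - 1) (0, p.2) 0 _ _ oU; rewrite /= g0; apply => //.
  - by move=> q; exact: derPhi.
  - by rewrite ph0 subrr.
pose gam1 (s : R) : pt R n := p + s *: v + (ph s - 1) *: (0, p.2).
have g10 : gam1 0 = p by rewrite /gam1 g0 ph0 subrr scale0r addr0.
have cg1 : {for (0 : R), continuous gam1}.
  by apply: cvgD; [exact: cg0|exact: cz dc].
have D2 : is_derive (0 : R) 1 (fun s : R => Phi (gam1 s + (ph s - 1) * s *: (0, v.2)))
    ((c0 * ('D_v N p).1 + dot ('D_v N p).2 y0) + (0 - 0) * 'D_(0, p.2) Phi p
     + ((0 - 0) * 0 + (ph 0 - 1) * 1) * 'D_(0, v.2) Phi p).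
  have := @is_derive_add_dir R _ Phi U gam1
    (fun s => (ph s - 1) * s) (0, v.2) 0 _ _ oU; rewrite g10; apply => //.
  - by move=> q; exact: derPhi.
  - by rewrite mulr0.
have {}D2 := drv_eq D2 (_ : _ = g p ('D_v N p) w).
have {}D2 : is_derive (0 : R) 1
    (fun s : R => Phi (gam1 s + (ph s - 1) * s *: (0, v.2))) (g p ('D_v N p) w).
  by apply: D2; rewrite ph0 gE !subrr !mul0r !addr0 mul0r addr0.
have gam2E s : gam1 s + (ph s - 1) * s *: (0, v.2) =
    (p.1 + s * v.1, ph s *: (p.2 + s *: v.2)).
  congr pair => /=; first by rewrite /GRing.scale/= !mulr0 !addr0.
  rewrite -scalerA -addrA -scalerDr addrC.
  by rewrite scalerBl scale1r subrK.
(* The form evaluated on [normal_field] along the corrected curve: there only [z] and the direction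
   [x / |x|] matter, so [ph] drops out. *)
pose Psi (s : R) := c0 * normal_z S rho (p.1 + s * v.1)
   + normal_r S rho (p.1 + s * v.1) * (dot (p.2 + s *: v.2) y0 / enorm (p.2 + s *: v.2)).
have EPsi : \forall s \near (0 : R), Psi s = Phi (gam1 s + (ph s - 1) * s *: (0, v.2)).
  have n1 : \forall s \near (0 : R), a < p.1 + s * v.1 < b.
    have := drv_continuous dline; rewrite /prop_for /continuous_at mul0r addr0.
    by move=> c; apply: (c [set x | a < x < b]); exact: near_itv.
  have n2 : \forall s \near (0 : R), enorm (p.2 + s *: v.2) != 0.
    by have /cvgr_neq0 := drv_continuous den; apply.
  apply: filterS2 n1 n2 => s sab e0.
  have sab' : a <= p.1 + s * v.1 <= b by case/andP: sab => *; rewrite !ltW.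
  have [rs0 _] := rho_rad sab'.
  have es0 : 0 < enorm (p.2 + s *: v.2) by rewrite lt0r e0 enorm_ge0.
  have ps0 : 0 < ph s by rewrite divr_gt0.
  have Mg : revolution a b rho (p.1 + s * v.1, ph s *: (p.2 + s *: v.2)).
    split => //=; rewrite enormZ gtr0_norm// /ph divfK//.
  rewrite gam2E /Phi (outward_unit_normalE rho_smooth rho_rad HN Mg) /Psi.
  rewrite /normal_field /= scalerA dotZl enormZ gtr0_norm//.
  have -> : normal_r S rho (p.1 + s * v.1) / (ph s * enorm (p.2 + s *: v.2)) * ph s
     = normal_r S rho (p.1 + s * v.1) / enorm (p.2 + s *: v.2).
    by field; rewrite e0 gt_eqF.
  by congr (_ + _); rewrite mulrA mulrAC.
have [dnz dnr] := is_derive_normal prof rho_smooth rho_rad pab.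
have ddot : is_derive (0 : R) 1 (fun s : R => dot (p.2 + s *: v.2) y0) (dot v.2 y0).
  exact: (is_derive_lineP _ _ _ _).1 (is_derive_dot p v y0).
have dPsi := drv_add (drv_scale c0 (comp_line _ _ dnz))
  (drv_mul (comp_line _ _ dnr) (drv_div ddot den e00)).
have [_ E1] := D2.
have [_ E2] := near_eq_is_derive EPsi dPsi.
rewrite -E1 E2 mul0r !scale0r !addr0 pE.
have py : dot p.2 y0 = rho p.1 * drad p w.
  rewrite /y0 dotDr !dotZr -enorm_sqr pE /drad pE; field.
  exact: r00.
have vy : dot v.2 y0 = drad p v * drad p w + k0 * sph p v w.
  rewrite /y0 dotDr !dotZr (dotC v.2 p.2) /sph /drad pE; field.
  exact: r00.
have pv : dot p.2 v.2 = rho p.1 * drad p v.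
  by rewrite /drad pE mulrC divfK.
rewrite py vy pv /c0 /k0; field.
exact: r00.
Qed.

Definition meridian p : pt R n := (1, (rho1 p.1 / rho p.1) *: p.2).

Lemma drad_comb p v (c d : R) : drad p (c *: v + d *: meridian p) =
  c * drad p v + d * drad p (meridian p).
Proof. by rewrite /drad /= dotDr !dotZr mulrDl !mulrA. Qed.

Lemma sph_comb p v w (c d : R) : p.2 != 0 ->
  sph p (c *: v + d *: meridian p) w = c * sph p v w.
Proof.
move=> p0; have z0 : sph p (meridian p) w = 0 by rewrite sphC sph_radial.
have -> : sph p (c *: v + d *: meridian p) w =
    c * sph p v w + d * sph p (meridian p) w.
  by rewrite /sph drad_comb /= dotDl !(dotZl c) !(dotZl d); ring.
by rewrite z0 mulr0 addr0.
Qed.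

Lemma drad_meridian p : revolution a b rho p ->
  drad p (meridian p) = rho1 p.1.
Proof.
move=> Mp; have [p0 pE r0 rR] := revolution_off rho_rad Mp.
rewrite /drad /= dotZr -enorm_sqr pE; field.
by rewrite gt_eqF.
Qed.

(** The Weingarten map is [curv_z] on the meridian and [curv_u] on the tangent vectors of the
    spheres; [v.1] is the meridian coefficient of [v]. The identity is tested against every [w], the
    metric being nondegenerate. *)
Lemma shape_operator N p v D : outward_unit_normal S a b rho N ->
  revolution a b rho p -> a < p.1 < b -> tangent rho p v ->
  is_covariant_derivative S p v N D ->
  D = curv_u S L rho p.1 *: v
      + ((curv_z S G rho p.1 - curv_u S L rho p.1) * v.1) *: meridian p.
Proof.
move=> HN Mp pab' tv HD.
have [p0 pE r0 rR] := revolution_off rho_rad Mp.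
have [pab _] := Mp; have r00 : rho p.1 != 0 by rewrite gt_eqF.
have pR : ((enorm p.2)%:E < rad S)%E by rewrite pE.
have dv := (tangentE rho_smooth rho_rad _ Mp).1 tv.
apply/eqP; rewrite -subr_eq0; apply/eqP.
apply: (metric_nondegenerate p0 pR) => w.
rewrite metric_subl// HD (normal_derivative w HN Mp pab' tv).
have NE := outward_unit_normalE rho_smooth rho_rad HN Mp.
have sN u : sph p (N p) u = 0.
  by rewrite NE /normal_field sphC sph_radial.
have sN' u : sph p u (N p) = 0 by rewrite sphC.
have dN : drad p (N p) = normal_r S rho p.1.
  rewrite NE /normal_field /drad /= dotZr -enorm_sqr pE; field.
  exact: r00.
have N1 : (N p).1 = normal_z S rho p.1 by rewrite NE.
have [_ ->] := is_derive_metric prof (N p) w v p0 pR.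
have [_ ->] := is_derive_metric prof v w (N p) p0 pR.
have [_ ->] := is_derive_metric prof v (N p) w p0 pR.
rewrite !sN !sN' !dN !N1 [g p (_ + _) w]metric_offE// drad_comb sph_comb//.
rewrite drad_meridian// pE /= dv (sphC p w v).
have [I1 I2] := normal_identities G rho_rad pab.
rewrite /curv_u.
move: I1 I2; set nz := normal_z _ _ _; set nr := normal_r _ _ _.
set nz1 := normal_z1 _ _ _ _; set nr1 := normal_r1 _ _ _ _.
set kz := curv_z _ _ _ _; set ka := sph_factor _ _.
set sg := sph p v w; set dw := drad p w.
rewrite /GRing.scale /=.
move: r00 (f (rho p.1)) (G (rho p.1)) (L (rho p.1)) => r00 F gg ll.
move: r00 (rho1 p.1); move: (rho p.1) v.1 w.1 => r v1 w1 r00 p1 I1 I2.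
(* Koszul's formula regrouped so that the left sides of [normal_identities] appear; the rest is the
   spherical part. *)
have -> : F ^+ 2 * (nz1 * v1) * w1 + nr1 * v1 * dw + nr * ka * sg / r
  + (2 * gg * F ^+ 2 * (p1 * v1) * (nz * w1)
     + (1 - ka) * (0 * dw + nr * sg) / r
     + 2 * ka * (ll - r^-1) * (p1 * v1) * 0
     + (2 * gg * F ^+ 2 * nr * (v1 * w1)
     + (1 - ka) * (0 * dw + p1 * v1 * 0) / r
     + 2 * ka * (ll - r^-1) * nr * sg)
     - (2 * gg * F ^+ 2 * dw * (v1 * nz)
     + (1 - ka) * (sg * nr + p1 * v1 * 0) / r
     + 2 * ka * (ll - r^-1) * dw * 0)) / 2
  = v1 * w1 * (F ^+ 2 * nz1 + gg * F ^+ 2 * (p1 * nz + nr))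
    + v1 * dw * (nr1 - gg * F ^+ 2 * nz) + nr * ll * ka * sg.
  by field; exact: r00.
by rewrite I1 I2; ring.
Qed.

(** In any basis the matrix is [ku] times the identity plus a rank one matrix built from the
    coordinates [t] of the meridian. The trace of the latter is [kz - ku], because the meridian has
    [z] component 1. *)
Lemma mean_curvatureE N p H : outward_unit_normal S a b rho N ->
  revolution a b rho p -> a < p.1 < b -> is_mean_curvature S rho N p H ->
  H = curv_z S G rho p.1 + n.-1%:R * curv_u S L rho p.1.
Proof.
move=> HN Mp pab' [e [A [[te fe se] cA ->]]].
have [p0 pE r0 rR] := revolution_off rho_rad Mp.
have [t tE] : exists t : 'I_n -> R, meridian p = \sum_i t i *: e i.
  apply: se; apply/(tangentE rho_smooth rho_rad _ Mp).
  by rewrite drad_meridian// mulr1.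
set kz := curv_z S G rho p.1; set ku := curv_u S L rho p.1.
have AE i j : A i j = (i == j)%:R * ku + (kz - ku) * (e j).1 * t i.
  apply/eqP; rewrite -subr_eq0; apply/eqP.
  apply: (fe (fun i => A i j - ((i == j)%:R * ku + (kz - ku) * (e j).1 * t i))).
  have ej : ku *: e j = \sum_i ((i == j)%:R * ku) *: e i.
    rewrite (bigD1 j)//= eqxx mul1r big1 ?addr0// => k kj.
    by rewrite (negbTE kj) mul0r scale0r.
  have -> : \sum_i (A i j - ((i == j)%:R * ku + (kz - ku) * (e j).1 * t i)) *: e i
      = \sum_i A i j *: e i - (ku *: e j + ((kz - ku) * (e j).1) *: meridian p).
    rewrite tE scaler_sumr ej -big_split /= -sumrB; apply: eq_bigr => k _.
    by rewrite scalerBl scalerDl scalerA.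
  by rewrite (shape_operator HN Mp pab' (te j) (cA j)) -/kz -/ku subrr.
have t1 : \sum_i t i * (e i).1 = 1.
  have := congr1 (fun x : pt R n => x.1) tE; rewrite /= => ->.
  by elim/big_rec2: _ => //= i x y _ ->.
rewrite /mxtrace; under eq_bigr => i _ do rewrite AE eqxx mul1r -mulrA [_.1 * _]mulrC.
rewrite big_split /= -[X in _ + X]mulr_sumr t1 mulr1 sumr_const card_ord -[ku *+ n]mulr_natl.
have n0 : (0 < n)%N.
  rewrite lt0n; apply/negP => /eqP n00; move/negP: p0; apply.
  by apply/eqP/rowP => -[i ilt]; exfalso; move: ilt; rewrite n00.
have nE : n%:R = n.-1%:R + 1 :> R by rewrite natr1 prednK.
by rewrite nE; ring.
Qed.

End MeanCurvature.

(** * Sign of the averaged mean curvature *)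

Section IntegralBound.
Context {R : realType}.

(** [I] is compared with the continuous [J] on the open interval only, since the formula for the
    mean curvature is established at interior points; the two endpoints have measure 0. *)
Lemma Rintegral_ge_boundary (a b : R) (I J P P1 : R -> R) : a < b ->
  (forall z, a <= z <= b -> is_derive z 1 P (P1 z)) ->
  (forall z, a <= z <= b -> {for z, continuous P1}) ->
  (forall z, a <= z <= b -> {for z, continuous J}) ->
  (forall z, a < z < b -> I z = J z) ->
  (forall z, a <= z <= b -> P1 z <= J z) ->
  P b - P a <= \int[lebesgue_measure]_(z in `[a, b]) I z.
Proof.
move=> ab dP cP1 cJ IJ PJ.
have within_cont (F : R -> R) : (forall z, a <= z <= b -> {for z, continuous F}) ->
    {within `[a, b], continuous F}.
  by move=> c; apply: continuous_in_subspaceT => z; rewrite inE/= in_itv/= => /c.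
have int_cont (F : R -> R) : (forall z, a <= z <= b -> {for z, continuous F}) ->
    lebesgue_measure.-integrable `[a, b] (EFin \o F).
  move=> /within_cont c.
  by apply: continuous_compact_integrable => //; exact: segment_compact.
have mJ : measurable_fun `]a, b[ J.
  apply: subspace_continuous_measurable_fun => //.
  apply: continuous_in_subspaceT => z; rewrite inE/= in_itv/= => zab.
  by apply: cJ; lra.
have IJ' : {in `]a, b[%classic, J =1 I}.
  by move=> z; rewrite inE/= in_itv/= => zab; rewrite /= IJ.
have mI : measurable_fun `]a, b[ I := eq_measurable_fun _ IJ' mJ.
have -> : \int[lebesgue_measure]_(z in `[a, b]) I z =
          \int[lebesgue_measure]_(z in `[a, b]) J z.
  rewrite /Rintegral; congr fine.
  rewrite (@integral_itv_bndoo _ _ _ _ true false); last exact/measurable_EFinP.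
  rewrite (@integral_itv_bndoo _ _ _ _ true false); last exact/measurable_EFinP.
  by apply: eq_integral => z zab; rewrite IJ'.
have -> : P b - P a = \int[lebesgue_measure]_(z in `[a, b]) P1 z.
  rewrite /Rintegral (@continuous_FTC2 _ P1 P a b ab (within_cont _ cP1)) //.
    split.
    - move=> z; rewrite in_itv/= => /andP[az zb].
      by have [] := dP z; rewrite ?(ltW az) ?(ltW zb).
    - apply: cvg_at_right_filter; apply: (@drv_continuous _ P a (P1 a)).
      by apply: dP; lra.
    - apply: cvg_at_left_filter; apply: (@drv_continuous _ P b (P1 b)).
      by apply: dP; lra.
  move=> z; rewrite inE/= ?in_itv/= => /andP[az zb].
  by rewrite derive1E; have [|_ ->] := dP z; rewrite ?(ltW az) ?(ltW zb).
by apply: le_Rintegral => //; exact: int_cont.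
Qed.

End IntegralBound.

Section PointwiseContinuity.
Context {R : realType} {T : topologicalType} (z : T) (F E : T -> R).
Hypotheses (cF : {for z, continuous F}) (cE : {for z, continuous E}).

Lemma cont_mul : {for z, continuous (fun y => F y * E y)}.
Proof. exact: (cvgM cF cE). Qed.

Lemma cont_add : {for z, continuous (fun y => F y + E y)}.
Proof. exact: (cvgD cF cE). Qed.

Lemma cont_sub : {for z, continuous (fun y => F y - E y)}.
Proof. exact: (cvgB cF cE). Qed.

End PointwiseContinuity.

Section Sphere.
Context {R : realType} {n : nat}.

Lemma enorm_continuous : continuous (@enorm R n).
Proof.
move=> x; rewrite /enorm.
apply: (@continuous_comp _ _ _ (fun y : 'rV[R]_n => dot y y) Num.sqrt); last first.
  exact: sqrt_continuous.
rewrite /dot; apply: continuous_big x => [|i _ y]; first exact: add_continuous.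
have c : {for y, continuous (fun z : 'rV[R]_n => z 0 i)} by exact: coord_continuous.
exact: (continuousM c c).
Qed.

Lemma measurable_sphere : measurable (@sphere R n).
Proof.
rewrite -[sphere]setCK; apply: measurableC; apply: sub_sigma_algebra.
have -> : ~` sphere = @enorm R n @^-1` [set x | x != 1].
  by apply/seteqP; split => u /= /eqP.
by apply: open_comp => [u _|]; [exact: enorm_continuous|exact: open_neq].
Qed.

End Sphere.

Section Average.
Context {R : realType} {n : nat} (S : rotsym R n) (G G1 L L1 : R -> R).
Hypothesis prof : log_profile S G G1 L L1.
Hypothesis GL_ge0 : forall r, 0 < r -> (r%:E < rad S)%E -> 0 <= G r /\ 0 <= L r.
Local Notation f := (fz S).
Local Notation h := (hu S).
Local Notation g := (metric (fz S) (hu S)).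
Context (a b : R) (rho : R -> R).
Hypothesis n0 : (0 < n)%N.
Hypothesis ab : a < b.
Hypothesis rho_smooth : smooth_near `[a, b] rho.
Hypothesis rho_rad : forall z, a <= z <= b ->
  0 < rho z /\ ((rho z)%:E < rad S)%E.
Implicit Types (p v w : pt R n) (z : R).
Local Notation rho1 := (derive1 rho).
Local Notation rho2 := (derive1n 2 rho).

Definition meridian_pt z : pt R n := (z, rho z *: delta_mx 0 (Ordinal n0)).

Lemma revolution_meridian_pt z : a <= z <= b -> revolution a b rho (meridian_pt z).
Proof.
move=> zab; split => //=; have [r0 _] := rho_rad zab.
by rewrite enormZ enorm_delta mulr1 gtr0_norm.
Qed.

Lemma normal_normal_field p : revolution a b rho p ->
  normal S rho p (normal_field S rho p).
Proof.
move=> Mp w /(tangentE rho_smooth rho_rad _ Mp) tw.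
have [p0 pE r0 rR] := revolution_off rho_rad Mp.
have [pab _] := Mp; have [s0 f0] := arc_speed_gt0 rho_rad pab.
rewrite metric_offE// (sphC p) sph_radial// mulr0 addr0 tw pE.
rewrite /drad /= dotZr -enorm_sqr pE /normal_z /normal_r; field.
by rewrite !gt_eqF.
Qed.

(** Orthogonality makes the [z] component of the normal vanish, and [normal_z] is a nonzero multiple
    of the slope. *)
Lemma orthogonal_slope z : meets_orthogonally S a b rho -> z = a \/ z = b ->
  rho1 z = 0.
Proof.
move=> orth zE; have zab : a <= z <= b by case: zE => ->; rewrite lexx ltW.
have Mp := revolution_meridian_pt zab.
have [p0 pE r0 rR] := revolution_off rho_rad Mp.
have [s0 f0] := arc_speed_gt0 rho_rad zab.
have := orth _ _ Mp zE (normal_normal_field Mp).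
rewrite metric_offE// /sph /drad /= !dot0r mul0r !mulr0 subr0 mulr0 !addr0 mulr1.
rewrite pE /= => /eqP; rewrite mulf_eq0 sqrf_eq0 gt_eqF//= /normal_z.
by rewrite mulf_eq0 oppr_eq0 invr_eq0 mulf_eq0 (gt_eqF s0) (gt_eqF f0) !orbF => /eqP.
Qed.

Lemma rho_profile_derivatives z : a <= z <= b ->
  [/\ is_derive z 1 (f \o rho) (G (rho z) * f (rho z) * rho1 z),
      is_derive z 1 (h \o rho) (L (rho z) * h (rho z) * rho1 z),
      is_derive z 1 (G \o rho) (G1 (rho z) * rho1 z)
    & is_derive z 1 (L \o rho) (L1 (rho z) * rho1 z)].
Proof.
move=> zab; have [d1 _] := rho_derivatives rho_smooth zab.
have [r0 rR] := rho_rad zab; have [df dG dh dL] := prof r0 rR.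
by split; exact: is_derive1_comp.
Qed.

(** The angle of the generating curve with the direction of [d/dz], measured by the metric. *)
Definition angle z : R := atan (rho1 z / f (rho z)).
Definition angle1 z : R :=
  f (rho z) * (rho2 z - G (rho z) * rho1 z ^+ 2) / arc_speed S rho z ^+ 2.

Lemma is_derive_angle z : a <= z <= b -> is_derive z 1 angle (angle1 z).
Proof.
move=> zab; have [df _ _ _] := rho_profile_derivatives zab.
have [d1 d2] := rho_derivatives rho_smooth zab.
have [s0 f0] := arc_speed_gt0 rho_rad zab.
have f00 : f (rho z) != 0 by rewrite gt_eqF.
have dq := drv_div d2 df f00.
apply: drv_eq (drv_comp (is_derive1_atan _) dq) _.
rewrite /angle1 arc_speed_sqr /=; field.
by rewrite f00 /= -arc_speed_sqr expf_neq0// gt_eqF.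
Qed.

Lemma angle_slope_ge0 z : a <= z <= b -> 0 <= angle z * rho1 z.
Proof.
move=> zab; have [s0 f0] := arc_speed_gt0 rho_rad zab.
have [p0|p0] := leP 0 (rho1 z).
  by rewrite mulr_ge0// -[X in X <= _]atan0 le_atan// divr_ge0// ltW.
rewrite nmulr_lge0// -[X in _ <= X]atan0 le_atan// ltW//.
by rewrite pmulr_llt0// invr_gt0.
Qed.

(* The density of [H], up to the boundary term
   [- (angle * h(rho)^(n-1))'], is nonnegative. *)
Lemma surface_integral_curvature_ge0 sigma (H : pt R n -> R) :
  meets_orthogonally S a b rho ->
  (forall p, revolution a b rho p -> a < p.1 < b ->
     H p = curv_z S G rho p.1 + n.-1%:R * curv_u S L rho p.1) ->
  0 <= surface_integral S sigma a b rho H.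
Proof.
move=> orth HE; rewrite /surface_integral.
set m := fine (sigma (@sphere R n)).
have m0 : 0 <= m by rewrite fine_ge0.
pose A z := h (rho z) ^+ n.-1.
(* As [h' = L h], the derivative of [h^(n-1)] can be written without the exponent [n - 2]. *)
pose A1 z := n.-1%:R * A z * (L (rho z) * rho1 z).
have dA z : a <= z <= b -> is_derive z 1 A (A1 z).
  move=> zab; have [_ dh _ _] := rho_profile_derivatives zab.
  apply: drv_eq (drv_exprn n.-1 dh) _; rewrite /A1 /A /=.
  case: (n.-1) => [|k]; first by rewrite !mul0r.
  by rewrite /= exprS; ring.
pose P z := - m * (angle z * A z).
pose P1 z := - m * (angle1 z * A z + angle z * A1 z).
have dP z : a <= z <= b -> is_derive z 1 P (P1 z).
  move=> zab; exact: drv_scale (drv_mul (is_derive_angle zab) (dA z zab)).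
pose J z := m * A z * (G (rho z) * f (rho z) - angle1 z + n.-1%:R * (f (rho z) * L (rho z))).
have Pend z : z = a \/ z = b -> P z = 0.
  by move=> /(orthogonal_slope orth) E; rewrite /P /angle E mul0r atan0 mul0r mulr0.
have c_angle1 z : a <= z <= b -> {for z, continuous angle1}.
  move=> zab; have [df _ dG _] := rho_profile_derivatives zab.
  have [d1 d2] := rho_derivatives rho_smooth zab.
  have d3 := smooth_near_derive1 2 rho_smooth zab.
  have ds := is_derive_arc_speed prof rho_smooth rho_rad zab.
  have [s0 f0] := arc_speed_gt0 rho_rad zab.
  have s20 : arc_speed S rho z ^+ 2 != 0 by rewrite expf_neq0// gt_eqF.
  exact: drv_continuous (drv_div (drv_mul df (drv_sub d3 (drv_mul dG (drv_sqr d2))))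
    (drv_sqr ds) s20).
have cc (F : R -> R) z d : is_derive z 1 F d -> {for z, continuous F}.
  exact: drv_continuous.
(* The lower bound 0 is written as [P b - P a]: both values vanish because the slope, hence the
   angle, is 0 at the boundary. *)
rewrite -[X in X <= _](subrr (0 : R)) -{1}(Pend b (or_intror erefl)) -(Pend a (or_introl erefl)).
apply: (@Rintegral_ge_boundary _ a b _ J P P1) => // z zab.
- have [_ _ _ dL] := rho_profile_derivatives zab.
  have [d1 d2] := rho_derivatives rho_smooth zab.
  have cA := cc _ _ _ (dA z zab).
  have cA1 : {for z, continuous A1}.
    have cLr := cc _ _ _ (drv_mul dL d2).
    have cnA := cc _ _ _ (drv_scale n.-1%:R (dA z zab)).
    exact: (cont_mul cnA cLr).
  have ca := cc _ _ _ (is_derive_angle zab).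
  have c1 := cont_mul (c_angle1 z zab) cA.
  have c2 := cont_mul ca cA1.
  have c0 : {for z, continuous (fun _ : R => - m)} by exact: cst_continuous.
  exact: cont_mul c0 (cont_add c1 c2).
- have [df _ dG dL] := rho_profile_derivatives zab.
  have c1 := cc _ _ _ (drv_scale m (dA z zab)).
  have c2 := cc _ _ _ (drv_mul dG df).
  have c3 := cc _ _ _ (drv_scale n.-1%:R (drv_mul df dL)).
  exact: (cont_mul c1 (cont_add (cont_sub c2 (c_angle1 z zab)) c3)).
- have zab' : a <= z <= b by case/andP: zab => *; rewrite !ltW.
  have [r0 rR] := rho_rad zab'; have [s0 f0] := arc_speed_gt0 rho_rad zab'.
  have -> : \int[sigma]_(u in sphere) H (z, rho z *: (u : 'rV[R]_n)) =
      (curv_z S G rho z + n.-1%:R * curv_u S L rho z) * m.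
    rewrite -Rintegral_cst; last exact: measurable_sphere.
    apply: eq_Rintegral => u /set_mem /= u1; rewrite HE//.
    by split => //=; rewrite enormZ u1 mulr1 gtr0_norm.
  rewrite /area_density -/(arc_speed S rho z) /J /A /curv_z /curv_u /normal_r /angle1.
  move: s0; move: (arc_speed S rho z) => s s0; field.
  by rewrite gt_eqF.
- have [r0 rR] := rho_rad zab; have [Gr Lr] := GL_ge0 r0 rR.
  have [s0 f0] := arc_speed_gt0 rho_rad zab.
  have A0 : 0 <= A z by rewrite exprn_ge0// ltW// hu_gt0.
  have as0 := angle_slope_ge0 zab.
  rewrite -subr_ge0.
  have -> : J z - P1 z = m * A z * (G (rho z) * f (rho z)
     + n.-1%:R * (L (rho z) * (f (rho z) + angle z * rho1 z))).
    rewrite /J /P1 /A1; ring.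
  apply: mulr_ge0; first exact: mulr_ge0.
  apply: addr_ge0; first by apply: mulr_ge0 => //; exact: ltW.
  apply: mulr_ge0 => //; apply: mulr_ge0 => //.
  by apply: addr_ge0 => //; exact: ltW.
Qed.

Lemma average_ge0 (H : pt R n -> R) (Hbar : R) :
  meets_orthogonally S a b rho ->
  (forall p, revolution a b rho p -> a < p.1 < b ->
     H p = curv_z S G rho p.1 + n.-1%:R * curv_u S L rho p.1) ->
  is_average S a b rho H Hbar -> 0 <= Hbar.
Proof.
move=> orth HE [sigma _ ->]; apply: divr_ge0.
  exact: surface_integral_curvature_ge0.
apply: Rintegral_ge0 => z /=; rewrite in_itv/= => zab.
have [r0 rR] := rho_rad zab.
apply: mulr_ge0; last by apply: Rintegral_ge0.
apply: mulr_ge0; first exact: sqrtr_ge0.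
by rewrite exprn_ge0// ltW// hu_gt0.
Qed.

End Average.

(** * The evolution equation of the generating curve *)

Section Slices.
Context {R : realType}.

Lemma derivable_first (V W : normedModType R) (F : R * V -> W) (t : R) (x : V) :
  derivable F (t, x) (1, 0) -> derivable (fun s : R => F (s, x)) t 1.
Proof.
have E (s : R) : (0, x) + s *: (1, 0) = (s, x) :> R * V.
  by congr pair; rewrite /= ?scaler0 ?addr0// /GRing.scale/= mulr1 add0r.
have -> : (fun s : R => F (s, x)) = (fun s : R => F ((0, x) + s *: (1, 0))).
  by apply/funext => s; rewrite E.
by rewrite derivable_line scale1r E.
Qed.

Lemma is_derive_dot_self (n : nat) (V : normedModType R) (N : V -> pt R n)
    (q v : V) : derivable N q v ->
  is_derive q v (fun x => dot (N x).2 (N x).2) (2 * dot (N q).2 ('D_v N q).2).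
Proof.
move=> dN; rewrite /dot.
have -> : (fun x => \sum_i (N x).2 0 i * (N x).2 0 i) =
    \sum_i (fun x => (N x).2 0 i * (N x).2 0 i).
  by apply/funext => x; rewrite fct_sumE.
rewrite mulr_sumr; apply: is_derive_sum => i.
by apply: drv_eq (drv_mul (is_derive_coord i dN) (is_derive_coord i dN)) _; ring.
Qed.

Lemma smooth_near_row (D : set R) (a b : R) (r : R -> R -> R) (t : R) : D t ->
  smooth_near [set q : R * R | D q.1 /\ a <= q.2 <= b] (fun q => r q.1 q.2) ->
  smooth_near `[a, b] (r t).
Proof.
move=> Dt [U [oU sU CU]].
have E : r t = (fun s : R => r ((t, 0) + s *: (0, 1) : R * R).1
                        ((t, 0) + s *: (0, 1) : R * R).2).
  by apply/funext => s; rewrite row_line.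
exists [set s : R | U ((t, 0) + s *: (0, 1))]; split.
- exact: open_line.
- by move=> z; rewrite /= in_itv/= row_line => zab; exact: sU.
- by move=> k; rewrite E; apply: (Ck_line (F := fun q : R * R => r q.1 q.2)).
Qed.

End Slices.

Section GraphEquation.
Context {R : realType} {n : nat} (S : rotsym R n) (G G1 L L1 : R -> R).
Hypothesis prof : log_profile S G G1 L L1.
Hypothesis GL_ge0 : forall r, 0 < r -> (r%:E < rad S)%E -> 0 <= G r /\ 0 <= L r.
Hypothesis n0 : (0 < n)%N.
Local Notation f := (fz S).
Local Notation h := (hu S).
Context (a b : R) (rho0 : R -> R) (T : R) (X : R -> pt R n -> pt R n)
  (r : R -> R -> R).
Hypothesis ab : a < b.
Hypothesis flow : vpmc_flow S a b rho0 T X r.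

(** The trajectory [Y] of the material point that is at height [z] at time [t] satisfies
    [|Y.2| = r(s, Y.1)]. Differentiating this at [s = t] gives
    [r_t = (Hbar - H) (N_r - r_z N_z)]. *)
Lemma graph_equation t : 0 < t < T -> exists2 Hbar : R, 0 <= Hbar &
  forall z, a < z < b ->
  'D_(1, 0) (fun q : R * R => r q.1 q.2) (t, z) =
  graph_speed n.-1%:R (f (r t z)) (G (r t z)) (L (r t z)) Hbar
    (derive1 (r t) z) (derive1n 2 (r t) z).
Proof.
move=> /andP[t0 tT].
have t0T : 0 <= t < T by rewrite ltW.
have rho_smooth : smooth_near `[a, b] (r t).
  exact: (@smooth_near_row R [set t | 0 <= t < T] a b r t t0T (flow_graph_smooth flow)).
have rho_rad z : a <= z <= b -> 0 < r t z /\ ((r t z)%:E < rad S)%E.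
  exact: (flow_graph flow).
have orth := flow_orthogonal flow t0T.
have [N [H [Hbar [HN Hm Hav Hflow]]]] := flow_equation flow t0T.
have HE p : revolution a b (r t) p -> a < p.1 < b ->
    H p = curv_z S G (r t) p.1 + n.-1%:R * curv_u S L (r t) p.1.
  move=> Mp pab; exact: (mean_curvatureE prof rho_smooth rho_rad HN Mp pab (Hm p Mp)).
exists Hbar.
  exact: (average_ge0 prof GL_ge0 n0 ab rho_smooth rho_rad orth HE Hav).
move=> z zab'; have zab : a <= z <= b by case/andP: zab' => *; rewrite !ltW.
pose q0 : pt R n := meridian_pt (r t) n0 z.
have Mq0 : revolution a b (r t) q0 := revolution_meridian_pt n0 rho_rad zab.
have [p0 Mp0 Xp0] : exists2 p, revolution a b rho0 p & X t p = q0.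
  have : (X t @` revolution a b rho0) q0 by rewrite (flow_image flow t0T).
  by move=> [p Mp <-]; exists p.
have [q00 qE r0 rR] := revolution_off rho_rad Mq0.
pose Y s := X s p0.
have Yt : Y t = q0 by [].
have [UX [oUX sUX CUX]] := flow_smooth flow.
have dY : derivable Y t 1.
  have UXt : UX (t, p0) by apply: sUX.
  have [d _] := CUX 1%N (1, 0).
  exact: (derivable_first (d _ UXt)).
pose V : pt R n := (Hbar - H q0) *: normal_field S (r t) q0.
have DY : 'D_1 Y t = V.
  rewrite -derive1E (Hflow p0 Mp0) Xp0.
  by rewrite (outward_unit_normalE rho_smooth rho_rad HN Mq0).
have d1 : is_derive t 1 (fun s => (Y s).1) V.1.
  by rewrite -DY; exact: is_derive_fst.
have den : is_derive t 1 (fun s => enorm (Y s).2) (dot q0.2 V.2 / enorm q0.2).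
  have d := is_derive_dot_self dY; rewrite DY Yt in d.
  have dpos : 0 < dot (Y t).2 (Y t).2 by rewrite Yt lt0r dot_eq0 q00 dot_ge0.
  apply: drv_eq (drv_sqrt d dpos) _.
  rewrite Yt -/(enorm q0.2); field.
  by rewrite enorm_eq0.
have [U [oU sU CU]] := flow_graph_smooth flow.
pose F (q : R * R) := r q.1 q.2.
have Utz : U (t, z) by apply: sU.
have dF q v : U q -> derivable F q v.
  by move=> Uq; have [d _] := CU 1%N v; exact: d.
have cF v : {for (t, z), continuous ('D_v F)}.
  by have [_ c] := CU 1%N v; exact: c.
have dzF : 'D_(0, 1) F (t, z) = derive1 (r t) z.
  by rewrite derive1E; have [_ <-] := is_derive_row (dF (t, z) (0, 1) Utz).
(* [(s, (Y s).1)] is reached from [(s, z)] by a move in the direction [(0, 1)], whose length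
   vanishes at [s = t]. *)
have dchain : is_derive t 1 (fun s => F (s, (Y s).1))
    ('D_(1, 0) F (t, z) + (V.1 - 0) * 'D_(0, 1) F (t, z)).
  have dbase := is_derive_col (dF (t, z) (1, 0) Utz).
  have cbase : {for t, continuous (fun s : R => (s, z))}.
    have -> : (fun s : R => (s, z)) = (fun s : R => (0, z) + s *: (1, 0)).
      by apply/funext => s; rewrite col_line.
    exact: line_continuous.
  have c0 : (Y t).1 - z = 0 by rewrite Yt subrr.
  have dF01 q : U q -> derivable F q (0, 1) by exact: dF.
  have D := @is_derive_add_dir R _ F U (fun s : R => (s, z)) (fun s => (Y s).1 - z)
    (0, 1) t _ _ oU Utz dF01 (cF (0, 1)) cbase c0 (drv_sub d1 (drv_cst z t 1)) dbase.
  have E : (fun s => F (s, (Y s).1)) =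
           (fun s => F ((s, z) + ((Y s).1 - z) *: (0, 1))).
    apply/funext => s.
    have -> // : (s, z) + ((Y s).1 - z) *: (0, 1) = (s, (Y s).1) :> R * R.
    congr pair; rewrite /= /GRing.scale/= ?mulr0 ?addr0// mulr1.
    by rewrite addrC subrK.
  by rewrite E.
(* A two-sided neighbourhood of [t] is needed inside the life span, hence [0 < t]. *)
have EY : \forall s \near t, enorm (Y s).2 = F (s, (Y s).1).
  have : \forall s \near t, 0 < s < T by apply: near_itv; rewrite t0.
  apply: filterS => s /andP[s0 sT]; have s0T : 0 <= s < T by rewrite ltW.
  have : revolution a b (r s) (Y s).
    by rewrite -(flow_image flow s0T); exists p0.
  by move=> [].
have [_ E1] := near_eq_is_derive EY den.
have [_ E2] := dchain.
have Ft : 'D_(1, 0) F (t, z) = dot q0.2 V.2 / enorm q0.2 - V.1 * derive1 (r t) z.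
  by rewrite -dzF -E1 E2 subr0 [V.1 * _]mulrC addrK.
rewrite -[LHS]/('D_(1, 0) F (t, z)) Ft.
have V1 : V.1 = (Hbar - H q0) * normal_z S (r t) z by [].
have V2 : dot q0.2 V.2 / enorm q0.2 = (Hbar - H q0) * normal_r S (r t) z.
  have -> : V.2 = (Hbar - H q0) *: ((normal_r S (r t) z / enorm q0.2) *: q0.2) by [].
  have r00 : enorm q0.2 != 0 by rewrite enorm_eq0.
  by rewrite dotZr [dot q0.2 (_ *: q0.2)]dotZr -enorm_sqr; field.
rewrite V1 V2 (HE q0 Mq0 zab') -[q0.1]/z.
have [s0 f0] := arc_speed_gt0 rho_rad zab.
have sE := arc_speed_sqr S (r t) z.
rewrite /graph_speed.
have -> : Num.sqrt (1 + derive1 (r t) z ^+ 2 / f (r t z) ^+ 2) =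
    arc_speed S (r t) z / f (r t z).
  have -> : 1 + derive1 (r t) z ^+ 2 / f (r t z) ^+ 2 =
      (arc_speed S (r t) z / f (r t z)) ^+ 2.
    by rewrite expr_div_n sE; field; rewrite gt_eqF.
  by rewrite sqrtr_sqr gtr0_norm// divr_gt0.
rewrite -sE /curv_z /curv_u /normal_z /normal_r.
have pE : derive1 (r t) z ^+ 2 = arc_speed S (r t) z ^+ 2 - f (r t z) ^+ 2.
  by rewrite sE; ring.
move: s0 f0 pE.
move: (derive1n 2 (r t) z) (n.-1%:R : R) => Q k.
move: (f (r t z)) (G (r t z)) (L (r t z)) (derive1 (r t) z) (arc_speed S (r t) z) => ff gg ll P s s0 f0 pE.
have -> : Hbar - ((gg * ff - ff * (Q - gg * P ^+ 2) / s ^+ 2) / s + k * (ff / s * ll))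
  = Hbar - (gg * ff / s - ff * (Q - gg * P ^+ 2) / s ^+ 3 + k * ff * ll / s).
  by field; rewrite gt_eqF.
(* [normal_r - P * normal_z] equals [(f^2 + P^2) / (f s) = s / f], the factor between normal and
   radial speed. *)
set W := Hbar - _.
transitivity (W * (ff ^+ 2 + P ^+ 2) / (ff * s)).
  by field; rewrite !gt_eqF.
rewrite /W pE; field.
by rewrite !gt_eqF.
Qed.

End GraphEquation.

Section GraphFlow.
Context {R : realType} {n : nat} (S : rotsym R n) (G G1 L L1 : R -> R).
Hypothesis prof : log_profile S G G1 L L1.
Hypothesis GL_ge0 : forall r, 0 < r -> (r%:E < rad S)%E -> 0 <= G r /\ 0 <= L r.
Hypothesis n0 : (0 < n)%N.
Local Notation f := (fz S).
Local Notation h := (hu S).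
Context (a b : R) (rho0 : R -> R) (T : R) (X : R -> pt R n -> pt R n)
  (r : R -> R -> R).
Hypothesis ab : a < b.
Hypothesis flow : vpmc_flow S a b rho0 T X r.

Local Notation F := (fun q : R * R => r q.1 q.2).
Local Notation dx E := ('D_((0 : R), (1 : R)) (E : R * R -> R)).
Local Notation dt E := ('D_((1 : R), (0 : R)) (E : R * R -> R)).

Lemma derive1_rowE (E : R * R -> R) t z :
  derive1 (fun y => E (t, y)) z = dx E (t, z).
Proof. by rewrite derive1E row_lineE derive_line scale1r row_line. Qed.

Lemma derive1n_rowE t z :
  derive1 (r t) z = dx F (t, z) /\ derive1n 2 (r t) z = dx (dx F) (t, z).
Proof.
have E1 y : derive1 (r t) y = dx F (t, y) by rewrite -(derive1_rowE F t y).
split; first exact: E1.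
have -> : derive1n 2 (r t) = derive1 (fun y => dx F (t, y)).
  by rewrite /derive1n /=; congr derive1; apply/funext.
by rewrite -(derive1_rowE (dx F) t z).
Qed.

(* [sg = -1] reflects the generating curve in [z], so that a decreasing
   curve becomes an increasing one. *)
Lemma graph_flow_of_flow (sg al be t0 : R) : sg ^+ 2 = 1 -> 0 < t0 ->
  (forall x, al <= x <= be -> a < sg * x < b) ->
  (forall t x, t0 <= t < T -> al <= x <= be -> 0 < sg * dx F (t, sg * x)) ->
  exists Hb : R -> R, graph_flow n.-1%:R f G L al be t0 T
    (fun t x => r t (sg * x)) (fun t x => sg * dx F (t, sg * x))
    (fun t x => dx (dx F) (t, sg * x)) (fun t x => sg * dx (dx (dx F)) (t, sg * x))
    (fun t x => dt F (t, sg * x)) (fun t x => sg * dt (dx F) (t, sg * x)) Hb.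
Proof.
move=> sg2 t00 win pos.
have [U [oU sU CU]] := flow_graph_smooth flow.
have tU t x : t0 <= t < T -> al <= x <= be -> U (t, sg * x).
  by move=> tT /win xab; apply: sU => /=; split; lra.

have Cx k : Ck k U (dx F) by have [_ c1] := CU k.+1 (0, 1).
have Cxx k : Ck k U (dx (dx F)) by have [_ c1] := Cx k.+1 (0, 1).
have Ct k : Ck k U (dt F) by have [_ c1] := CU k.+1 (1, 0).
have der (E : R * R -> R) v q : (forall k, Ck k U E) -> U q -> derivable E q v.
  by move=> /(_ 1%N v)[+ _]; apply.
have dsg (x : R) : is_derive x 1 (fun y => sg * y) sg.
  by apply: drv_eq (drv_scale sg (drv_id x)) _; rewrite mulr1.
have dE (E : R * R -> R) t x : (forall k, Ck k U E) -> U (t, sg * x) ->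
    is_derive x 1 (fun y => E (t, sg * y)) (sg * dx E (t, sg * x)).
  move=> CE Uq.
  apply: drv_eq (drv_comp (is_derive_row (der E _ _ CE Uq)) (dsg x)) _.
  by rewrite mulrC.
have dEt (E : R * R -> R) t x : (forall k, Ck k U E) -> U (t, sg * x) ->
    is_derive t 1 (fun s => E (s, sg * x)) (dt E (t, sg * x)).
  by move=> CE Uq; exact: is_derive_col (der E _ _ CE Uq).
have cE (E : R * R -> R) t x : (forall k, Ck k U E) -> U (t, sg * x) ->
    {for (t, x), continuous (fun q : R * R => E (q.1, sg * q.2))}.
  move=> CE Uq; apply: (@continuous_comp _ _ _ (fun q : R * R => (q.1, sg * q.2)) E).
    have c1 : fst q @[q --> ((t, x) : R * R)] --> t by exact: cvg_fst.
    have c2 : sg * snd q @[q --> ((t, x) : R * R)] --> sg * x.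
      by apply: cvgM; [exact: cvg_cst|exact: cvg_snd].
    exact: (cvg_pair c1 c2).
  exact: (CE 0%N).
(* Outside []0, T[] the value 0 is a mere default, so that a function of all real times can be
   chosen. *)
have : forall t : R, exists Hbar : R, 0 < t < T -> 0 <= Hbar /\ forall z, a < z < b ->
    dt F (t, z) = graph_speed n.-1%:R (f (r t z)) (G (r t z)) (L (r t z)) Hbar
      (derive1 (r t) z) (derive1n 2 (r t) z).
  move=> t; have [tT|nT] := pselect (0 < t < T); last by exists 0.
  have [Hbar H0 HE] := graph_equation prof GL_ge0 n0 ab flow tT.
  by exists Hbar.
move=> /choice[Hb HbP]; exists Hb; split.
- move=> t x tT xab; split; last exact: pos.
  by have [] := flow_graph flow (t := t) (z := sg * x); [lra|have := win x xab; lra|].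
- move=> t x tT xab; have Uq := tU t x tT xab; split.
  + exact: (dE F).
  + apply: drv_eq (drv_scale sg (dE (dx F) t x Cx Uq)) _.
    by rewrite mulrA -expr2 sg2 mul1r.
  + exact: dE.
- move=> t x tT xab; have Uq := tU t x tT xab; split; first exact: (dEt F).
  exact: drv_scale (dEt (dx F) t x Cx Uq).
- move=> t x tT xab; have Uq := tU t x tT xab.
  have c1 : {for (t, sg * x), continuous (dx (dt F))}.
    by have [_ c] := Ct 1%N (0, 1); exact: c.
  have c2 : {for (t, sg * x), continuous (dt (dx F))}.
    by have [_ c] := Cx 1%N (1, 0); exact: c.
  have dU q : U q -> [/\ derivable F q (1, 0), derivable F q (0, 1),
      derivable (dt F) q (0, 1) & derivable (dx F) q (1, 0)].
    by move=> qU; split; [exact: der|exact: der|exact: der|exact: der].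
  have sw := @derive_comm R _ F U (t, sg * x) (1, 0) (0, 1) oU Uq dU c1 c2.
  by rewrite -sw; exact: dE.
- move=> t x tT xab.
  have t0T : 0 < t < T by lra.
  have [_ /(_ _ (win x xab)) ->] := HbP t t0T.
  have [-> ->] := derive1n_rowE t (sg * x).
  by rewrite /graph_speed exprMn sg2 mul1r.
- move=> t x tT xab; have Uq := tU t x tT xab; split; first exact: (cE F).
  have c := cE (dx F) t x Cx Uq.
  by apply: cvgM; [exact: cvg_cst|exact: c].
- move=> t tT; have t0T : 0 < t < T by lra.
  by have [] := HbP t t0T.
Qed.

End GraphFlow.

(** * Critical points *)

Section CriticalPoints.
Context {R : realType}.

(** The uniform margin lets [[c, d]] be enlarged to an interval that still avoids all limit points,
    which leaves room for the bump to vanish. *)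
Lemma finite_gap (k : nat) (x : 'I_k -> R) (c d : R) :
  (forall i, x i \notin `[c, d]) ->
  exists2 e : R, 0 < e & forall i, x i < c - e \/ d + e < x i.
Proof.
move=> xcd.
suff [e e0 eP] : exists2 e : R, 0 < e &
    forall i, i \in enum 'I_k -> x i < c - e \/ d + e < x i.
  by exists e => // i; apply: eP; rewrite mem_enum.
elim: (enum 'I_k) => [|i s [e e0 eP]]; first by exists 1.
have [e' e'0 e'P] : exists2 e' : R, 0 < e' & x i < c - e' \/ d + e' < x i.
  have := xcd i; rewrite in_itv/= negb_and -!ltNge => /orP[h|h].
    by exists ((c - x i) / 2); [|left]; lra.
  by exists ((x i - d) / 2); [|right]; lra.
exists (Num.min e e'); first by rewrite lt_min e0.
have m1 : Num.min e e' <= e by rewrite ge_min lexx.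
have m2 : Num.min e e' <= e' by rewrite ge_min lexx orbT.
move=> j; rewrite inE => /orP[/eqP ->|/eP[h|h]].
- by case: e'P => h; [left|right]; lra.
- by left; lra.
- by right; lra.
Qed.

(** Each of the finitely many extrema converges to a point outside [[al, be]], so all of them have
    left it from some common time on. *)
Lemma enumerates_avoid (P : (R -> R) -> R -> Prop) (a b t1 T al be : R)
    (r : R -> R -> R) (k : nat) (xi : 'I_k -> R -> R) (xiT : 'I_k -> R) :
  enumerates P a b t1 T r xi xiT ->
  (forall i, xiT i < al \/ be < xiT i) ->
  exists2 t2 : R, t2 < T & forall t z, t2 < t < T -> t1 <= t ->
    al <= z <= be -> a < z < b -> ~ P (r t) z.
Proof.
move=> [_ xiE _ xicv] xiab.
suff [t2 t2T tP] : exists2 t2 : R, t2 < T & forall i, i \in enum 'I_k ->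
    forall t, t2 < t < T -> xi i t < al \/ be < xi i t.
  exists t2 => // t z tT t1t zab z_ab Pz.
  have : (range (fun i => xi i t)) z.
    by rewrite -xiE//; case/andP: tT => _ ->; rewrite t1t.
  move=> [i _ iz]; have := tP i _ t tT; rewrite mem_enum iz => /(_ isT).
  by lra.
elim: (enum 'I_k) => [|i s [t2 t2T tP]]; first by exists (T - 1) => //; lra.
have [t3 t3T tP3] : exists2 t3 : R, t3 < T &
    forall t, t3 < t < T -> xi i t < al \/ be < xi i t.
  have aux (e : R) : 0 < e -> exists2 t3 : R, t3 < T &
      forall t, t3 < t < T -> `|xiT i - xi i t| < e.
    move=> e0; have /cvgrPdist_lt /(_ e e0) := xicv i.
    move=> /nbhs_ballP[d/= d0 dP]; exists (T - d); first by lra.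
    move=> t /andP[td tT]; apply: dP => //.
    by rewrite -ball_normE/= gtr0_norm; lra.
  case: (xiab i) => h.
    have [|t3 t3T tP3] := aux (al - xiT i); first by lra.
    by exists t3 => // t /tP3; rewrite ltr_norml; left; lra.
  have [|t3 t3T tP3] := aux (xiT i - be); first by lra.
  by exists t3 => // t /tP3; rewrite ltr_norml; right; lra.
exists (Num.max t2 t3); first by rewrite gt_max t2T.
move=> j; rewrite inE => js t /andP[]; rewrite gt_max => /andP[t2t t3t] tT.
case/orP: js => [/eqP ->|js]; first by apply: tP3; rewrite t3t.
by apply: tP js _ _; rewrite t2t.
Qed.

(** Turns a zero of the slope into one of the enumerated extrema, through the second derivative
    test. *)
Lemma nondegenerate_extremum (a b z : R) (rho : R -> R) :
  smooth_near `[a, b] rho -> a < z < b -> derive1 rho z = 0 ->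
  derive1n 2 rho z <> 0 -> local_min rho z \/ local_max rho z.
Proof.
move=> rs zab r1 r2.
have d y : a < y < b -> is_derive y 1 rho (derive1 rho y) /\
    is_derive y 1 (derive1 rho) (derive1n 2 rho y).
  move=> /andP[ay yb]; have yab : a <= y <= b by rewrite !ltW.
  exact: (rho_derivatives rs yab).
have near_of (e : R) (Q : R -> Prop) : 0 < e ->
    (forall y, `|y - z| < e -> Q y) -> \forall y \near z, Q y.
  move=> e0 H; apply/nbhs_ballP; exists e => //= y.
  by rewrite -ball_normE/= distrC; exact: H.
have /orP[r2n|r2p] : (derive1n 2 rho z < 0) || (0 < derive1n 2 rho z).
  by rewrite -neq_lt; apply/eqP.
- right.
  have dN y : a < y < b -> is_derive y 1 (fun y => - rho y) (- derive1 rho y).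
    by move=> /d[d1 _]; exact: drv_opp.
  have [_ d2] := d z zab.
  have [||e e0 eP] := second_derive_pos zab dN (drv_opp d2).
  + by rewrite r1 oppr0.
  + by rewrite oppr_gt0.
  apply: (near_of e) => // y ye; have [->//|yz] := eqVneq y z.
  by have := eP y ye yz; rewrite ltrN2 => /ltW.
- left.
  have d1 y : a < y < b -> is_derive y 1 rho (derive1 rho y) by move=> /d[].
  have [_ d2] := d z zab.
  have [e e0 eP] := second_derive_pos zab d1 d2 r1 r2p.
  apply: (near_of e) => // y ye; have [->//|yz] := eqVneq y z.
  by have := eP y ye yz => /ltW.
Qed.

Lemma continuous_sign (g : R -> R) (x y : R) :
  (forall z, Num.min x y <= z <= Num.max x y -> {for z, continuous g}) ->
  (forall z, Num.min x y <= z <= Num.max x y -> g z != 0) ->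
  0 < g x -> 0 < g y.
Proof.
move=> cg g0 gx.
have mM : Num.min x y <= Num.max x y by rewrite ge_min !le_max lexx.
rewrite ltNge; apply/negP => gy.
have [||z] := @IVT R g (Num.min x y) (Num.max x y) 0 mM.
- apply: continuous_in_subspaceT => z; rewrite inE/= in_itv/=; exact: cg.
- by rewrite ge_min le_max; case: (leP x y) => _; rewrite gy (ltW gx) ?orbT.
by rewrite in_itv/= => zxy gz; have := g0 z zxy; rewrite gz eqxx.
Qed.

End CriticalPoints.

Section SlopeSign.
Context {R : realType}.

(** The sign is read off at [(t3, c)], carried along [z = c] in time and then along [z] at fixed
    time; continuity in each variable separately suffices. *)
Lemma slope_sign (p : R -> R -> R) (t3 T al be c : R) : al <= c <= be -> t3 < T ->
  (forall t z, t3 <= t < T -> al <= z <= be ->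
     [/\ {for z, continuous (p t)}, {for t, continuous (p^~ z)} & p t z != 0]) ->
  exists2 sg : R, sg = 1 \/ sg = -1 &
    forall t z, t3 <= t < T -> al <= z <= be -> 0 < sg * p t z.
Proof.
move=> cab t3T H.
have t33 : t3 <= t3 < T by rewrite lexx.
have [sg sgE sg0] : exists2 sg : R, sg = 1 \/ sg = -1 & 0 < sg * p t3 c.
  have [_ _] := H t3 c t33 cab; rewrite neq_lt => /orP[h|h].
    by exists (-1); [right|lra].
  by exists 1; [left|lra].
exists sg => // t z tT zab.
have sgn0 : sg != 0 by case: sgE => ->; rewrite ?oppr_eq0 oner_neq0.
have mulc (g : R -> R) (y : R) : {for y, continuous g} ->
    {for y, continuous (fun x => sg * g x)}.
  by move=> cg; apply: cont_mul cg; exact: cst_continuous.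
have /andP[t3t tT'] := tT.
have step1 : 0 < sg * p t c.
  apply: (@continuous_sign R (fun s => sg * p s c) t3 t) => // s.
  - rewrite (min_l t3t) (max_r t3t) => /andP[t3s st].
    have sT : t3 <= s < T by rewrite t3s (le_lt_trans st).
    by apply: (mulc (p^~ c)); have [] := H s c sT cab.
  - rewrite (min_l t3t) (max_r t3t) => /andP[t3s st].
    have sT : t3 <= s < T by rewrite t3s (le_lt_trans st).
    by rewrite mulf_neq0//; have [] := H s c sT cab.
have win y : Num.min c z <= y <= Num.max c z -> al <= y <= be.
  by case: (leP c z) => _; lra.
apply: (@continuous_sign R (fun y => sg * p t y) c z) => // y /win yab.
- by apply: mulc; have [] := H t y tT yab.
- by rewrite mulf_neq0//; have [] := H t y tT yab.
Qed.

Lemma signed_monotone (g g' : R -> R) (sg x y : R) : x <= y ->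
  (forall z, x <= z <= y -> is_derive z 1 g (g' z) /\ 0 < sg * g' z) ->
  0 <= sg * (g y - g x).
Proof.
move=> xy H; have [z|| z zxy ->] := @MVT_segment R g g' x y xy.
- by rewrite in_itv/= => zxy; have [] := H z ltac:(lra).
- apply: derivable_within_continuous => z; rewrite in_itv/= => zxy.
  by have [[]] := H z zxy.
have [_ h] := H z zxy.
by rewrite mulrA mulr_ge0 ?subr_ge0// ltW.
Qed.

End SlopeSign.

(** * Choice of the interval, the direction and the initial time *)

Unset Implicit Arguments.

Theorem theorem10 (R : realType) (n : nat) (hn : (2 <= n)%N)
  (S : rotsym R n) (a b : R) (rho0 : R -> R) (hM : RSS2 S a b rho0)
  (T : R) (hT : 0 < T) (X : R -> pt R n -> pt R n) (r : R -> R -> R)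
  (hX : maximal_vpmc_flow S a b rho0 T X r)
  (t1 : R) (ht1 : 0 <= t1 < T)
  (hcrit : nondegenerate_critical a b t1 T r)
  (k : nat) (xi : 'I_k -> R -> R) (xiT : 'I_k -> R)
  (hxi : enumerates local_min a b t1 T r xi xiT)
  (l : nat) (eta : 'I_l -> R -> R) (etaT : 'I_l -> R)
  (heta : enumerates local_max a b t1 T r eta etaT)
  (c d : R) (hcd : c <= d) (hsub : `[c, d] `<=` `[a, b])
  (hac : a \notin `[c, d]) (hbd : b \notin `[c, d])
  (hxiT : forall i, xiT i \notin `[c, d])
  (hetaT : forall i, etaT i \notin `[c, d]) :
  exists delta t2 : R, [/\ 0 < delta, 0 <= t2 < T &
    forall t z, t2 < t < T -> c <= z <= d -> delta <= r t z].
Proof.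
have [[ab abJ _ _ _] curved] := hM; have [flow _] := hX.
have n0 : (0 < n)%N by exact: ltnW.
have zJ : zdom S a by apply: abJ; rewrite /= in_itv/= lexx ltW.
have [G [G1 [L [L1 [sig0 [C [prof ax axR]]]]]]] := log_profile_exists hn zJ.
have GL := log_profile_ge0 prof ax axR curved.
have ac : a < c.
  have : `[a, b]%classic c by apply: hsub; rewrite /= in_itv/= lexx.
  rewrite /= in_itv/= => /andP[acle _]; rewrite lt_neqAle acle andbT.
  by apply/eqP => E; move: hac; rewrite E in_itv/= lexx hcd.
have db : d < b.
  have : `[a, b]%classic d by apply: hsub; rewrite /= in_itv/= hcd lexx.
  rewrite /= in_itv/= => /andP[_ dble]; rewrite lt_neqAle dble andbT.
  by apply/eqP => E; move: hbd; rewrite -E in_itv/= lexx hcd.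
have [e1 e10 e1P] := finite_gap hxiT; have [e2 e20 e2P] := finite_gap hetaT.
(* Half the distances to [a] and [b] keep the enlarged interval inside []a, b[], where the evolution
   equation holds. *)
pose e := Num.min (Num.min e1 e2) (Num.min ((c - a) / 2) ((b - d) / 2)).
have e0 : 0 < e by rewrite !lt_min e10 e20 !divr_gt0 ?subr_gt0.
have [ee1 ee2 eca ebd] : [/\ e <= e1, e <= e2, e <= (c - a) / 2 & e <= (b - d) / 2].
  by rewrite /e !ge_min !lexx ?orbT.
have [al [be [alE beE]]] : exists al be : R, al = c - e /\ be = d + e.
  by exists (c - e), (d + e).
have win z : al <= z <= be -> a < z < b by clear -alE beE eca ebd ac db; lra.
have alc : al < c by clear -alE e0; lra.
have dbe : d < be by clear -beE e0; lra.
have albe : al < be by clear -alc dbe hcd; lra.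
clearbody e.
have [s1 s1T s1P] : exists2 t2 : R, t2 < T & forall t z, t2 < t < T -> t1 <= t ->
    al <= z <= be -> a < z < b -> ~ local_min (r t) z.
  apply: enumerates_avoid hxi _ => i.
  by case: (e1P i) => h; [left|right]; clear -h alE beE ee1; lra.
have [s2 s2T s2P] : exists2 t2 : R, t2 < T & forall t z, t2 < t < T -> t1 <= t ->
    al <= z <= be -> a < z < b -> ~ local_max (r t) z.
  apply: enumerates_avoid heta _ => i.
  by case: (e2P i) => h; [left|right]; clear -h alE beE ee2; lra.
have /andP[t10 t1T] := ht1.
pose t3 := (Num.max t1 (Num.max s1 s2) + T) / 2.
have mT : Num.max t1 (Num.max s1 s2) < T by rewrite !gt_max t1T s1T.
have [m1 m2 m3] : [/\ t1 <= Num.max t1 (Num.max s1 s2),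
    s1 <= Num.max t1 (Num.max s1 s2) & s2 <= Num.max t1 (Num.max s1 s2)].
  by rewrite !le_max !lexx !orbT.
have [t3T t13 s13 s23] : [/\ t3 < T, t1 < t3, s1 < t3 & s2 < t3].
  by rewrite /t3; move: mT m1 m2 m3; clear; split; lra.
clearbody t3; clear mT m1 m2 m3.
have t30 : 0 < t3 := le_lt_trans t10 t13.
have [U [oU sU CU]] := flow_graph_smooth flow.
pose F (q : R * R) := r q.1 q.2.
pose p t z := 'D_(0, 1) F (t, z).
have Cp : Ck 0 U ('D_(0, 1) F) by have [_] := CU 1%N (0, 1).
have tzU t z : t3 <= t < T -> al <= z <= be -> U (t, z).
  move=> /andP[tt tT] /win/andP[az zb]; apply: sU => /=.
  by rewrite tT !ltW//; exact: lt_le_trans tt.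
have pE t z : p t z = derive1 (r t) z.
  by have [->] := derive1n_rowE r t z.
have smooth_r t : t3 <= t < T -> smooth_near `[a, b] (r t).
  move=> /andP[tt tT].
  have t0T : 0 <= t < T by rewrite tT andbT ltW//; exact: lt_le_trans tt.
  exact: (@smooth_near_row R [set t | 0 <= t < T] a b r t t0T (flow_graph_smooth flow)).
have p_cont_ne0 t z : t3 <= t < T -> al <= z <= be ->
    [/\ {for z, continuous (p t)}, {for t, continuous (p^~ z)} & p t z != 0].
  move=> tT zab; have /= cpt := Cp _ (tzU t z tT zab).
  split.
  - exact: cont_row cpt.
  - exact: cont_col cpt.
  (* A zero of the slope would be nondegenerate, hence a local minimum or maximum, and the
     enumerated ones have left [[al, be]] by the time [t3]. *)
  - rewrite pE; apply/eqP => r1.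
    have /andP[tt tT'] := tT.
    have [m mP] := hcrit.
    have t1t : t1 <= t := ltW (lt_le_trans t13 tt).
    have [_ /(_ z)] := mP t ltac:(by rewrite t1t).
    have zab' := win z zab.
    have zle : a <= z <= b by case/andP: zab' => *; rewrite !ltW.
    move=> /(_ zle r1) r2.
    case: (nondegenerate_extremum (smooth_r t tT) zab' r1 r2).
      apply: s1P => //; rewrite tT' andbT; exact: lt_le_trans tt.
    apply: s2P => //; rewrite tT' andbT; exact: lt_le_trans tt.
have cab : al <= c <= be by rewrite !ltW//; exact: le_lt_trans dbe.
have [sg sgE sgp] := slope_sign cab t3T p_cont_ne0.
have sg2 : sg ^+ 2 = 1 by case: sgE => ->; rewrite ?sqrrN expr1n.
have mono t x y : t3 <= t < T -> al <= x -> x <= y -> y <= be ->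
    0 <= sg * (r t y - r t x).
  move=> tT alx xy ybe; apply: (signed_monotone (g' := p t) xy) => z /andP[xz zy].
  have zab : al <= z <= be by rewrite (le_trans alx xz) (le_trans zy ybe).
  split; last exact: sgp.
  rewrite pE; have := smooth_near_derive1 0 (smooth_r t tT); apply.
  by have /andP[az zb] := win z zab; rewrite !ltW.
(* By monotonicity it is enough to bound [r t] at one end of [[c, d]]: [c] if the curve increases,
   and [d], which becomes [- d] after reflection, if it decreases. *)
have [al' [be' [x0 [w1 w2 w3]]]] : exists al' be' x0 : R,
    [/\ al' < x0 < be', forall x, al' <= x <= be' -> al <= sg * x <= be
      & forall t z, t3 <= t < T -> c <= z <= d -> r t (sg * x0) <= r t z].
  case: sgE => sgE; rewrite sgE in mono *.
    exists al, be, c; split.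
    - by rewrite alc (le_lt_trans hcd dbe).
    - by move=> x; rewrite mul1r.
    - move=> t z tT /andP[cz zd]; rewrite mul1r -subr_ge0.
      have := mono t c z tT (ltW alc) cz (le_trans zd (ltW dbe)).
      by rewrite mul1r.
  exists (- be), (- al), (- d); split.
  - by rewrite !ltrN2 dbe (lt_le_trans alc hcd).
  - by move=> x; clear; lra.
  - move=> t z tT /andP[cz zd]; rewrite mulrNN mul1r -subr_ge0.
    have := mono t z d tT (le_trans (ltW alc) cz) zd (ltW dbe).
    by rewrite mulN1r opprB.
pose K := barrier_rate (n.-1%:R : R) (18 / (be' - al') ^+ 2) C (2 / sig0).
have /andP[sig00 sig01] := axis_rho0 ax.
(* Chosen so that [K * (T - t0) <= sig0 / 2]; the denominator [|K| + 1] is positive whatever the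
   sign of [K]. *)
pose t0 := Num.max t3 (T - sig0 / (2 * (`|K| + 1))).
have K10 : 0 < `|K| + 1 by rewrite ltr_wpDl.
have t0T : t0 < T.
  by rewrite gt_max t3T gtrBl divr_gt0// mulr_gt0.
have t3t0 : t3 <= t0 by rewrite le_max lexx.
have Kt0 : K * (T - t0) <= sig0 / 2.
  have h : T - t0 <= sig0 / (2 * (`|K| + 1)).
    have : T - sig0 / (2 * (`|K| + 1)) <= t0 by rewrite le_max lexx orbT.
    by clear; lra.
  apply: le_trans (_ : (`|K| + 1) * (sig0 / (2 * (`|K| + 1))) <= _).
    apply: le_trans (_ : (`|K| + 1) * (T - t0) <= _).
      rewrite ler_wpM2r ?subr_ge0 ?(ltW t0T)//.
      by have := ler_norm K; clear; lra.
    by rewrite ler_wpM2l// ltW.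
  rewrite le_eqVlt; apply/orP; left; apply/eqP; field.
  by rewrite gt_eqF.
have t00 : 0 < t0 := lt_le_trans t30 t3t0.
have win' x : al' <= x <= be' -> a < sg * x < b by move=> /w2/win.
have pos' t x : t0 <= t < T -> al' <= x <= be' -> 0 < sg * 'D_(0, 1) F (t, sg * x).
  move=> /andP[t0t tT] /w2 sx; apply: sgp => //.
  by rewrite tT (le_trans t3t0 t0t).
have [Hb gf] := graph_flow_of_flow prof GL n0 ab flow sg2 t00 win' pos'.
have k0 : (0 : R) <= n.-1%:R by exact: ler0n.
have [delta delta0 deltaP] := graph_flow_lower_bound k0 w1 t0T ax gf Kt0.
exists delta, t0; split=> //; first by rewrite (ltW t00).
move=> t z /andP[t0t tT] zcd.
have tt : t0 <= t < T by rewrite tT ltW.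
apply: le_trans (deltaP t tt) _; apply: w3 => //.
by rewrite tT (le_trans t3t0 (ltW t0t)).
Qed.
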